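(* Let $\mathcal A,\mathcal A'$ be odd generic systems of 4-cycle algebras with direct limits (operator algebra limits) $A=\varinjlim\mathcal A$, $A'=\varinjlim\mathcal A'$ respectively. Then $A$ and $A'$ are star extendibly isomorphic if and only if $\mathcal A$ and $\mathcal A'$ are regularly isomorphic.
   Context: 4-cycle algebras. For positive integers $n_1,\dots,n_4$ with $r=\sum n_i$, the 4-cycle algebra with these block sizes is the algebra $A\subseteq M_r(\mathbb C)$ of block matrices $(a_{ij})$, $a_{ij}\in M_{n_i,n_j}(\mathbb C)$, with $a_{ij}=0$ unless $i=j$ or ($i\in\{1,2\}$, $j\in\{3,4\}$). $Q_1,\dots,Q_4$ denote the block projections. $C^*(A)=M_r(\mathbb C)$. An embedding (injective homomorphism) $\phi:A\to A'$ is star extendible if it extends to a $*$-homomorphism $C^*(A)\to C^*(A')$; its multiplicity is that of the extension. It is regular if it is a direct sum (sum with mutually orthogonal ranges) of multiplicity one star extendible embeddings. A multiplicity one star extendible embedding is rigid of type $\theta$ if $\theta$ is a permutation of $\{1,2,3,4\}$ preserving $\{1,2\}$ and $\{3,4\}$ and $\phi(Q_iAQ_j)\subseteq Q'_{\theta(i)}A'Q'_{\theta(j)}$ for all $i,j$ (four types: $\mathrm{id},(12),(34),(12)(34)$). A rigid embedding is a sum of multiplicity one rigid embeddings with mutually orthogonal ranges; it is generic if all four types occur. A generic system is a direct system $\mathcal A=(A_k,\alpha_k)$ of 4-cycle algebras with all $\alpha_k$ generic; it is odd if only finitely many $\alpha_k$ have even multiplicity. Its operator algebra limit is the norm closed direct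 limit inside the C*-algebra $\varinjlim C^*(A_k)$. A star extendible isomorphism of such limits is an isomorphism extending to a $*$-isomorphism of the generated C*-algebras. Two systems are regularly isomorphic if there are subsequences and regular star extendible crossover embeddings $A_{n_1}\to A'_{m_1}\to A_{n_2}\to A'_{m_2}\to\cdots$ such that the composition of any two consecutive crossover maps is the given embedding $A_{n_i}\to A_{n_{i+1}}$ or $A'_{m_i}\to A'_{m_{i+1}}$. *)

(* Defs.v *)
From HB Require Import structures.
From mathcomp Require Import all_boot all_order all_algebra perm spectral.
From mathcomp Require Import complex.
From mathcomp Require Import all_classical all_reals all_analysis.

Set Implicit Arguments.
Unset Strict Implicit.
Unset Printing Implicit Defensive.

Import Order.TTheory GRing.Theory Num.Theory.
Import numFieldNormedType.Exports.

Local Open Scope classical_set_scope.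
Local Open Scope ring_scope.
Local Open Scope sesquilinear_scope.

(* Star algebras are not assumed unital: the connecting maps below need not
   preserve units, so the limit C*-algebras may fail to have one. *)
HB.mixin Record Lmodule_isStarAlgebra (C : numClosedFieldType) B
    of GRing.Lmodule C B := {
  amul : B -> B -> B;
  adj : B -> B;
  amulA : associative amul;
  amulPl : forall (c : C) (x y z : B),
    amul (c *: x + y) z = c *: amul x z + amul y z;
  amulPr : forall (c : C) (x y z : B),
    amul z (c *: x + y) = c *: amul z x + amul z y;
  adjK : involutive adj;
  adjP : forall (c : C) (x y : B), adj (c *: x + y) = c^* *: adj x + adj y;
  adjM : forall x y : B, adj (amul x y) = amul (adj y) (adj x)
}.

#[short(type="starAlgType")]
HB.structure Definition StarAlgebra (C : numClosedFieldType) :=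
  {B of GRing.Lmodule C B & Lmodule_isStarAlgebra C B}.

HB.mixin Record StarAlgebra_isCstarAlgebra (C : numClosedFieldType) B
    of StarAlgebra C B & CompleteNormedModule C B := {
  norm_amul : forall x y : B, `|amul x y| <= `|x| * `|y|;
  norm_cstar : forall x : B, `|amul (adj x) x| = `|x| ^+ 2
}.

#[short(type="cstarAlgType")]
HB.structure Definition CstarAlgebra (C : numClosedFieldType) :=
  {B of StarAlgebra C B & CompleteNormedModule C B
      & StarAlgebra_isCstarAlgebra C B}.

Lemma mx_adjK (C : numClosedFieldType) r :
  involutive (fun x : 'M[C]_r => x^t*).
Proof. exact: trmxCK. Qed.

Lemma mx_adjP (C : numClosedFieldType) r (c : C) (x y : 'M[C]_r) :
  (c *: x + y)^t* = c^* *: x^t* + y^t*.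
Proof. by apply/matrixP => i j; rewrite !mxE rmorphD rmorphM. Qed.

Lemma mx_adjM (C : numClosedFieldType) r (x y : 'M[C]_r) :
  (x *m y)^t* = y^t* *m x^t*.
Proof. by rewrite trmx_mul map_mxM. Qed.

Lemma mx_amulPl (C : numClosedFieldType) r (c : C) (x y z : 'M[C]_r) :
  (c *: x + y) *m z = c *: (x *m z) + y *m z.
Proof. by rewrite mulmxDl scalemxAl. Qed.

Lemma mx_amulPr (C : numClosedFieldType) r (c : C) (x y z : 'M[C]_r) :
  z *m (c *: x + y) = c *: (z *m x) + z *m y.
Proof. by rewrite mulmxDr scalemxAr. Qed.

HB.instance Definition _ (C : numClosedFieldType) (r : nat) :=
  Lmodule_isStarAlgebra.Build C 'M[C]_r (@mulmxA C r r r r) (@mx_amulPl C r)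
    (@mx_amulPr C r) (@mx_adjK C r) (@mx_adjP C r) (@mx_adjM C r).

(* Maps defined only on a subset are total functions whose values off that
   subset are irrelevant. *)
Definition alg_hom_on (C : numClosedFieldType) (B B' : starAlgType C)
    (D : set B) (f : B -> B') : Prop :=
  (forall (c : C) x y, D x -> D y -> f (c *: x + y) = c *: f x + f y) /\
  (forall x y, D x -> D y -> f (amul x y) = amul (f x) (f y)).

Definition star_hom_on (C : numClosedFieldType) (B B' : starAlgType C)
    (D : set B) (f : B -> B') : Prop :=
  alg_hom_on D f /\ (forall x, D x -> f (adj x) = adj (f x)).

Definition star_hom (C : numClosedFieldType) (B B' : starAlgType C)
    (f : B -> B') : Prop := star_hom_on setT f.

(* Block sizes are indexed by 'I_4 = {0,1,2,3} in place of {1,2,3,4}. *)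
Definition sizes := 'I_4 -> nat.

Notation blockmx C n := 'M[C]_(\sum_(i < 4) n i).

Definition fourCycle (C : numClosedFieldType) (n : sizes) :
    set (blockmx C n) :=
  [set x | forall i j : 'I_4, ~~ [|| i == j | (i < 2)%N && (2 <= j)%N] ->
     submxblock x i j = 0].
Arguments fourCycle C n : clear implicits.

Definition blockproj (C : numClosedFieldType) (n : sizes) (i : 'I_4) :
    blockmx C n :=
  \mxdiag_(k < 4) (if k == i then 1%:M else 0 : 'M[C]_(n k)).

Definition embedding (C : numClosedFieldType) (n n' : sizes)
    (phi : blockmx C n -> blockmx C n') : Prop :=
  [/\ set_fun (fourCycle C n) (fourCycle C n') phi,
      alg_hom_on (fourCycle C n) phi &
      set_inj (fourCycle C n) phi].

(* [Phi] is an extension of [phi] to the generated C*-algebras, which are the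
   full matrix algebras. *)
Definition star_extension (C : numClosedFieldType) (n n' : sizes)
    (phi Phi : blockmx C n -> blockmx C n') : Prop :=
  star_hom Phi /\ (forall x, fourCycle C n x -> Phi x = phi x).

Definition star_ext_embedding (C : numClosedFieldType) (n n' : sizes)
    (phi : blockmx C n -> blockmx C n') : Prop :=
  embedding phi /\ exists Phi, star_extension phi Phi.

(* Phi is unitarily equivalent to x |-> x (+) ... (+) x (+) 0 with m summands;
   the V a are the isometries onto the m copies of the domain space. *)
Definition star_hom_multiplicity (C : numClosedFieldType) (r r' : nat)
    (Phi : 'M[C]_r -> 'M[C]_r') (m : nat) : Prop :=
  exists V : 'I_m -> 'M[C]_(r', r),
    (forall a b, (V a)^t* *m V b = if a == b then 1%:M else 0) /\
    (forall x, Phi x = \sum_(a < m) V a *m x *m (V a)^t*).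

Definition multiplicity (C : numClosedFieldType) (n n' : sizes)
    (phi : blockmx C n -> blockmx C n') (m : nat) : Prop :=
  exists2 Phi, star_extension phi Phi & star_hom_multiplicity Phi m.

Definition mult_one_embedding (C : numClosedFieldType) (n n' : sizes)
    (phi : blockmx C n -> blockmx C n') : Prop :=
  star_ext_embedding phi /\ multiplicity phi 1.

(* Taking x = y = 1 the second condition says that the projections psi l 1 are
   mutually orthogonal, i.e. that the ranges of the star extensions are. *)
Definition orthogonal_sum (C : numClosedFieldType) (n n' : sizes) (m : nat)
    (phi : blockmx C n -> blockmx C n')
    (psi : 'I_m -> blockmx C n -> blockmx C n') : Prop :=
  (forall x, fourCycle C n x -> phi x = \sum_(l < m) psi l x) /\
  (forall l l' x y, l != l' -> fourCycle C n x -> fourCycle C n y ->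
     psi l x *m psi l' y = 0).

Definition regular_embedding (C : numClosedFieldType) (n n' : sizes)
    (phi : blockmx C n -> blockmx C n') : Prop :=
  star_ext_embedding phi /\
  exists (m : nat) (psi : 'I_m -> blockmx C n -> blockmx C n'),
    orthogonal_sum phi psi /\ forall l, mult_one_embedding (psi l).

Definition rigid_type (theta : 'S_4) : Prop :=
  forall i : 'I_4, ((theta i < 2) = (i < 2))%N.

Definition rigid_of_type (C : numClosedFieldType) (n n' : sizes)
    (theta : 'S_4) (phi : blockmx C n -> blockmx C n') : Prop :=
  [/\ mult_one_embedding phi, rigid_type theta &
      forall (i j : 'I_4) x, fourCycle C n x ->
        exists2 y, fourCycle C n' y &
          phi (blockproj C n i *m x *m blockproj C n j) =
          blockproj C n' (theta i) *m y *m blockproj C n' (theta j)].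

Definition generic_embedding (C : numClosedFieldType) (n n' : sizes)
    (phi : blockmx C n -> blockmx C n') : Prop :=
  star_ext_embedding phi /\
  exists (m : nat) (psi : 'I_m -> blockmx C n -> blockmx C n')
         (theta : 'I_m -> 'S_4),
    [/\ orthogonal_sum phi psi,
        forall l, rigid_of_type (theta l) (psi l) &
        forall t, rigid_type t -> exists l, theta l = t].

Record system (C : numClosedFieldType) := System {
  bsize : nat -> sizes;
  bsize_gt0 : forall k i, (0 < bsize k i)%N;
  conn : forall k, blockmx C (bsize k) -> blockmx C (bsize k.+1);
  conn_emb : forall k, star_ext_embedding (@conn k)
}.

Definition stage (C : numClosedFieldType) (S : system C) (k : nat) :
    set (blockmx C (bsize S k)) := fourCycle C (bsize S k).
Arguments stage {C} S k.

Definition generic_system (C : numClosedFieldType) (S : system C) : Prop :=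
  forall k, generic_embedding (@conn C S k).

Definition odd_system (C : numClosedFieldType) (S : system C) : Prop :=
  finite_set [set k | exists2 m, multiplicity (@conn C S k) m & ~~ odd m].

(* [B], with the maps [iota k], is the C*-algebra direct limit of the matrix
   algebras C*(A_k) along the star extensions of the connecting maps. As these
   extensions are injective, this is the completion of the union of the
   C*(A_k); injective *-homomorphisms of C*-algebras are isometric. *)
Definition cstar_limit (C : numClosedFieldType) (S : system C)
    (B : cstarAlgType C) (iota : forall k, blockmx C (bsize S k) -> B) :
    Prop :=
  [/\ forall k, star_hom (iota k),
      forall k, injective (iota k),
      forall k Phi, star_extension (@conn C S k) Phi ->
        forall x, iota k.+1 (Phi x) = iota k x &
      closure (\bigcup_k range (iota k)) = setT].

Definition operator_limit (C : numClosedFieldType) (S : system C)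
    (B : cstarAlgType C) (iota : forall k, blockmx C (bsize S k) -> B) :
    set B :=
  closure (\bigcup_k (iota k @` stage S k)).

Definition cstar_subalgebra (C : numClosedFieldType) (B : cstarAlgType C)
    (D : set B) : Prop :=
  [/\ D 0, forall (c : C) x y, D x -> D y -> D (c *: x + y),
      forall x y, D x -> D y -> D (amul x y),
      forall x, D x -> D (adj x) & closed D].

Definition cstar_generated (C : numClosedFieldType) (B : cstarAlgType C)
    (A : set B) : set B :=
  \bigcap_(D in [set D | cstar_subalgebra D /\ A `<=` D]) D.

Definition star_ext_isomorphic (C : numClosedFieldType)
    (B B' : cstarAlgType C) (A : set B) (A' : set B') : Prop :=
  exists f : B -> B',
    [/\ set_bij A A' f, alg_hom_on A f &
        exists F : B -> B',
          [/\ set_bij (cstar_generated A) (cstar_generated A') F,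
              star_hom_on (cstar_generated A) F &
              forall x, A x -> F x = f x]].

(* Elements of the various stages are gathered in a sigma type, so that
   the composite conn (k-1) o ... o conn j is an iterate of [step] and no
   cast between matrix sizes is needed. *)
Definition in_stage (C : numClosedFieldType) (S : system C) (k : nat)
    (x : blockmx C (bsize S k)) : {k : nat & blockmx C (bsize S k)} :=
  Tagged (fun k => blockmx C (bsize S k)) x.

Definition step (C : numClosedFieldType) (S : system C)
    (t : {k : nat & blockmx C (bsize S k)}) :
    {k : nat & blockmx C (bsize S k)} :=
  in_stage (conn (tagged t)).

Definition is_conn (C : numClosedFieldType) (S : system C) (j k : nat)
    (f : blockmx C (bsize S j) -> blockmx C (bsize S k)) : Prop :=
  forall x, stage S j x ->
    iter (k - j) (@step C S) (in_stage x) = in_stage (f x).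

Definition regularly_isomorphic (C : numClosedFieldType)
    (S S' : system C) : Prop :=
  exists (n m : nat -> nat)
         (phi : forall i,
            blockmx C (bsize S (n i)) -> blockmx C (bsize S' (m i)))
         (psi : forall i,
            blockmx C (bsize S' (m i)) -> blockmx C (bsize S (n i.+1))),
    [/\ forall i, (n i < n i.+1)%N /\ (m i < m i.+1)%N,
        forall i, regular_embedding (phi i) /\ regular_embedding (psi i),
        forall i, is_conn (psi i \o phi i) &
        forall i, is_conn (phi i.+1 \o psi i)].

(* Main.v *)
(* Let S be the block signature (+,-,+,-) and F the block projection (1,1,0,0). A
   star homomorphism Phi compatible with F, and with S on the commutant of F,
   compares the two signatures through two symmetries of the corner
   p = Phi(e_cc): a = S p, and b, obtained in the same way from a matrix unit
   e_dd of the lower blocks and moved to p by Phi(e_cd). If a and b commute then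
   Phi is regular: diagonalising a and b simultaneously splits p.

   An isomorphism of the limits sends the matrix units of a stage to elements
   that are approximated by such homomorphisms. Composing an approximant with
   one of the inverse gives a map close to a connecting map, whose multiplicity
   is odd and whose symmetries commute. Since a(ab - ba)a = -(ab - ba), the
   commutator is singular on a corner of odd rank, so (ab)^2 has a fixed vector
   there. This cancels the contribution of the second map and shows that (ab)^2
   is close to p for the first one, so that a small rotation makes a and b
   commute. Nearby maps with commuting symmetries are conjugate by a unitary of
   the diagonal blocks; hence the approximately commuting diagram can be made
   exact step by step, with regular crossover maps. *)

Require Import Defs.
From HB Require Import structures.
From mathcomp Require Import all_boot all_order all_algebra perm spectral.
From mathcomp Require Import complex.
From mathcomp Require Import all_classical all_reals all_analysis.
From mathcomp Require Import ring lra zify.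

Set Implicit Arguments.
Unset Strict Implicit.
Unset Printing Implicit Defensive.

Import Order.TTheory GRing.Theory Num.Theory.
Import numFieldNormedType.Exports.

Local Open Scope classical_set_scope.
Local Open Scope ring_scope.
Local Open Scope sesquilinear_scope.

(** * Star homomorphisms of matrix algebras *)

(** The isomorphism does not know [S] and [F]; compatibility with both has to be read off from A. A
    radical element x of a stage satisfies x A x = 0, and this relation forces the block-diagonal
    part of its image to vanish; products of radical units with adjoints of such then handle the two
    corners of [F]. For [S], let e be a unit joining the two blocks of one side. The [S]-even part
    of its image pulls back to a limit g of block-diagonal elements that commutes with every
    block-diagonal element commuting with e. But the product of [S] at a late stage with the image
    of an earlier [S] commutes with e, while conjugation by it changes the sign of everything
    block-diagonal in the position of g; so g = 0. All this leaves [S] uncontrolled only between top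
    and bottom, and the defect there is ab. The defect of a composite is the product of the two
    defects, spread over matrix units, which is why a fixed vector for the second map isolates the
    first. Finally, the conjugating unitaries of the intertwining need not be close to 1: each
    crossover map remembers a map close to the isomorphism of which it is a conjugate, and the next
    map absorbs the unitary. *)

Section StarHom.
Variable C : numClosedFieldType.

Lemma star_homP (B B' : starAlgType C) (f : B -> B') :
  (forall (c : C) x y, f (c *: x + y) = c *: f x + f y) ->
  (forall x y, f (amul x y) = amul (f x) (f y)) ->
  (forall x, f (adj x) = adj (f x)) -> star_hom f.
Proof. by move=> fP fM fA; split; [split=> *|move=> *]; auto. Qed.

Variables (B B' : starAlgType C) (f : B -> B').
Hypothesis hf : star_hom f.

Lemma shomP (c : C) x y : f (c *: x + y) = c *: f x + f y.
Proof. by case: hf => [[fP _] _]; apply: fP. Qed.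

Lemma shomM x y : f (amul x y) = amul (f x) (f y).
Proof. by case: hf => [[_ fM] _]; apply: fM. Qed.

Lemma shomA x : f (adj x) = adj (f x).
Proof. by case: hf => [_]; apply. Qed.

Lemma shom0 : f 0 = 0.
Proof. by have := shomP (-1) 0 0; rewrite scaleN1r oppr0 addr0 scaleN1r addNr. Qed.

Lemma shomD x y : f (x + y) = f x + f y.
Proof. by rewrite -[x in LHS]scale1r shomP scale1r. Qed.

Lemma shomZ c x : f (c *: x) = c *: f x.
Proof. by rewrite -[c *: x]addr0 shomP shom0 addr0. Qed.

Lemma shomN x : f (- x) = - f x.
Proof. by rewrite -scaleN1r shomZ scaleN1r. Qed.

Lemma shomB x y : f (x - y) = f x - f y.
Proof. by rewrite shomD shomN. Qed.

Lemma shom_sum (I : Type) (s : seq I) (P : pred I) (F : I -> B) :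
  f (\sum_(i <- s | P i) F i) = \sum_(i <- s | P i) f (F i).
Proof. by rewrite (big_morph f shomD shom0). Qed.

End StarHom.

Lemma shom_comp (C : numClosedFieldType) (B1 B2 B3 : starAlgType C)
    (f : B1 -> B2) (g : B2 -> B3) :
  star_hom f -> star_hom g -> star_hom (g \o f).
Proof.
move=> hf hg; apply: star_homP => [c x y|x y|x] /=.
- by rewrite !(shomP hf, shomP hg).
- by rewrite !(shomM hf, shomM hg).
- by rewrite !(shomA hf, shomA hg).
Qed.

Lemma shom_id (C : numClosedFieldType) (B : starAlgType C) :
  star_hom (@id B).
Proof. exact: star_homP. Qed.

Section MatrixStar.
Variable C : numClosedFieldType.
Implicit Types r : nat.

Lemma adjmxE r r' (x : 'M[C]_(r, r')) i j : x^t* i j = (x j i)^*.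
Proof. by rewrite !mxE. Qed.

Lemma adjmxD r r' (x y : 'M[C]_(r, r')) : (x + y)^t* = x^t* + y^t*.
Proof. by rewrite linearD /= map_mxD. Qed.

Lemma adjmxN r r' (x : 'M[C]_(r, r')) : (- x)^t* = - x^t*.
Proof. by rewrite linearN /= map_mxN. Qed.

Lemma adjmxB r r' (x y : 'M[C]_(r, r')) : (x - y)^t* = x^t* - y^t*.
Proof. by rewrite adjmxD adjmxN. Qed.

Lemma adjmxZ r r' (c : C) (x : 'M[C]_(r, r')) : (c *: x)^t* = c^* *: x^t*.
Proof. by rewrite linearZ /= map_mxZ. Qed.

Lemma adjmxM r r' r'' (x : 'M[C]_(r, r')) (y : 'M[C]_(r', r'')) :
  (x *m y)^t* = y^t* *m x^t*.
Proof. by rewrite trmx_mul map_mxM. Qed.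

Lemma adjmx_sum r r' (I : Type) (s : seq I) (P : pred I) (F : I -> 'M[C]_(r, r')) :
  (\sum_(i <- s | P i) F i)^t* = \sum_(i <- s | P i) (F i)^t*.
Proof.
apply: (big_morph (fun x : 'M[C]_(r, r') => x^t*)); first exact: adjmxD.
by rewrite trmx0 map_mx0.
Qed.

Lemma adjmx0 r r' : (0 : 'M[C]_(r, r'))^t* = 0.
Proof. by rewrite trmx0 map_mx0. Qed.

Lemma adjmx1 r : (1%:M : 'M[C]_r)^t* = 1%:M.
Proof. by rewrite trmx1 map_mx1. Qed.

Lemma adjmx_delta r r' (i : 'I_r) (j : 'I_r') :
  (delta_mx i j : 'M[C]_(r, r'))^t* = delta_mx j i.
Proof. by rewrite trmx_delta map_delta_mx. Qed.

Lemma delta_sandwich r (a b a' b' : 'I_r) (x : 'M[C]_r) :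
  delta_mx a b *m x *m delta_mx a' b' = x b a' *: delta_mx a b'.
Proof.
apply/matrixP=> i j; rewrite !mxE (bigD1 a') //= big1 ?addr0; last first.
  by move=> k /negPf kn; rewrite [delta_mx _ _ _ _]mxE kn mulr0.
rewrite !mxE (bigD1 b) //= big1 ?addr0; last first.
  by move=> k /negPf kn; rewrite [delta_mx _ _ _ _]mxE kn andbF mul0r.
rewrite !mxE !eqxx andbT andTb.
by case: (i == a); case: (j == b'); rewrite ?(mulr0, mul0r, mulr1, mul1r).
Qed.

Lemma adjmx_mul_eq0 r r' (x : 'M[C]_(r', r)) : x^t* *m x = 0 -> x = 0.
Proof.
move=> h; apply/matrixP=> i j; rewrite [RHS]mxE.
have ge0 (k : 'I_r') : true -> 0 <= x^t* j k * x k j.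
  by move=> _; rewrite adjmxE mulrC mul_conjC_ge0.
have s0 : \sum_k x^t* j k * x k j = 0 by move/matrixP: h => /(_ j j); rewrite !mxE.
have /eqP := psumr_eq0P ge0 s0 (i := i) isT.
by rewrite adjmxE mulrC mul_conjC_eq0 => /eqP.
Qed.

End MatrixStar.

Section MatrixHom.
Variables (C : numClosedFieldType) (r r' : nat) (Phi : 'M[C]_r -> 'M[C]_r').
Hypothesis hPhi : star_hom Phi.
Local Notation E x y := (Phi (delta_mx x y)).

Lemma mhomM x y : Phi (x *m y) = Phi x *m Phi y.
Proof. exact: (shomM hPhi). Qed.

Lemma mhomA x : Phi (x^t*) = (Phi x)^t*.
Proof. exact: (shomA hPhi). Qed.

Lemma mhom_unitA (x y : 'I_r) : (E x y)^t* = E y x.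
Proof. by rewrite -mhomA adjmx_delta. Qed.

Lemma mhom_unitM (x y z w : 'I_r) :
  E x y *m E z w = if y == z then E x w else 0.
Proof.
rewrite -mhomM mul_delta_mx_cond; case: eqP => _; first by rewrite mulr1n.
by rewrite mulr0n (shom0 hPhi).
Qed.

Lemma mhom_unitMM (x y w : 'I_r) : E x y *m E y w = E x w.
Proof. by rewrite mhom_unitM eqxx. Qed.

Lemma mhom_unitMMl (k : nat) (q : 'M[C]_(k, r')) (x y w : 'I_r) :
  q *m E x y *m E y w = q *m E x w.
Proof. by rewrite -mulmxA mhom_unitMM. Qed.

Lemma mhom_sum x : Phi x = \sum_a \sum_b x a b *: E a b.
Proof.
rewrite [x in LHS]matrix_sum_delta (shom_sum hPhi); apply: eq_bigr => a _.
by rewrite (shom_sum hPhi); apply: eq_bigr => b _; rewrite (shomZ hPhi).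
Qed.

Lemma mhom1M x : Phi 1%:M *m Phi x = Phi x.
Proof. by rewrite -mhomM mul1mx. Qed.

Lemma mhomM1 x : Phi x *m Phi 1%:M = Phi x.
Proof. by rewrite -mhomM mulmx1. Qed.

Lemma mhom1A : (Phi 1%:M)^t* = Phi 1%:M.
Proof. by rewrite -mhomA adjmx1. Qed.

Lemma mhom1E : Phi 1%:M = \sum_a E a a.
Proof.
by rewrite -(shom_sum hPhi); congr Phi; rewrite [LHS]matrix_sum_delta;
  apply: eq_bigr => a _; rewrite (bigD1 a) //= mxE eqxx scale1r big1 ?addr0 // => b;
  rewrite eq_sym mxE => /negPf ->; rewrite scale0r.
Qed.

Lemma mhom_inj (c : 'I_r) : E c c != 0 -> injective Phi.
Proof.
move=> h x y exy; apply/eqP; rewrite -subr_eq0; apply/eqP/matrixP=> i j.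
have z : Phi (x - y) = 0 by rewrite (shomB hPhi) exy subrr.
have /eqP : Phi (delta_mx c i *m (x - y) *m delta_mx j c) = 0.
  by rewrite !mhomM z mulmx0 mul0mx.
rewrite delta_sandwich (shomZ hPhi) scaler_eq0 (negPf h) orbF => /eqP ->.
by rewrite mxE.
Qed.

Lemma mhom_tr (c : 'I_r) x : \tr (Phi x) = \tr (E c c) * \tr x.
Proof.
have tE a b : \tr (E a b) = (a == b)%:R * \tr (E c c).
  rewrite -(mhom_unitMM a c b) mxtrace_mulC mhom_unitM eq_sym.
  by case: eqP; rewrite ?mul1r // mul0r mxtrace0.
rewrite mhom_sum raddf_sum /= [X in _ * X]/mxtrace mulr_sumr; apply: eq_bigr => a _.
rewrite raddf_sum /= (bigD1 a) //= big1 ?addr0; last first.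
  by move=> b ba; rewrite mxtraceZ tE eq_sym (negPf ba) mul0r mulr0.
by rewrite mxtraceZ [X in _ * X = _]tE eqxx mul1r mulrC.
Qed.

End MatrixHom.

(** * Intertwiners spread from one corner *)

Section Hat.
Variables (C : numClosedFieldType) (r : nat).

(** The units on both sides cut [q] to the corner P(e_cc) q Q(e_cc) and copy it to every diagonal
    position, which makes the sum an intertwiner of [P] and [Q]. For [P] equal to [Q] it lies in the
    commutant of the image; for [Q] the identity and [q] of rank one it yields a copy of the
    identity representation inside [P]. *)
Definition hat r1 r2 (P : 'M[C]_r -> 'M[C]_r1) (Q : 'M[C]_r -> 'M[C]_r2)
    (c : 'I_r) (q : 'M[C]_(r1, r2)) : 'M[C]_(r1, r2) :=
  \sum_x P (delta_mx x c) *m q *m Q (delta_mx c x).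

Variables (r1 r2 r3 : nat) (P1 : 'M[C]_r -> 'M[C]_r1) (P2 : 'M[C]_r -> 'M[C]_r2)
  (P3 : 'M[C]_r -> 'M[C]_r3).
Hypotheses (h1 : star_hom P1) (h2 : star_hom P2) (h3 : star_hom P3).
Variable c : 'I_r.

Lemma hat_twine q y : P1 y *m hat P1 P2 c q = hat P1 P2 c q *m P2 y.
Proof.
rewrite (mhom_sum h1) (mhom_sum h2) mulmx_suml mulmx_sumr; apply: eq_bigr => a _.
rewrite mulmx_suml mulmx_sumr; apply: eq_bigr => b _.
rewrite -scalemxAl -scalemxAr; congr (_ *: _).
rewrite /hat mulmx_sumr mulmx_suml (bigD1 b) //= [RHS](bigD1 a) //=.
rewrite [X in _ + X = _]big1 ?[X in _ = _ + X]big1 ?addr0.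
- by rewrite !mulmxA (mhom_unitMM h1) -!mulmxA (mhom_unitMM h2).
- by move=> i /negPf ia; rewrite -!mulmxA (mhom_unitM h2) ia !mulmx0.
- by move=> i /negPf ib; rewrite !mulmxA (mhom_unitM h1) eq_sym ib !mul0mx.
Qed.

Lemma hatM q q' :
  hat P1 P2 c q *m hat P2 P3 c q' = hat P1 P3 c (q *m P2 (delta_mx c c) *m q').
Proof.
rewrite /hat mulmx_suml; apply: eq_bigr => a _; rewrite mulmx_sumr (bigD1 a) //=.
rewrite big1 ?addr0.
  by rewrite !mulmxA (mhom_unitMMl h2).
move=> i /negPf ia; rewrite !mulmxA -[_ *m P2 (delta_mx c a) *m _]mulmxA (mhom_unitM h2).
by rewrite eq_sym ia mulmx0 !mul0mx.
Qed.

Lemma hatA q : (hat P1 P2 c q)^t* = hat P2 P1 c (q^t*).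
Proof.
rewrite /hat adjmx_sum; apply: eq_bigr => a _.
by rewrite !adjmxM (mhom_unitA h1) (mhom_unitA h2) mulmxA.
Qed.

End Hat.

Lemma hat1 (C : numClosedFieldType) r r' (P : 'M[C]_r -> 'M[C]_r') c :
  star_hom P -> hat P P c (P (delta_mx c c)) = P 1%:M.
Proof.
move=> h; rewrite (mhom1E h); apply: eq_bigr => a _.
by rewrite !(mhom_unitMM h).
Qed.

Section HatUnit.
Variables (C : numClosedFieldType) (r r1 r2 : nat).
Variables (P1 : 'M[C]_r -> 'M[C]_r1) (P2 : 'M[C]_r -> 'M[C]_r2).
Hypotheses (h1 : star_hom P1) (h2 : star_hom P2).

Lemma hat_unitr c q x y :
  hat P1 P2 c q *m P2 (delta_mx x y) =
  P1 (delta_mx x c) *m q *m P2 (delta_mx c y).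
Proof.
rewrite /hat mulmx_suml (bigD1 x) //= big1 ?addr0 => [|i /negPf ix].
  by rewrite (mhom_unitMMl h2).
by rewrite -mulmxA (mhom_unitM h2) ix mulmx0.
Qed.

End HatUnit.

(** * Block signatures and compatible homomorphisms *)

Section Blocks.
Variables (C : numClosedFieldType) (n : sizes).
Local Notation r := (\sum_(i < 4) n i)%N.
Implicit Types (a b : 'I_r) (x y : 'M[C]_r).

Definition blk (a : 'I_r) : 'I_4 := tagnat.sig1 a.
Definition bsgn (a : 'I_r) : C := (-1) ^+ odd (blk a).
Definition btop (a : 'I_r) : bool := (blk a < 2)%N.
Definition Sg : 'M[C]_r := diag_mx (\row_a bsgn a).
Definition Fg : 'M[C]_r := diag_mx (\row_a (btop a)%:R).

Lemma SgE x a b : (Sg *m x) a b = bsgn a * x a b.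
Proof. by rewrite mul_diag_mx !mxE. Qed.

Lemma SgrE x a b : (x *m Sg) a b = x a b * bsgn b.
Proof. by rewrite mul_mx_diag !mxE. Qed.

Lemma FgE x a b : (Fg *m x) a b = (btop a)%:R * x a b.
Proof. by rewrite mul_diag_mx !mxE. Qed.

Lemma FgrE x a b : (x *m Fg) a b = x a b * (btop b)%:R.
Proof. by rewrite mul_mx_diag !mxE. Qed.

Lemma FcE x a b : ((1%:M - Fg) *m x) a b = (~~ btop a)%:R * x a b.
Proof.
rewrite mulmxBl mul1mx mxE [(- _ : 'M[C]_r) _ _]mxE FgE.
by case: (btop a); rewrite /= ?mul1r ?mul0r ?subrr ?subr0.
Qed.

Lemma FcrE x a b : (x *m (1%:M - Fg)) a b = x a b * (~~ btop b)%:R.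
Proof.
rewrite mulmxBr mulmx1 mxE [(- _ : 'M[C]_r) _ _]mxE FgrE.
by case: (btop b); rewrite /= ?mulr1 ?mulr0 ?subrr ?subr0.
Qed.

Lemma radE x a b :
  (Fg *m x *m (1%:M - Fg)) a b = if btop a && ~~ btop b then x a b else 0.
Proof.
rewrite FcrE FgE.
by case: (btop a); case: (btop b); rewrite /= ?(mulr1, mul1r, mulr0, mul0r).
Qed.

Lemma bsgn_sqr a : bsgn a * bsgn a = 1.
Proof. by rewrite /bsgn -expr2 sqrr_sign. Qed.

Lemma Sg_sqr : Sg *m Sg = 1%:M.
Proof.
apply/matrixP=> a b; rewrite SgE !mxE.
by case: eqP => [->|_]; rewrite ?mulr0n ?mulr0 // mulr1n bsgn_sqr.
Qed.

Lemma Sg_sqrl k (x : 'M[C]_(k, r)) : x *m Sg *m Sg = x.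
Proof. by rewrite -mulmxA Sg_sqr mulmx1. Qed.

Lemma Sg_adj : Sg^t* = Sg.
Proof.
apply/matrixP=> a b; rewrite adjmxE !mxE eq_sym.
case: eqP => [->|_]; last by rewrite !mulr0n conjC0.
by rewrite !mulr1n /bsgn rmorph_sign.
Qed.

Lemma Fg_adj : Fg^t* = Fg.
Proof.
apply/matrixP=> a b; rewrite adjmxE !mxE eq_sym.
case: eqP => [->|_]; last by rewrite !mulr0n conjC0.
by rewrite !mulr1n conjC_nat.
Qed.

Lemma Fg_idem : Fg *m Fg = Fg.
Proof.
apply/matrixP=> a b; rewrite FgE !mxE.
by case: (btop a); rewrite ?mul1r // mul0r mul0rn.
Qed.

Lemma Sg_Fg : Sg *m Fg = Fg *m Sg.
Proof. by rewrite /Sg /Fg !mulmx_diag; congr diag_mx; apply/rowP=> a; rewrite !mxE mulrC. Qed.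

Lemma Sg_delta a b : Sg *m delta_mx a b = bsgn a *: delta_mx a b.
Proof.
apply/matrixP=> i j; rewrite SgE !mxE.
by case: (eqVneq i a) => [->|]; rewrite ?andFb ?mulr0.
Qed.

Lemma Sg_deltar a b : delta_mx a b *m Sg = bsgn b *: delta_mx a b.
Proof.
apply/matrixP=> i j; rewrite SgrE !mxE mulrC.
by case: (eqVneq j b) => [->|]; rewrite ?andbF ?mulr0.
Qed.

Lemma Fg_delta a b : Fg *m delta_mx a b = (btop a)%:R *: delta_mx a b.
Proof.
apply/matrixP=> i j; rewrite FgE !mxE.
by case: (eqVneq i a) => [->|]; rewrite ?andFb ?mulr0.
Qed.

Lemma Fg_deltar a b : delta_mx a b *m Fg = (btop b)%:R *: delta_mx a b.
Proof.
apply/matrixP=> i j; rewrite FgrE !mxE mulrC.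
by case: (eqVneq j b) => [->|]; rewrite ?andbF ?mulr0.
Qed.

Lemma delta_even a b : btop a = btop b ->
  Fg *m delta_mx a b = delta_mx a b *m Fg.
Proof. by move=> ab; rewrite Fg_delta Fg_deltar ab. Qed.

(** Sign and side are the two binary digits of the block index. Commuting with [Sg] and [Fg]
    therefore forces a matrix to be block-diagonal, and two symmetries can replace the four block
    projections. *)
Lemma blk_eq a b : (blk a == blk b) = (bsgn a == bsgn b) && (btop a == btop b).
Proof.
rewrite /bsgn /btop (inj_eq (@signr_inj C)).
by case: (blk a) (blk b) => [] [|[|[|[|//]]]] ? [] [|[|[|[|//]]]] ?.
Qed.

Definition diagalg x := Fg *m x = x *m Fg /\ Sg *m x = x *m Sg.

Lemma diagalgP x :
  diagalg x <-> forall a b, blk a != blk b -> x a b = 0.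
Proof.
split=> [[hF hS] a b|h].
  rewrite blk_eq negb_and.
  move/matrixP: hF => /(_ a b); rewrite FgE FgrE mulrC => hF.
  move/matrixP: hS => /(_ a b); rewrite SgE SgrE mulrC => hS.
  case/orP=> ne.
    move/eqP: hS; rewrite -subr_eq0 -mulrBr mulf_eq0 subr_eq0 (negPf ne) orbF.
    by move/eqP.
  move/eqP: hF; rewrite -subr_eq0 -mulrBr mulf_eq0 => /orP[/eqP //|].
  move: ne; case: (btop a); case: (btop b); rewrite /= ?mulr0n ?mulr1n ?subr0 ?sub0r ?oppr_eq0 ?oner_eq0 //.
split; apply/matrixP=> a b; rewrite ?FgE ?FgrE ?SgE ?SgrE.
  have [/eqP|/h->] := eqVneq (blk a) (blk b); last by rewrite mulr0 mul0r.
  by rewrite blk_eq => /andP[_ /eqP->]; rewrite mulrC.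
have [/eqP|/h->] := eqVneq (blk a) (blk b); last by rewrite mulr0 mul0r.
by rewrite blk_eq => /andP[/eqP-> _]; rewrite mulrC.
Qed.

Lemma fourCycleE x : fourCycle C n x <->
  forall a b, ~~ [|| blk a == blk b | btop a && ~~ btop b] -> x a b = 0.
Proof.
split=> h.
  move=> a b; rewrite /btop -leqNgt => ab; have := h _ _ ab.
  move/matrixP=> /(_ (tagnat.sig2 a) (tagnat.sig2 b)).
  by rewrite !mxE !tagnat.sig2K.
move=> i j ij; apply/matrixP=> s t; rewrite !mxE; apply: h.
by rewrite /btop /blk !tagnat.Rank1K -leqNgt.
Qed.

Lemma fourCycle_delta a b :
  (blk a == blk b) || (btop a && ~~ btop b) -> fourCycle C n (delta_mx a b).
Proof.
move=> h; apply/fourCycleE => i j; rewrite mxE.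
by case: (eqVneq i a) => [->|//]; case: (eqVneq j b) => [->|//]; rewrite h.
Qed.

Lemma fourCycle_diagalg x : diagalg x -> fourCycle C n x.
Proof.
move/diagalgP=> h; apply/fourCycleE => a b.
by rewrite negb_or => /andP[/h].
Qed.

Lemma fourCycle_rad x : x = Fg *m x *m (1%:M - Fg) -> fourCycle C n x.
Proof.
move=> h; apply/fourCycleE => a b.
rewrite negb_or => /andP[_ /negPf nt].
by rewrite h radE nt.
Qed.

Definition evenpart x := Fg *m x *m Fg + (1%:M - Fg) *m x *m (1%:M - Fg).

Lemma evenpartE x a b :
  evenpart x a b = if btop a == btop b then x a b else 0.
Proof.
rewrite /evenpart mxE FgrE FgE FcrE FcE.
by case: (btop a); case: (btop b); rewrite /= ?(mulr1, mul1r, mulr0, mul0r, subr0, subrr, addr0, add0r).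
Qed.

(** The splitting into the self-adjoint part and the radical of the 4-cycle algebra, written with
    [Sg] and [Fg] only; in this form it is transported by maps that respect the two symmetries. *)
Lemma fourCycleP x : fourCycle C n x <->
  diagalg (evenpart x) /\ x - evenpart x = Fg *m x *m (1%:M - Fg).
Proof.
split=> [/fourCycleE h|[/diagalgP h1 /matrixP h2]].
  split.
    apply/diagalgP => a b ab; rewrite evenpartE.
    by case: eqP => // e; apply: h; rewrite (negPf ab) e; case: (btop b).
  apply/matrixP=> a b; rewrite radE mxE [(- _ : 'M[C]_r) _ _]mxE evenpartE.
  case: eqP => [->|ne]; first by rewrite subrr; case: (btop b).
  rewrite subr0; case: ifP => // na; apply: h.
  rewrite na orbF; apply/negP => /eqP e; apply: ne.
  by rewrite /btop e.
apply/fourCycleE => a b; rewrite negb_or => /andP[ab nt].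
have := h2 a b; rewrite radE (negPf nt) mxE [(- _ : 'M[C]_r) _ _]mxE => /eqP.
by rewrite subr_eq0 => /eqP->; exact: h1.
Qed.

Lemma diagalg_delta a b : blk a = blk b -> diagalg (delta_mx a b).
Proof.
move=> h; apply/diagalgP => i j; rewrite mxE.
by case: (eqVneq i a) => [->|//]; case: (eqVneq j b) => [->|//]; rewrite h eqxx.
Qed.

Lemma diagalgM x y : diagalg x -> diagalg y -> diagalg (x *m y).
Proof.
case=> [xF xS] [yF yS]; split.
  by rewrite mulmxA xF -mulmxA yF mulmxA.
by rewrite mulmxA xS -mulmxA yS mulmxA.
Qed.

Lemma diagalgA x : diagalg x -> diagalg (x^t*).
Proof.
case=> [xF xS]; split.
  by rewrite -{1}Fg_adj -adjmxM -xF adjmxM Fg_adj.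
by rewrite -{1}Sg_adj -adjmxM -xS adjmxM Sg_adj.
Qed.

Lemma diagalgD x y : diagalg x -> diagalg y -> diagalg (x + y).
Proof. by case=> [xF xS] [yF yS]; split; rewrite mulmxDl mulmxDr ?xF ?xS ?yF ?yS. Qed.

Lemma diagalgZ k x : diagalg x -> diagalg (k *: x).
Proof. by case=> [xF xS]; split; rewrite -scalemxAl -scalemxAr ?xF ?xS. Qed.

Lemma diagalg1 : diagalg 1%:M.
Proof. by split; rewrite mulmx1 mul1mx. Qed.

Lemma diagalgB x y : diagalg x -> diagalg y -> diagalg (x - y).
Proof. by move=> hx hy; rewrite -scaleN1r; apply: diagalgD => //; apply: diagalgZ. Qed.

Lemma fourCycleD x y : fourCycle C n x -> fourCycle C n y -> fourCycle C n (x + y).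
Proof.
move=> /fourCycleE hx /fourCycleE hy; apply/fourCycleE => a b ab.
by rewrite mxE hx // hy // addr0.
Qed.

Lemma fourCycle0 : fourCycle C n 0.
Proof. by apply/fourCycleE => a b _; rewrite mxE. Qed.

End Blocks.

Arguments Sg {C} n.
Arguments Fg {C} n.
Arguments bsgn {C n} a.
Arguments btop {n} a.

(** [c] is in block 0 and [d] in block 2: one index on each side, both of positive sign, so that no
    signs enter the computations in the corner. *)
Definition base_pair (C : numClosedFieldType) (n : sizes)
    (c d : 'I_(\sum_(i < 4) n i)) : Prop :=
  [/\ btop c, ~~ btop d, bsgn c = 1 :> C & bsgn d = 1 :> C].
Arguments base_pair C {n} c d.

(** A rigid map may exchange the two top blocks and the two bottom blocks independently. This
    multiplies the signature by one sign over [Fg] and another over its complement, and conjugation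
    by such a sign matrix is trivial on the commutant of [Fg] but not beyond it. Hence the
    restriction in the last clause. *)
Definition good (C : numClosedFieldType) (n n' : sizes)
    (Phi : blockmx C n -> blockmx C n') : Prop :=
  [/\ star_hom Phi, Fg n' *m Phi 1%:M = Phi (Fg n) &
      forall x, Fg n *m x = x *m Fg n ->
        Sg n' *m Phi x *m Sg n' = Phi (Sg n *m x *m Sg n)].

Section Good.
Variables (C : numClosedFieldType) (n n' : sizes).
Variable Phi : blockmx C n -> blockmx C n'.
Hypothesis gPhi : good Phi.
Local Notation r := (\sum_(i < 4) n i)%N.
Local Notation S' := (Sg n').
Local Notation F' := (Fg n').
Local Notation E x y := (Phi (delta_mx x y)).

Lemma good_hom : star_hom Phi. Proof. by case: gPhi. Qed.
Let hPhi := good_hom.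

Lemma good_F x : F' *m Phi x = Phi (Fg n *m x).
Proof. by case: gPhi => _ h _; rewrite -(mhom1M hPhi x) mulmxA h -(mhomM hPhi). Qed.

Lemma good_Fr x : Phi x *m F' = Phi (x *m Fg n).
Proof.
rewrite -[Phi x]trmxCK -{1}[F']Fg_adj -adjmxM -(mhomA hPhi) good_F.
by rewrite -(mhomA hPhi) adjmxM trmxCK Fg_adj.
Qed.

Lemma good_S x : Fg n *m x = x *m Fg n ->
  S' *m Phi x = Phi (Sg n *m x *m Sg n) *m S'.
Proof. by move=> h; case: gPhi => _ _ <- //; rewrite Sg_sqrl. Qed.

Lemma good_Sunit (x y : 'I_r) : btop x = btop y ->
  S' *m E x y = (bsgn x * bsgn y) *: (E x y *m S').
Proof.
move/delta_even=> h; rewrite good_S // Sg_delta -scalemxAl Sg_deltar scalerA.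
by rewrite (shomZ hPhi) -scalemxAl.
Qed.

Lemma good_diagalg x : diagalg x -> diagalg (Phi x).
Proof.
case=> [xF xS]; split; first by rewrite good_F good_Fr xF.
by rewrite good_S // xS Sg_sqrl.
Qed.

Lemma good_fourCycle x : fourCycle C n x -> fourCycle C n' (Phi x).
Proof.
case/fourCycleP=> [xD xR].
rewrite -[x](subrK (evenpart x)) xR (shomD hPhi).
apply: fourCycleD; last by apply: fourCycle_diagalg; exact: good_diagalg.
have yF : (Fg n *m x *m (1%:M - Fg n)) *m Fg n = 0.
  by rewrite -mulmxA mulmxBl mul1mx Fg_idem subrr mulmx0.
have Fy : Fg n *m (Fg n *m x *m (1%:M - Fg n)) = Fg n *m x *m (1%:M - Fg n).
  by rewrite !mulmxA Fg_idem.
move: (Fg n *m x *m _) yF Fy => y yF Fy.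
by apply: fourCycle_rad; rewrite mulmxBr mulmx1 good_F good_Fr Fy yF (shom0 hPhi) subr0.
Qed.

Variables c d : 'I_r.
Hypothesis cd : base_pair C c d.

Definition gsa := S' *m E c c.
Definition gsb := E c d *m S' *m E d c.
Local Notation p := (E c c).

Lemma gsaC : gsa = p *m S'.
Proof. by rewrite /gsa good_Sunit //; case: cd => _ _ -> _; rewrite mulr1 scale1r. Qed.

Lemma gp_adj : p^t* = p. Proof. exact: mhom_unitA. Qed.
Lemma gp_idem : p *m p = p. Proof. exact: mhom_unitMM. Qed.

Lemma gsa_adj : gsa^t* = gsa.
Proof. by rewrite {1}gsaC adjmxM Sg_adj gp_adj. Qed.

Lemma gsa_sqr : gsa *m gsa = p.
Proof. by rewrite {2}/gsa gsaC mulmxA Sg_sqrl gp_idem. Qed.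

Lemma gsa_p : gsa *m p = gsa.
Proof. by rewrite /gsa -mulmxA gp_idem. Qed.

Lemma p_gsa : p *m gsa = gsa.
Proof. by rewrite gsaC mulmxA gp_idem. Qed.

Lemma gsb_adj : gsb^t* = gsb.
Proof. by rewrite /gsb !adjmxM !(mhom_unitA hPhi) Sg_adj mulmxA. Qed.

Lemma gsb_p : gsb *m p = gsb.
Proof. by rewrite /gsb (mhom_unitMMl hPhi). Qed.

Lemma p_gsb : p *m gsb = gsb.
Proof. by rewrite /gsb !mulmxA (mhom_unitMM hPhi). Qed.

Lemma Sdd : S' *m E d d = E d d *m S'.
Proof. by rewrite good_Sunit //; case: cd => _ _ _ ->; rewrite mulr1 scale1r. Qed.

Lemma gsb_sqr : gsb *m gsb = p.
Proof.
rewrite /gsb !mulmxA (mhom_unitMMl hPhi) -[_ *m S' *m E d d]mulmxA Sdd.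
by rewrite mulmxA Sg_sqrl (mhom_unitMM hPhi) (mhom_unitMM hPhi).
Qed.

Definition gsh (x : 'I_r) := if btop x then gsa else gsb.

Lemma gsh_adj x : (gsh x)^t* = gsh x.
Proof. by rewrite /gsh; case: ifP; rewrite (gsa_adj, gsb_adj). Qed.

(** Seen through the units [E x c], the signature acts on the corner by only two symmetries, one for
    each side, because units within one side are compatible with it up to sign. *)
Lemma good_Sc x : S' *m E x c = bsgn x *: (E x c *m gsh x).
Proof.
case: cd => tc td sc sd; rewrite /gsh; case: ifP => tx.
  rewrite good_Sunit ?tx ?tc // sc mulr1; congr (_ *: _).
  by rewrite gsaC mulmxA (mhom_unitMM hPhi).
rewrite -(mhom_unitMM hPhi x d c) mulmxA good_Sunit ?tx ?(negPf td) // sd mulr1.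
rewrite -scalemxAl; congr (_ *: _).
by rewrite /gsb !mulmxA !(mhom_unitMM hPhi).
Qed.

Lemma good_Scr x : E c x *m S' = bsgn x *: (gsh x *m E c x).
Proof.
have := congr1 (fun y : 'M[C]_(_, _) => y^t*) (good_Sc x).
rewrite adjmxZ !adjmxM Sg_adj !(mhom_unitA hPhi) gsh_adj /bsgn rmorph_sign.
exact.
Qed.

(** A radical unit passes through the corner from a top row to a bottom column, so conjugation by
    the signature brings in a on the left and b on the right. Thus ab measures how far [Phi] is from
    respecting the signature where [good] imposes nothing. *)
Lemma good_Srad x : x = Fg n *m x *m (1%:M - Fg n) ->
  S' *m Phi x *m S' = hat Phi Phi c (gsa *m gsb) *m Phi (Sg n *m x *m Sg n).
Proof.
move=> hx; have x0 a b : ~~ (btop a && ~~ btop b) -> x a b = 0.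
  by move=> /negPf ab; rewrite hx radE ab.
rewrite (mhom_sum hPhi x) (mhom_sum hPhi (_ *m _)).
rewrite mulmx_sumr mulmx_suml mulmx_sumr; apply: eq_bigr => a _.
rewrite mulmx_sumr mulmx_suml mulmx_sumr; apply: eq_bigr => b _.
rewrite SgrE SgE -!scalemxAr -scalemxAl (hat_unitr _ hPhi).
have [/andP[ta tb]|/x0 ->] := boolP (btop a && ~~ btop b); last first.
  by rewrite mulr0 mul0r !scale0r.
rewrite -(mhom_unitMM hPhi a c b) !mulmxA good_Sc -!scalemxAl -[_ *m E c b *m S']mulmxA good_Scr.
rewrite -!scalemxAr !scalerA /gsh ta (negPf tb) !mulmxA.
by rewrite -mulrA mulrCA mulrA.
Qed.

End Good.

Lemma good_id (C : numClosedFieldType) (n : sizes) : good (@id (blockmx C n)).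
Proof. by split=> //; rewrite mulmx1. Qed.

Section GoodComp.
Variables (C : numClosedFieldType) (n n' n'' : sizes).
Variables (Phi : blockmx C n -> blockmx C n') (Psi : blockmx C n' -> blockmx C n'').
Hypotheses (gPhi : good Phi) (gPsi : good Psi).

Lemma good_comp : good (Psi \o Phi).
Proof.
split=> /=.
- exact: (shom_comp (good_hom gPhi) (good_hom gPsi)).
- by rewrite good_F // good_F // mulmx1.
- move=> x hx; case: gPsi => _ _ ->; first by case: gPhi => _ _ ->.
  by rewrite (good_F gPhi) (good_Fr gPhi) hx.
Qed.

Variables (c d : 'I_(\sum_(i < 4) n i)) (c' d' : 'I_(\sum_(i < 4) n' i)).
Hypotheses (cd : base_pair C c d) (cd' : base_pair C c' d').

(** The product ab is the image of e_cd conjugated by the signature, times the adjoint of that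
    image. For a composite, [good_Srad] for [Psi] evaluates the outer conjugation. The factor coming
    from [Psi] lies in the commutant of its image, so the two factors commute. *)
Lemma gs_comp :
  gsa (Psi \o Phi) c *m gsb (Psi \o Phi) c d =
  hat Psi Psi c' (gsa Psi c' *m gsb Psi c' d') *m Psi (gsa Phi c *m gsb Phi c d).
Proof.
have [hPhi hPsi] := (good_hom gPhi, good_hom gPsi).
rewrite {1}/gsa /gsb /= !mulmxA -[_ *m Psi _ *m Psi _]mulmxA (mhom_unitMM (shom_comp hPhi hPsi)).
have [tc td sc sd] := cd.
rewrite (good_Srad gPsi cd'); last first.
  rewrite mulmxBr mulmx1 (good_F gPhi) (good_Fr gPhi) Fg_delta tc scale1r.
  by rewrite Fg_deltar (negPf td) scale0r (shom0 hPhi) subr0.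
rewrite -[hat _ _ _ _ *m _ *m _]mulmxA -(mhomM hPsi); congr (_ *m Psi _).
  by rewrite /gsb !mulmxA.
by rewrite /gsa (mhom_unitMMl hPhi).
Qed.

End GoodComp.

(** * The parity argument on a corner *)

Section Idempotent.
Variables (C : fieldType) (r : nat) (p : 'M[C]_r).
Hypothesis pp : p *m p = p.

(** The map x -> [Rb] x [L] identifies the corner of [p] with full matrices of size [m]; it makes
    determinants available on the corner. *)
Lemma idem_factor :
  exists m (L : 'M[C]_(r, m)) (Rb : 'M[C]_(m, r)),
    [/\ L *m Rb = p, Rb *m L = 1%:M & \rank p = m].
Proof.
move: (mulmx_base p) (col_base_full p) (row_base_free p).
move: (col_base p) (row_base p) => L Rb LR fL fR; exists (\rank p), L, Rb; split=> //.
have e : L *m (Rb *m L *m Rb) = L *m Rb.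
  by rewrite !mulmxA LR -mulmxA LR pp.
have := row_full_inj fL e.
rewrite -[RHS]mul1mx => e2; exact: (row_free_inj fR e2).
Qed.

Lemma idem_trace : \tr p = (\rank p)%:R.
Proof. by have [m [L [Rb [LR RL ->]]]] := idem_factor; rewrite -LR mxtrace_mulC RL mxtrace1. Qed.

Lemma odd_anticomm_kernel (a b : 'M[C]_r) : (2%:R : C) != 0 -> odd (\rank p) ->
  a *m a = p -> b *m b = p -> p *m a = a -> a *m p = a -> p *m b = b ->
  b *m p = b ->
  exists xi : 'cV[C]_r, [/\ xi != 0, p *m xi = xi & a *m b *m xi = b *m a *m xi].
Proof.
move=> c2 odd_p aa bb pa ap pb bp; have [m [L [Rb [LR RL rp]]]] := idem_factor.
rewrite {}rp in odd_p.
pose cut (x : 'M[C]_r) := Rb *m x *m L.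
have cutM x y : x *m p = x -> cut x *m cut y = cut (x *m y).
  by move=> xp; rewrite /cut !mulmxA -[_ *m L *m Rb]mulmxA LR -[_ *m x *m p]mulmxA xp.
pose k := cut (a *m b - b *m a).
have kk : cut a *m k *m cut a = - k.
  rewrite /k !cutM ?mulmxBr ?mulmxBl ?mulmxA ?aa ?pb //; last first.
    by rewrite -!mulmxA ap bp.
  rewrite -[a *m b *m a *m a]mulmxA aa -[_ *m p]mulmxA bp.
  by rewrite /cut !mulmxBr !mulmxBl opprB.
have aa1 : cut a *m cut a = 1%:M.
  by rewrite cutM // aa /cut -LR !mulmxA RL mul1mx RL.
(* Since the determinant of [cut a] squares to 1, [kk] gives det k = (-1)^m det k, and [m] is
   odd. *)
have : \det k == 0.
  have := congr1 determinant kk.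
  rewrite -scaleN1r detZ -signr_odd odd_p expr1 mulN1r !det_mulmx mulrAC -det_mulmx aa1 det1 mul1r.
  by move/eqP; rewrite -addr_eq0 -mulr2n -mulr_natr mulf_eq0 (negPf c2) orbF.
rewrite -det_tr => /det0P[v v0 vk].
exists (L *m v^T); have pL : p *m L = L by rewrite -{1}LR -mulmxA RL mulmx1.
split.
- apply: contra v0 => /eqP e; apply/eqP; rewrite -[v]trmxK.
  by rewrite -[v^T]mul1mx -RL -mulmxA e mulmx0 trmx0.
- by rewrite mulmxA pL.
- apply/eqP; rewrite -subr_eq0 -mulmxBl; apply/eqP.
  have -> : a *m b - b *m a = p *m (a *m b - b *m a).
    by rewrite mulmxBr !mulmxA pa pb.
  have kv : k *m v^T = 0 by rewrite -[k]trmxK -trmx_mul vk trmx0.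
  by rewrite -{1}LR -[RHS](mulmx0 _ L) -kv /k /cut !mulmxA.
Qed.

End Idempotent.

Definition gcomm (C : numClosedFieldType) (n n' : sizes)
    (Phi : blockmx C n -> blockmx C n') c d : Prop :=
  gsa Phi c *m gsb Phi c d = gsb Phi c d *m gsa Phi c.

Lemma gsab_adj (C : numClosedFieldType) (n n' : sizes)
    (Phi : blockmx C n -> blockmx C n') c d :
  good Phi -> base_pair C c d ->
  (gsa Phi c *m gsb Phi c d)^t* = gsb Phi c d *m gsa Phi c.
Proof. by move=> gPhi cd; rewrite adjmxM (gsa_adj gPhi cd) (gsb_adj gPhi). Qed.

(** The adjoint of ab is ba, so [gcomm] says that ab is self-adjoint. By [gs_comp] the product for
    the composite has two self-adjoint factors, and these commute by [hat_twine]. *)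
Lemma gcomm_comp (C : numClosedFieldType) (n n' n'' : sizes)
    (Phi : blockmx C n -> blockmx C n') (Psi : blockmx C n' -> blockmx C n'')
    c d c' d' :
  good Phi -> good Psi -> base_pair C c d -> base_pair C c' d' ->
  gcomm Phi c d -> gcomm Psi c' d' -> gcomm (Psi \o Phi) c d.
Proof.
move=> gPhi gPsi cd cd' k1 k2; rewrite /gcomm.
have gc := good_comp gPhi gPsi.
have [hPhi hPsi] := (good_hom gPhi, good_hom gPsi).
rewrite -(gsab_adj gc cd) (gs_comp gPhi gPsi cd cd') adjmxM -(mhomA hPsi).
rewrite (hatA hPsi hPsi) (gsab_adj gPhi cd) (gsab_adj gPsi cd') -k1 -k2.
by rewrite (hat_twine hPsi hPsi).
Qed.

Section OddMultiplicity.
Variables (C : numClosedFieldType) (n n' : sizes).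
Variables (Psi : blockmx C n -> blockmx C n').
Hypothesis gPsi : good Psi.
Variables c d : 'I_(\sum_(i < 4) n i).
Hypotheses (cd : base_pair C c d) (oddPsi : odd (\rank (Psi (delta_mx c c)))).
Let hPsi := good_hom gPsi.
Local Notation ab := (gsa Psi c *m gsb Psi c d).

(** From ab xi = ba xi follows (ab)^2 xi = xi, as ab ba is the corner projection. The vector,
    normalised and copied along the matrix units, spans a copy of the identity representation on
    which the spread of (ab)^2 acts trivially. *)
Lemma odd_fixed_isometry :
  exists W : 'M[C]_(_, _),
    [/\ W^t* *m W = 1%:M, forall x, Psi x *m W = W *m x &
        hat Psi Psi c (ab *m ab) *m W = W].
Proof.
have two0 : (2%:R : C) != 0 by rewrite pnatr_eq0.
have [xi [xi0 pxi abxi]] := odd_anticomm_kernel (gp_idem gPsi c) two0 oddPsi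
  (gsa_sqr gPsi cd) (gsb_sqr gPsi cd) (p_gsa gPsi cd) (gsa_p gPsi c)
  (p_gsb gPsi c d) (gsb_p gPsi c d).
pose s := (xi^t* *m xi) 0 0.
have s0 : 0 < s.
  rewrite lt_def; apply/andP; split; last first.
    by rewrite /s mxE sumr_ge0 // => i _; rewrite adjmxE mulrC mul_conjC_ge0.
  apply: contra xi0 => /eqP s0; apply/eqP/adjmx_mul_eq0/matrixP=> i j.
  by rewrite !ord1 [RHS]mxE.
pose k := (sqrtC s)^-1; pose q : 'M[C]_(_, _) := (k *: xi) *m delta_mx (0 : 'I_1) c.
have hid := shom_id 'M[C]_(\sum_(i < 4) n i).
have pq : Psi (delta_mx c c) *m q = q by rewrite /q -scalemxAl -scalemxAr mulmxA pxi.
exists (hat Psi id c q); split.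
- rewrite (hatA hPsi hid) (hatM _ _ hPsi) -mulmxA pq.
  have -> : q^t* *m q = delta_mx c c.
    rewrite /q -scalemxAl adjmxZ adjmxM adjmx_delta -scalemxAl -scalemxAr scalerA.
    rewrite mulmxA -[_ *m xi^t* *m xi]mulmxA [xi^t* *m xi]mx11_scalar -/s.
    rewrite mul_mx_scalar -scalemxAl mul_delta_mx scalerA.
    have kr : k^* = k.
      by apply: conj_Creal; rewrite /k realV sqrtC_real //; exact: ltW.
    have kks : k * k * s = 1.
      by rewrite -expr2 exprVn sqrtCK mulVf // gt_eqF.
    by rewrite kr kks scale1r.
  exact: (hat1 c hid).
- by move=> x; rewrite (hat_twine hPsi hid).
- rewrite (hatM _ _ hPsi) -mulmxA pq; congr (hat _ _ _ _).
  rewrite /q -scalemxAl -scalemxAr; congr (_ *: _); rewrite [LHS]mulmxA; congr (_ *m _).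
  move: abxi (gsb_sqr gPsi cd) (gsa_p gPsi c) (gsa_sqr gPsi cd) pxi; rewrite /q.
  move: (gsa Psi c) (gsb Psi c d) (Psi (delta_mx c c)) => a b p abxi bb ap aa pxi.
  by rewrite -[_ *m xi]mulmxA abxi !mulmxA -[a *m b *m b]mulmxA bb ap aa pxi.
Qed.

End OddMultiplicity.

Lemma conj_hom (C : numClosedFieldType) r r' (V : 'M[C]_(r', r)) :
  V^t* *m V = 1%:M -> star_hom (fun x : 'M[C]_r => V *m x *m V^t*).
Proof.
move=> VV; apply: star_homP => [k x y|x y|x].
- by rewrite mulmxDr mulmxDl -scalemxAr -scalemxAl.
- rewrite /amul /=; rewrite !mulmxA -[_ *m V^t* *m V]mulmxA VV mulmx1.
  by rewrite -!mulmxA.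
- by rewrite /adj /= !adjmxM trmxCK mulmxA.
Qed.

(** * Regular, rigid and generic embeddings *)

Section SignedIsometry.
Variables (C : numClosedFieldType) (n n' : sizes).
Local Notation r := (\sum_(i < 4) n i)%N.
Local Notation r' := (\sum_(i < 4) n' i)%N.

(** The four values of the pair [s], [t] are the four rigid types: [s] tells whether the top blocks
    are exchanged, [t] whether the bottom blocks are. *)
Definition gsign (s t : bool) : 'M[C]_r :=
  (-1) ^+ s *: Fg n + (-1) ^+ t *: (1%:M - Fg n).

Definition signed_isometry (V : 'M[C]_(r', r)) (s t : bool) : Prop :=
  [/\ V^t* *m V = 1%:M, Fg n' *m V = V *m Fg n &
      Sg n' *m V = V *m (Sg n *m gsign s t)].

Lemma gsign_adj s t : (gsign s t)^t* = gsign s t.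
Proof.
rewrite /gsign adjmxD !adjmxZ adjmxB adjmx1 Fg_adj.
by rewrite !rmorph_sign.
Qed.

Lemma gsign_F s t : gsign s t *m Fg n = (-1) ^+ s *: Fg n.
Proof.
rewrite /gsign mulmxDl -!scalemxAl mulmxBl mul1mx Fg_idem subrr scaler0 addr0.
by [].
Qed.

Lemma gsign_Fc s t : gsign s t *m (1%:M - Fg n) = (-1) ^+ t *: (1%:M - Fg n).
Proof.
rewrite mulmxBr mulmx1 gsign_F /gsign addrAC subrr add0r.
by [].
Qed.

Lemma gsign_sqr s t : gsign s t *m gsign s t = 1%:M.
Proof.
rewrite {2}/gsign mulmxDr -!scalemxAr gsign_F gsign_Fc !scalerA -!expr2 !sqrr_sign.
by rewrite !scale1r addrC subrK.
Qed.

Lemma gsign_even s t (x : 'M[C]_r) : Fg n *m x = x *m Fg n ->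
  gsign s t *m x = x *m gsign s t.
Proof.
move=> h; rewrite /gsign mulmxDl mulmxDr -!scalemxAl -!scalemxAr h.
by rewrite mulmxBl mulmxBr mul1mx mulmx1 h.
Qed.

Variables (V : 'M[C]_(r', r)) (s t : bool).
Hypothesis hV : signed_isometry V s t.
Local Notation phi := (fun x : 'M[C]_r => V *m x *m V^t*).

Lemma sisom_Fr : V^t* *m Fg n' = Fg n *m V^t*.
Proof. by case: hV => _ h _; rewrite -[LHS]trmxCK adjmxM trmxCK Fg_adj h adjmxM Fg_adj. Qed.

Lemma sisom_Sr : V^t* *m Sg n' = gsign s t *m Sg n *m V^t*.
Proof.
case: hV => _ _ h; rewrite -[LHS]trmxCK adjmxM trmxCK Sg_adj h !adjmxM.
by rewrite gsign_adj Sg_adj.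
Qed.

Lemma sisom_even (x : 'M[C]_r) : Fg n *m x = x *m Fg n ->
  Sg n' *m phi x *m Sg n' = phi (Sg n *m x *m Sg n).
Proof.
move=> xF; case: hV => _ _ h; rewrite !mulmxA h -[_ *m V^t* *m _]mulmxA sisom_Sr.
rewrite !mulmxA -[V *m Sg n *m gsign s t *m x]mulmxA (gsign_even s t xF).
rewrite !mulmxA -[_ *m gsign s t *m gsign s t]mulmxA gsign_sqr mulmx1.
by [].
Qed.

Lemma sisom_diagalg (x : 'M[C]_r) : diagalg x -> diagalg (phi x).
Proof.
case=> xF xS; have [VV h _] := hV; split.
  by rewrite !mulmxA h -[in RHS]mulmxA sisom_Fr mulmxA -[V *m Fg n *m x]mulmxA xF mulmxA.
by rewrite -[LHS]Sg_sqrl sisom_even // xS Sg_sqrl.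
Qed.

Lemma sisom_fourCycle (x : 'M[C]_r) : fourCycle C n x -> fourCycle C n' (phi x).
Proof.
case/fourCycleP=> xD xR; rewrite -[x](subrK (evenpart x)) xR.
have yF : (Fg n *m x *m (1%:M - Fg n)) *m Fg n = 0.
  by rewrite -mulmxA mulmxBl mul1mx Fg_idem subrr mulmx0.
have Fy : Fg n *m (Fg n *m x *m (1%:M - Fg n)) = Fg n *m x *m (1%:M - Fg n).
  by rewrite !mulmxA Fg_idem.
move: (Fg n *m x *m _) yF Fy => y yF Fy; rewrite mulmxDr mulmxDl.
apply: fourCycleD; last by apply: fourCycle_diagalg; exact: sisom_diagalg.
have [VV h _] := hV; apply: fourCycle_rad.
rewrite mulmxBr mulmx1 !mulmxA h -[V *m _ *m y]mulmxA Fy -[_ *m V^t* *m _]mulmxA sisom_Fr.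
by rewrite !mulmxA -[V *m y *m Fg n]mulmxA yF mulmx0 mul0mx subr0.
Qed.

Lemma sisom_inj : injective phi.
Proof.
case: hV => VV _ _ x y /(congr1 (fun z => V^t* *m z *m V)).
by rewrite !mulmxA VV !mul1mx -!mulmxA VV !mulmx1.
Qed.

Lemma sisom_mult_one : mult_one_embedding phi.
Proof.
have [VV _ _] := hV.
have hphi := conj_hom VV.
split; [split|].
- split; first by move=> x; exact: sisom_fourCycle.
    split; first by move=> k x y _ _; exact: (shomP hphi).
    by move=> x y _ _; exact: (shomM hphi).
  by move=> x y _ _; exact: sisom_inj.
- by exists phi.
- exists phi; first by [].
  exists (fun _ => V); split.
    by move=> a b; rewrite !ord1 eqxx.
  by move=> x; rewrite big_ord1.
Qed.

End SignedIsometry.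

Section SignedSum.
Variables (C : numClosedFieldType) (n n' : sizes) (m : nat).
Local Notation r := (\sum_(i < 4) n i)%N.
Local Notation r' := (\sum_(i < 4) n' i)%N.
Variables (V : 'I_m -> 'M[C]_(r', r)) (s t : 'I_m -> bool).
Hypothesis hV : forall l, signed_isometry (V l) (s l) (t l).
Hypothesis oV : forall l l', l != l' -> (V l)^t* *m V l' = 0.
Definition sumconj (x : 'M[C]_r) : 'M[C]_r' := \sum_l V l *m x *m (V l)^t*.

Lemma sumconjV (x : 'M[C]_r) l : sumconj x *m V l = V l *m x.
Proof.
rewrite /sumconj mulmx_suml (bigD1 l) //= [X in _ + X = _]big1 ?addr0 => [|l' ll'].
  by have [VV _ _] := hV l; rewrite -mulmxA VV mulmx1.
by rewrite -mulmxA oV // mulmx0.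
Qed.

Lemma sumconj_hom : star_hom sumconj.
Proof.
apply: star_homP => [k x y|x y|x].
- rewrite /sumconj scaler_sumr -big_split; apply: eq_bigr => l _ /=.
  by rewrite mulmxDr mulmxDl -scalemxAr -scalemxAl.
- rewrite /amul /= [in RHS]/sumconj mulmx_sumr; apply: eq_bigr => l _.
  by rewrite !mulmxA sumconjV.
- rewrite /adj /= /sumconj adjmx_sum; apply: eq_bigr => l _.
  by rewrite !adjmxM trmxCK mulmxA.
Qed.

Lemma sumconj_good : good sumconj.
Proof.
split; first exact: sumconj_hom.
- rewrite /sumconj mulmx_sumr; apply: eq_bigr => l _.
  by have [_ h _] := hV l; rewrite mulmx1 mulmxA h.
- move=> x xF; rewrite /sumconj mulmx_sumr mulmx_suml; apply: eq_bigr => l _.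
  exact: (sisom_even (hV l)).
Qed.

Variables c d : 'I_r.
Hypothesis cd : base_pair C c d.

Lemma sumconj_gsa : gsa sumconj c =
  \sum_l (-1) ^+ s l *: (V l *m delta_mx c c *m (V l)^t*).
Proof.
rewrite /gsa /sumconj mulmx_sumr; apply: eq_bigr => l _.
have [_ _ h] := hV l; have [tc _ sc _] := cd; rewrite !mulmxA h.
rewrite -[V l *m _ *m delta_mx _ _]mulmxA -[Sg n *m _ *m _]mulmxA.
have -> : gsign C n (s l) (t l) *m delta_mx c c = (-1) ^+ s l *: delta_mx c c.
  have e : Fg n *m delta_mx c c = delta_mx c c :> 'M[C]_r.
    by rewrite Fg_delta tc scale1r.
  by rewrite -e mulmxA gsign_F -scalemxAl e.
by rewrite -scalemxAr Sg_delta sc scale1r -!scalemxAr -!scalemxAl.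
Qed.

Lemma sumconj_gsb : gsb sumconj c d =
  \sum_l (-1) ^+ t l *: (V l *m delta_mx c c *m (V l)^t*).
Proof.
rewrite /gsb -mulmxA [sumconj (delta_mx d c)]/sumconj mulmx_sumr mulmx_sumr.
apply: eq_bigr => l _; have [_ _ h] := hV l; have [_ td _ sd] := cd.
rewrite !mulmxA -[_ *m Sg n' *m V l]mulmxA h mulmxA sumconjV.
rewrite -!mulmxA [gsign _ _ _ _ *m (_ *m _)]mulmxA.
have -> : gsign C n (s l) (t l) *m delta_mx d c = (-1) ^+ t l *: delta_mx d c.
  have e : (1%:M - Fg n) *m delta_mx d c = delta_mx d c :> 'M[C]_r.
    by rewrite mulmxBl mul1mx Fg_delta (negPf td) scale0r subr0.
  by rewrite -e mulmxA gsign_Fc -scalemxAl e.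
rewrite -scalemxAl -!scalemxAr; congr (_ *: (_ *m _)).
by rewrite !mulmxA -[delta_mx c d *m _ *m _]mulmxA Sg_delta sd scale1r mul_delta_mx.
Qed.

(** Both symmetries are combinations, with coefficients 1 or -1, of the same orthogonal projections,
    the images of e_cc under the summands. *)
Lemma sumconj_comm : gcomm sumconj c d.
Proof.
rewrite /gcomm sumconj_gsa sumconj_gsb mulmx_suml mulmx_suml.
apply: eq_bigr => l _; rewrite !mulmx_sumr (bigD1 l) //= [RHS](bigD1 l) //=.
rewrite [X in _ + X = _]big1 ?[X in _ = _ + X]big1 => [|l' ll'|l' ll'].
- by rewrite -!scalemxAl -!scalemxAr !scalerA mulrC.
- rewrite -scalemxAl -scalemxAr !mulmxA -[_ *m (V l)^t* *m V l']mulmxA oV 1?eq_sym //.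
  by rewrite mulmx0 !mul0mx !scaler0.
- rewrite -scalemxAl -scalemxAr !mulmxA -[_ *m (V l)^t* *m V l']mulmxA oV 1?eq_sym //.
  by rewrite mulmx0 !mul0mx !scaler0.
Qed.

Lemma sumconj_tr x : \tr (sumconj x) = m%:R * \tr x.
Proof.
rewrite /sumconj raddf_sum /= -[m in RHS]card_ord mulr_natl -sumr_const.
apply: eq_bigr => l _; have [VV _ _] := hV l.
by rewrite mxtrace_mulC mulmxA VV mul1mx.
Qed.

End SignedSum.

(** Commuting matrices have a common unitary triangularisation, and a self-adjoint triangular matrix
    is diagonal. *)
Lemma unitary_codiag (C : numClosedFieldType) r (a b : 'M[C]_r) :
  a^t* = a -> b^t* = b -> a *m b = b *m a ->
  exists (U : 'M[C]_r) (al be : 'I_r -> C),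
    [/\ U *m U^t* = 1%:M, U^t* *m U = 1%:M,
        forall i, a *m (U^t* *m delta_mx i (0 : 'I_1)) = al i *: (U^t* *m delta_mx i 0) &
        forall i, b *m (U^t* *m delta_mx i (0 : 'I_1)) = be i *: (U^t* *m delta_mx i 0)].
Proof.
move=> aA bA /cotrigonalization2[U Uu /andP[ta tb]].
have UU : U *m U^t* = 1%:M by apply/unitarymxP.
have UU' : U^t* *m U = 1%:M by apply: mulmx1C.
have gen (Y : 'M[C]_r) i : (forall j, i != j -> Y j i = 0) ->
    Y *m delta_mx i (0 : 'I_1) = Y i i *: delta_mx i 0.
  move=> Yd; apply/matrixP=> j k; rewrite ord1 -colE !mxE andbT.
  case: (eqVneq j i) => [->|ji]; first by rewrite mulr1.
  by rewrite mulr0 Yd // eq_sym.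
have key (x : 'M[C]_r) : x^t* = x -> is_trig_mx (conjmx U x) -> forall i,
    x *m (U^t* *m delta_mx i (0 : 'I_1)) =
    (U *m x *m U^t*) i i *: (U^t* *m delta_mx i 0).
  move=> xA tx i; set X := U *m x *m U^t*.
  have XA : X^t* = X by rewrite /X !adjmxM trmxCK xA mulmxA.
  have tX : is_trig_mx X by move: tx; rewrite conjymx.
  have Xd j : i != j -> X j i = 0.
    case: (ltngtP i j) => [ij|ji|/val_inj->]; last by rewrite eqxx.
      by move=> _; rewrite -XA adjmxE (is_trig_mxP tX) // conjC0.
    by move=> _; rewrite (is_trig_mxP tX).
  have -> : x *m (U^t* *m delta_mx i (0 : 'I_1)) = U^t* *m (X *m delta_mx i 0).
    by rewrite /X !mulmxA UU' mul1mx.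
  by rewrite scalemxAr gen.
exists U, (fun i => (U *m a *m U^t*) i i), (fun i => (U *m b *m U^t*) i i).
by split=> // i; apply: key.
Qed.

Lemma mx1_sum_delta (R : pzSemiRingType) k :
  1%:M = \sum_(i < k) delta_mx i i :> 'M[R]_k.
Proof.
apply/matrixP=> i j; rewrite mxE summxE (bigD1 i) //= big1 ?addr0 => [|l /negPf li].
  by rewrite mxE eqxx andTb eq_sym.
by rewrite mxE eq_sym li.
Qed.

Section GoodRegular.
Variables (C : numClosedFieldType) (n n' : sizes).
Variable Phi : blockmx C n -> blockmx C n'.
Local Notation r := (\sum_(i < 4) n i)%N.
Local Notation r' := (\sum_(i < 4) n' i)%N.
Variables c d : 'I_r.
Hypotheses (gPhi : good Phi) (cd : base_pair C c d) (kPhi : gcomm Phi c d).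
Let hPhi := good_hom gPhi.
Let hid := shom_id 'M[C]_r.

(** The map sending the basis vector e_x to Phi(e_xc) xi: the copy of the identity representation
    generated by a vector of the corner. *)
Definition slice (xi : 'cV[C]_r') : 'M[C]_(r', r) :=
  hat Phi id c (xi *m delta_mx (0 : 'I_1) c).

Lemma slice_twine xi x : Phi x *m slice xi = slice xi *m x.
Proof. by rewrite /slice (hat_twine hPhi hid). Qed.

Lemma sliceM (xi xi' : 'cV[C]_r') : Phi (delta_mx c c) *m xi' = xi' ->
  (slice xi)^t* *m slice xi' = (xi^t* *m xi') 0 0 *: 1%:M.
Proof.
move=> pxi; rewrite /slice (hatA hPhi hid) (hatM _ _ hPhi).
rewrite -mulmxA [_ *m (_ *m delta_mx _ _)]mulmxA pxi adjmxM adjmx_delta.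
rewrite mulmxA -[_ *m xi^t* *m xi']mulmxA [xi^t* *m xi']mx11_scalar mul_mx_scalar.
rewrite -scalemxAl mul_delta_mx -(hat1 c hid) /hat scaler_sumr !mxE.
by apply: eq_bigr => a _; rewrite -scalemxAr -scalemxAl.
Qed.

Lemma slice_sum (I : finType) (P : pred I) (xi : I -> 'cV[C]_r') x :
  \sum_(i | P i) xi i *m (xi i)^t* = Phi (delta_mx c c) ->
  \sum_(i | P i) slice (xi i) *m x *m (slice (xi i))^t* = Phi x.
Proof.
move=> h; transitivity (Phi x *m \sum_(i | P i) slice (xi i) *m (slice (xi i))^t*).
  by rewrite mulmx_sumr; apply: eq_bigr => i _; rewrite mulmxA slice_twine.
have e i : slice (xi i) *m (slice (xi i))^t* = hat Phi Phi c (xi i *m (xi i)^t*).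
  rewrite /slice (hatA hPhi hid) (hatM _ _ hid); congr (hat _ _ _ _).
  rewrite /= adjmxM adjmx_delta mulmxA -[xi i *m _ *m delta_mx c c]mulmxA mul_delta_mx.
  rewrite -[xi i *m _ *m delta_mx c 0]mulmxA mul_delta_mx [delta_mx 0 0]mx11_scalar.
  by rewrite mxE !eqxx mulmx1.
rewrite (eq_bigr _ (fun i _ => e i)).
have -> : \sum_(i | P i) hat Phi Phi c (xi i *m (xi i)^t*) = Phi 1%:M.
  rewrite -(hat1 c hPhi) -h /hat exchange_big; apply: eq_bigr => a _ /=.
  by rewrite mulmx_sumr mulmx_suml.
exact: mhomM1.
Qed.

Lemma slice_signed (xi : 'cV[C]_r') (s t : bool) :
  Phi (delta_mx c c) *m xi = xi -> xi^t* *m xi = 1%:M ->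
  gsa Phi c *m xi = (-1) ^+ s *: xi -> gsb Phi c d *m xi = (-1) ^+ t *: xi ->
  signed_isometry (slice xi) s t.
Proof.
move=> pxi xx axi bxi; split.
- by rewrite sliceM // xx mxE scale1r.
- have e : Phi 1%:M *m slice xi = slice xi by rewrite slice_twine mulmx1.
  by rewrite -{1}e mulmxA (good_F gPhi) mulmx1 slice_twine.
- have [tc td sc sd] := cd.
  rewrite /slice /hat mulmx_sumr mulmx_suml; apply: eq_bigr => x _.
  rewrite !mulmxA (good_Sc gPhi cd) -!scalemxAl -[_ *m gsh _ _ _ _ *m xi]mulmxA.
  have -> : gsh Phi c d x *m xi = (if btop x then (-1) ^+ s else (-1) ^+ t) *: xi.
    by rewrite /gsh; case: (btop x).
  rewrite -scalemxAr -!scalemxAl -!mulmxA.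
  rewrite [delta_mx c x *m (_ *m _)]mulmxA Sg_deltar -scalemxAl -!scalemxAr; congr (_ *: _).
  rewrite /gsign mulmxDr -!scalemxAr mulmxBr mulmx1 Fg_deltar.
  by case: (btop x); rewrite ?scale1r ?scale0r ?subrr ?subr0 ?scaler0 ?addr0 ?add0r -!scalemxAr.
Qed.

Lemma good_regular : Phi (delta_mx c c) != 0 -> regular_embedding Phi.
Proof.
move=> p0; split.
  split; last by exists Phi.
  split; first by move=> x; exact: good_fourCycle.
    split; first by move=> k x y _ _; exact: (shomP hPhi).
    by move=> x y _ _; exact: (shomM hPhi).
  by move=> x y _ _; exact: (mhom_inj hPhi p0).
have [U [al [be [UU UU' aU bU]]]] := unitary_codiag (gsa_adj gPhi cd) (gsb_adj gPhi c d) kPhi.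
pose xi i : 'cV[C]_r' := U^t* *m delta_mx i (0 : 'I_1).
have xx i j : (xi i)^t* *m xi j = (i == j)%:R%:M.
  rewrite /xi adjmxM trmxCK adjmx_delta mulmxA -[_ *m U *m _]mulmxA UU mulmx1.
  rewrite mul_delta_mx_cond [delta_mx _ _]mx11_scalar mxE !eqxx.
  by case: (i == j); rewrite ?mulr1n ?mulr0n // raddf0.
have al2 i : Phi (delta_mx c c) *m xi i = (al i * al i) *: xi i.
  by rewrite -(gsa_sqr gPhi cd) -mulmxA aU -scalemxAr aU scalerA.
have be2 i : Phi (delta_mx c c) *m xi i = (be i * be i) *: xi i.
  by rewrite -(gsb_sqr gPhi cd) -mulmxA bU -scalemxAr bU scalerA.
have xi0 i : xi i != 0.
  apply/eqP => e; have := xx i i; rewrite e mulmx0 eqxx => /matrixP/(_ 0 0).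
  by rewrite !mxE => /eqP; rewrite eq_sym oner_eq0.
have al4 i : (al i * al i) * (al i * al i) = al i * al i.
  have := al2 i; rewrite -{1}(gp_idem gPhi) -mulmxA al2 -scalemxAr al2 scalerA => /eqP.
  by rewrite -subr_eq0 -scalerBl scaler_eq0 (negPf (xi0 i)) orbF subr_eq0 => /eqP.
have albe i : al i * al i = be i * be i.
  have := be2 i; rewrite al2 => /eqP.
  by rewrite -subr_eq0 -scalerBl scaler_eq0 (negPf (xi0 i)) orbF subr_eq0 => /eqP.
(* The diagonalisation is carried out on the whole space. As a and b both square to the corner
   projection, its eigenvalue at [xi i] is the square of [al i] and of [be i], which is 0 or 1; the
   indices with value 1 form an orthonormal basis of the corner. *)
pose I := [pred i | al i * al i == 1].
have al0 i : ~~ I i -> al i * al i = 0.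
  rewrite inE; move: (al i * al i) (al4 i) => q /eqP qq /negPf h.
  by move: qq; rewrite -{3}[q]mulr1 -subr_eq0 -mulrBr mulf_eq0 subr_eq0 h orbF => /eqP.
have sgnP k : k * k = 1 :> C -> k = (-1) ^+ (k == -1).
  move=> kk; have /eqP : (k - 1) * (k + 1) = 0 by rewrite -subr_sqr expr2 kk expr1n subrr.
  rewrite mulf_eq0 subr_eq0 addr_eq0 => /orP[]/eqP-> /=; last by rewrite eqxx expr1.
  by rewrite -addr_eq0 -(natrD _ 1 1) pnatr_eq0 expr0.
have sV i : I i -> signed_isometry (slice (xi i)) (al i == -1) (be i == -1).
  rewrite inE => /eqP Ii; apply: slice_signed.
  - by rewrite al2 Ii scale1r.
  - by rewrite xx eqxx.
  - by rewrite aU -sgnP.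
  - by rewrite bU -sgnP // -albe.
have oV i j : I j -> i != j -> (slice (xi i))^t* *m slice (xi j) = 0.
  rewrite inE => /eqP Ij ij; rewrite sliceM; last by rewrite al2 Ij scale1r.
  by rewrite xx (negPf ij) mxE mul0rn scale0r.
have sumI : \sum_(i | I i) xi i *m (xi i)^t* = Phi (delta_mx c c).
  have -> : \sum_(i | I i) xi i *m (xi i)^t* = \sum_i Phi (delta_mx c c) *m (xi i *m (xi i)^t*).
    rewrite [RHS](bigID I) /= [X in _ = _ + X]big1 ?addr0.
      apply: eq_bigr => i /eqP Ii; rewrite mulmxA al2.
      by rewrite Ii scale1r.
    by move=> i /al0 Ii; rewrite mulmxA al2 Ii scale0r mul0mx.
  rewrite -mulmx_sumr -[RHS]mulmx1; congr (_ *m _).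
  transitivity (U^t* *m 1%:M *m U); last by rewrite mulmx1 UU'.
  rewrite mx1_sum_delta mulmx_sumr mulmx_suml; apply: eq_bigr => i _.
  rewrite /xi adjmxM trmxCK adjmx_delta !mulmxA.
  by rewrite -[_ *m delta_mx _ _ *m delta_mx _ _]mulmxA mul_delta_mx.
exists #|I|, (fun l x => slice (xi (enum_val l)) *m x *m (slice (xi (enum_val l)))^t*).
have Il (l : 'I_#|I|) : I (enum_val l) by have := enum_valP l.
split; [split|].
- move=> x _; rewrite -(slice_sum x sumI).
  exact: (@big_enum_val _ _ _ _ I (fun i => slice (xi i) *m x *m (slice (xi i))^t*)).
- move=> l l' x y ll' _ _.
  rewrite !mulmxA -[_ *m (slice _)^t* *m slice _]mulmxA oV //.
    by rewrite mulmx0 !mul0mx.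
  by apply: contra ll' => /eqP/enum_val_inj ->.
- by move=> l; apply: (sisom_mult_one (sV _ (Il l))).
Qed.

End GoodRegular.

Lemma blockprojE (C : numClosedFieldType) (n : sizes) (i : 'I_4) :
  blockproj C n i = diag_mx (\row_a (blk a == i)%:R).
Proof.
have -> : \row_a (blk a == i)%:R =
    \mxrow_(k < 4) const_mx (k == i)%:R :> 'rV[C]_(\sum_(i < 4) n i).
  by apply/rowP=> a; rewrite !mxE.
rewrite diag_mxrow /blockproj; apply/eq_mxdiagP => k.
by rewrite diag_const_mx; case: eqP; rewrite // raddf0.
Qed.

(** Each of the pairs {0,1} and {2,3} is either fixed pointwise or exchanged, so parity is shifted
    by a constant on each pair, visible at the first element of the pair. *)
Lemma rigid_type_sign (theta : 'S_4) (i : 'I_4) : rigid_type theta ->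
  odd (theta i) = odd i (+) odd (theta (if (i < 2)%N then 0 else 2%:R)).
Proof.
move=> h.
have inj k l : k != l -> nat_of_ord (theta k) != theta l.
  by apply: contra => /eqP/val_inj/perm_inj ->.
have := h 0; have := h 1; have := h 2%:R; have := h 3%:R.
have := inj 0 1 isT; have := inj 2%:R 3%:R isT.
have e k (Hk : (k < 4)%N) (j : 'I_4) : j = k :> nat -> Ordinal Hk = j by move=> jk; apply/val_inj.
case: i => [[|[|[|[|//]]]] Hi] /=.
- by rewrite (e _ Hi 0 erefl).
- rewrite (e _ Hi 1 erefl); case: (theta 0) (theta 1) => [[|[|[|[|//]]]] ?] [[|[|[|[|//]]]] ?] //=.
- by rewrite (e _ Hi 2%:R erefl).
- rewrite (e _ Hi 3%:R erefl); case: (theta 2%:R) (theta 3%:R) => [[|[|[|[|//]]]] ?] [[|[|[|[|//]]]] ?] //=.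
Qed.

Section Rigid.
Variables (C : numClosedFieldType) (n n' : sizes).
Local Notation r := (\sum_(i < 4) n i)%N.
Local Notation r' := (\sum_(i < 4) n' i)%N.

Lemma rigid_signed_isometry (theta : 'S_4) (phi : blockmx C n -> blockmx C n') :
  rigid_of_type theta phi ->
  exists (V : 'M[C]_(r', r)) s t, signed_isometry V s t /\
    forall x, fourCycle C n x -> phi x = V *m x *m V^t*.
Proof.
case=> [[_ [Phi [_ ext] [V [orthV PhiV]]]] rt loc].
have {}PhiV x : Phi x = V ord0 *m x *m (V ord0)^t* by rewrite PhiV big_ord1.
have {}orthV : (V ord0)^t* *m V ord0 = 1%:M by rewrite orthV eqxx.
move: (V ord0) PhiV orthV => {}V PhiV VV.
(* Locality applied to a block projection: the conjugate by [V] of the projection onto block i lies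
   under block theta(i), so [V] has no entry leading from block i elsewhere. *)
have loc1 (a : 'I_r) (b : 'I_r') : blk b != theta (blk a) -> V b a = 0.
  move=> ba; have [y _] := loc (blk a) (blk a) 1%:M (fourCycle_diagalg (diagalg1 C n)).
  have -> : blockproj C n (blk a) *m 1%:M *m blockproj C n (blk a) = blockproj C n (blk a).
    rewrite mulmx1 blockprojE mulmx_diag; congr diag_mx; apply/rowP=> k; rewrite !mxE.
    by case: eqP; rewrite ?mulr1 ?mulr0.
  rewrite -ext; last first.
    apply/fourCycleE => k l; rewrite blockprojE !mxE.
    by case: (eqVneq k l) => [->|]; rewrite ?eqxx // mulr0n.
  rewrite PhiV => /(congr1 (fun z => z *m V)).
  rewrite -[V *m _ *m _ *m V]mulmxA VV mulmx1 !blockprojE => /matrixP/(_ b a).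
  rewrite mul_mx_diag -!mulmxA mul_diag_mx [LHS]mxE [RHS]mxE.
  by rewrite [X in _ * X = _]mxE eqxx mulr1 [X in _ = X * _]mxE (negPf ba) mul0r.
exists V, (odd (theta 0)), (odd (theta 2%:R)); split; last by move=> x /ext <-; rewrite PhiV.
split=> //.
  apply/matrixP=> b a; rewrite mul_diag_mx mul_mx_diag !mxE.
  case: (eqVneq (blk b) (theta (blk a))) => [e|/loc1->]; last by rewrite mulr0 mul0r.
  by rewrite mulrC /btop e rt.
apply/matrixP=> b a; rewrite {1}/Sg mul_diag_mx [LHS]mxE [X in X * _ = _]mxE.
have -> : (V *m (Sg n *m gsign C n (odd (theta 0)) (odd (theta 2%:R)))) b a =
    V b a * bsgn a * (if btop a then (-1) ^+ odd (theta 0) else (-1) ^+ odd (theta 2%:R)).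
  rewrite mulmxA /gsign mulmxDr -!scalemxAr mulmxBr mulmx1 /Fg /Sg !mul_mx_diag !mxE.
  by case: (btop a); rewrite /= ?mulr1 ?mulr0 ?subrr ?subr0 ?mulr0 ?addr0 ?add0r mulrC.
case: (eqVneq (blk b) (theta (blk a))) => [e|/loc1->]; last by rewrite mulr0 !mul0r.
rewrite {1}/bsgn e (rigid_type_sign _ rt) signr_addb -/(bsgn a) /btop.
by case: (blk a < 2)%N; rewrite mulrC mulrA.
Qed.

Lemma generic_sumconj (phi : blockmx C n -> blockmx C n') :
  generic_embedding phi ->
  exists m (V : 'I_m -> 'M[C]_(r', r)) s t,
    [/\ forall l, signed_isometry (V l) (s l) (t l),
        forall l l', l != l' -> (V l)^t* *m V l' = 0 &
        forall x, fourCycle C n x -> phi x = sumconj V x].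
Proof.
case=> _ [m [psi [theta [[sum orth] rig _]]]].
have /choice[V /choice[s /choice[t h]]] l := rigid_signed_isometry (rig l).
exists m, V, s, t; split.
- by move=> l; case: (h l).
- move=> l l' ll'; have := orth l l' 1%:M 1%:M ll'.
  have A1 := fourCycle_diagalg (diagalg1 C n).
  have [[[VV _ _] e] [[VV' _ _] e']] := (h l, h l').
  rewrite e // e' // !mulmx1 => /(_ A1 A1) /(congr1 (fun z => (V l)^t* *m z *m V l')).
  by rewrite !mulmxA VV mul1mx -!mulmxA VV' mulmx1 mul0mx mulmx0.
- by move=> x hx; rewrite sum //; apply: eq_bigr => l _; case: (h l) => _ ->.
Qed.

End Rigid.

(** * C*-norms on matrix algebras *)

Section RealNorm.
Variable R : realType.
Local Notation C := (R[i]).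

(** Norms over [R[i]] take values in [R[i]]; all estimates are done with this real number
    instead. *)
Definition nm (V : normedModType C) (x : V) : R := complex.Re `|x|.
Definition cabs (c : C) : R := complex.Re `|c|.

Lemma nmE (V : normedModType C) (x : V) : `|x| = (nm x)%:C%C.
Proof. by rewrite /nm RRe_real // normr_real. Qed.

Lemma cabsE (c : C) : `|c| = (cabs c)%:C%C.
Proof. by rewrite /cabs RRe_real // normr_real. Qed.

Lemma nm_ge0 (V : normedModType C) (x : V) : 0 <= nm x.
Proof. by rewrite -ler0c -nmE normr_ge0. Qed.

Lemma cabs_ge0 c : 0 <= cabs c.
Proof. by rewrite -ler0c -cabsE normr_ge0. Qed.

Lemma nm0 (V : normedModType C) : nm (0 : V) = 0.
Proof. by apply: (@complexI R); rewrite -nmE normr0. Qed.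

Lemma nm_eq0 (V : normedModType C) (x : V) : nm x = 0 -> x = 0.
Proof. by move=> h; apply: normr0_eq0; rewrite nmE h. Qed.

Lemma nmD (V : normedModType C) (x y : V) : nm (x + y) <= nm x + nm y.
Proof. by rewrite -lecR rmorphD /= -!nmE ler_normD. Qed.

Lemma nmZ (V : normedModType C) c (x : V) : nm (c *: x) = cabs c * nm x.
Proof. by apply: (@complexI R); rewrite rmorphM /= -nmE -cabsE normrZ -nmE. Qed.

Lemma cabs_real (x : R) : cabs x%:C%C = `|x|.
Proof. by rewrite /cabs normc_def /= expr0n /= addr0 sqrtr_sqr. Qed.

Lemma cabs0 : cabs 0 = 0.
Proof. by rewrite /cabs normr0. Qed.

Lemma cabs_sign (b : bool) : cabs ((-1) ^+ b) = 1.
Proof. by rewrite /cabs normr_sign. Qed.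

Lemma nmN (V : normedModType C) (x : V) : nm (- x) = nm x.
Proof. by rewrite /nm normrN. Qed.

Lemma nmBC (V : normedModType C) (x y : V) : nm (x - y) = nm (y - x).
Proof. by rewrite /nm distrC. Qed.

Lemma nm_tri (V : normedModType C) (y x z : V) : nm (x - z) <= nm (x - y) + nm (y - z).
Proof. by rewrite -{1}[x](subrK y) -addrA nmD. Qed.

Lemma nm_sum (V : normedModType C) (I : Type) (s : seq I) (P : pred I) (F : I -> V) :
  nm (\sum_(i <- s | P i) F i) <= \sum_(i <- s | P i) nm (F i).
Proof.
elim/big_ind2: _ => [|x1 x2 y1 y2 h1 h2|//]; first by rewrite nm0.
by apply: le_trans (nmD _ _) _; exact: lerD.
Qed.

Section Cstar.
Variable B : cstarAlgType C.
Implicit Types x y : B.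

Lemma nmM x y : nm (amul x y) <= nm x * nm y.
Proof. by rewrite -lecR rmorphM /= -!nmE norm_amul. Qed.

Lemma nm_star x : nm (amul (adj x) x) = nm x ^+ 2.
Proof. by apply: (@complexI R); rewrite rmorphXn /= -!nmE norm_cstar. Qed.

Lemma nm_adj x : nm (adj x) = nm x.
Proof.
have le y : nm y <= nm (adj y).
  have := nm_star y; have [->|y0] := eqVneq (nm y) 0; first by rewrite nm_ge0.
  have yp : 0 < nm y by rewrite lt_def y0 nm_ge0.
  move=> e; have := nmM (adj y) y; rewrite e expr2 ler_pM2r //.
by apply/eqP; rewrite eq_le le -{2}[x]adjK le.
Qed.

End Cstar.

(** Otherwise x / y > 1 would have bounded powers, against Bernoulli's inequality. This does the
    work of the spectral radius formula: the C*-identity controls powers with exponent 2^k, and the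
    constant [K] is lost in the limit. *)
Lemma pow2_root_le (x y K : R) : 0 <= y ->
  (forall k, x ^+ (2 ^ k) <= K * y ^+ (2 ^ k)) -> x <= y.
Proof.
move=> y0 h; rewrite leNgt; apply/negP => yx.
have x0 : 0 < x by apply: le_lt_trans yx.
have [y0'|yp] := eqVneq y 0.
  by have := h 0%N; rewrite !expr1 y0' mulr0 leNgt x0.
have {}yp : 0 < y by rewrite lt_def yp.
have t1 : 1 < x / y by rewrite ltr_pdivlMr // mul1r.
pose u := x / y - 1; have u0 : 0 < u by rewrite /u subr_gt0.
have te : x / y = 1 + u by rewrite /u addrC subrK.
have bern n : 1 + n%:R * u <= (x / y) ^+ n.
  rewrite te; elim: n => [|n IH]; first by rewrite mul0r addr0 expr0.
  rewrite exprS; have : (1 + u) * (1 + n%:R * u) <= (1 + u) * (1 + u) ^+ n.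
    by rewrite ler_pM2l //; lra.
  apply: le_trans; rewrite -natr1.
  have : 0 <= n%:R * u * u by rewrite !mulr_ge0 // ltW.
  by nra.
have bd k : (x / y) ^+ (2 ^ k) <= K.
  by rewrite expr_div_n ler_pdivrMr ?exprn_gt0.
have [k hk] : exists k : nat, K < 1 + k%:R * u.
  exists (Num.Def.truncn (Num.max 0 (K / u))).+1.
  have h0 : 0 <= Num.max 0 (K / u) by rewrite le_max lexx.
  have /andP[_] := Num.Theory.truncn_itv h0.
  rewrite gt_max => /andP[_]; rewrite ltr_pdivrMr // => /lt_le_trans; apply.
  by rewrite lerDr.
have b1 := bern (2 ^ k)%N; have b2 := bd k.
have kk : (k%:R : R) <= (2 ^ k)%N%:R by rewrite ler_nat ltnW // ltn_expl.
have : k%:R * u <= (2 ^ k)%N%:R * u by rewrite ler_pM2r.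
by lra.
Qed.

End RealNorm.

Section MatrixIdentities.
Variables (K : pzRingType) (r : nat).
Implicit Types x y z u v p s k : 'M[K]_r.

Lemma conjmx_mulr v u d z : v *m u = 1%:M ->
  z *m (v *m d *m u) = v *m (u *m z *m v *m d) *m u.
Proof. by move=> vu; rewrite !mulmxA vu mul1mx. Qed.

Lemma conjmx_mull v u d z : v *m u = 1%:M ->
  v *m d *m u *m z = v *m (d *m (u *m z *m v)) *m u.
Proof. by move=> vu; rewrite !mulmxA -[_ *m v *m u]mulmxA vu mulmx1. Qed.

Lemma conjmx_canc v u d : u *m v = 1%:M -> u *m (v *m d *m u) *m v = d.
Proof. by move=> uv; rewrite !mulmxA uv mul1mx -mulmxA uv mulmx1. Qed.

Lemma conjmx_inj v u d d' : u *m v = 1%:M ->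
  v *m d *m u = v *m d' *m u -> d = d'.
Proof. by move=> uv e; rewrite -(conjmx_canc d uv) e conjmx_canc. Qed.

Lemma conjmx_mul v u d d' : u *m v = 1%:M ->
  v *m d *m u *m (v *m d' *m u) = v *m (d *m d') *m u.
Proof. by move=> uv; rewrite !mulmxA -[_ *m u *m v]mulmxA uv mulmx1. Qed.

Lemma corner_isqrt p s k h : p *m p = p -> k *m p = h -> p *m s = s *m p ->
  s *m s *m k = 1%:M -> p *m s *m (p *m s) *m h = p.
Proof.
move=> pp <- ps ssk; have -> : p *m s *m (p *m s) = p *m (s *m s).
  by rewrite mulmxA -[p *m s *m p]mulmxA -ps !mulmxA pp.
by rewrite mulmxA -[p *m _ *m k]mulmxA ssk mulmx1 pp.
Qed.

End MatrixIdentities.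

Section CNorm.
Variable R : realType.
Local Notation C := (R[i]).

Record cnorm r (N : 'M[C]_r -> R) : Prop := Cnorm {
  cnD : forall x y, N (x + y) <= N x + N y;
  cnZ : forall c x, N (c *: x) = cabs c * N x;
  cnM : forall x y, N (x *m y) <= N x * N y;
  cnS : forall x, N (x^t* *m x) = N x ^+ 2;
  cn_ge0 : forall x, 0 <= N x;
  cn_eq0 : forall x, N x = 0 -> x = 0
}.

Lemma shom_cnorm r (B : cstarAlgType C) (f : 'M[C]_r -> B) :
  star_hom f -> injective f -> cnorm (fun x => nm (f x)).
Proof.
move=> hf fI; split.
- by move=> x y; rewrite (shomD hf) nmD.
- by move=> c x; rewrite (shomZ hf) nmZ.
- by move=> x y; rewrite (shomM hf) nmM.
- by move=> x; rewrite (shomM hf) (shomA hf) nm_star.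
- by move=> x; exact: nm_ge0.
- by move=> x /nm_eq0 fx; apply: fI; rewrite fx (shom0 hf).
Qed.

Section One.
Variables (r : nat) (N : 'M[C]_r -> R).
Hypothesis hN : cnorm N.

Lemma cn0 : N 0 = 0.
Proof. by rewrite -(scale0r 0) (cnZ hN) cabs0 mul0r. Qed.

Lemma cnN x : N (- x) = N x.
Proof. by rewrite -scaleN1r (cnZ hN) -[-1]expr1 (cabs_sign R true) mul1r. Qed.

Lemma cnB x y : N (x - y) <= N x + N y.
Proof. by rewrite -(cnN y) (cnD hN). Qed.

Lemma cnBC x y : N (x - y) = N (y - x).
Proof. by rewrite -cnN opprB. Qed.

Lemma cn_tri y x z : N (x - z) <= N (x - y) + N (y - z).
Proof. by rewrite -{1}[x](subrK y) -addrA (cnD hN). Qed.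

Lemma cn_sum (I : Type) (s : seq I) (P : pred I) (F : I -> 'M[C]_r) :
  N (\sum_(i <- s | P i) F i) <= \sum_(i <- s | P i) N (F i).
Proof.
elim/big_ind2: _ => [|x1 x2 y1 y2 h1 h2|//]; first by rewrite cn0.
by apply: le_trans (cnD hN _ _) _; exact: lerD.
Qed.

Lemma cnA x : N (x^t*) = N x.
Proof.
have le y : N y <= N (y^t*).
  have := cnS hN y; have [->|y0] := eqVneq (N y) 0; first by rewrite (cn_ge0 hN).
  have yp : 0 < N y by rewrite lt_def y0 (cn_ge0 hN).
  by move=> e; have := cnM hN (y^t*) y; rewrite e expr2 ler_pM2r.
by apply/eqP; rewrite eq_le le -{2}[x]trmxCK le.
Qed.

Lemma cn_proj p : p^t* = p -> p *m p = p -> N p = 0 \/ N p = 1.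
Proof.
move=> pA pp; have := cnS hN p; rewrite pA pp => /eqP.
rewrite -{1}[N p]mulr1 expr2 -subr_eq0 -mulrBr mulf_eq0 subr_eq0.
by case/orP=> /eqP ->; [left|right].
Qed.

Lemma cn_proj1 p : p^t* = p -> p *m p = p -> N p < 1 -> p = 0.
Proof. by move=> pA pp; case: (cn_proj pA pp) => [/(cn_eq0 hN)//|->]; rewrite ltxx. Qed.

Lemma cn_proj_le p : p^t* = p -> p *m p = p -> N p <= 1.
Proof. by move=> pA pp; case: (cn_proj pA pp) => ->. Qed.

Lemma cn_pisom k (v : 'M[C]_r) : k^t* = k -> k *m k = k -> v^t* *m v = k -> N v <= 1.
Proof.
move=> kA kk vv; have := cnS hN v; rewrite vv.
have := cn_proj_le kA kk; have := cn_ge0 hN v => v0 k1 e.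
by rewrite -(ler_pXn2r (n := 2)) ?nnegrE // expr1n -e.
Qed.

Lemma cn_unit a b : N (delta_mx a b) = 1.
Proof.
have e1 x : N (delta_mx x x) = 1.
  have [|||//] := @cn_proj (delta_mx x x); first exact: adjmx_delta.
    by rewrite mul_delta_mx.
  move/(cn_eq0 hN)/matrixP=> /(_ x x); rewrite !mxE !eqxx => /eqP.
  by rewrite oner_eq0.
have := cnS hN (delta_mx a b); rewrite adjmx_delta mul_delta_mx e1 => e.
by apply/eqP; rewrite -(@eqrXn2 _ 2) ?(cn_ge0 hN) // expr1n -e.
Qed.

Lemma cn_entry (x : 'M[C]_r) a b : cabs (x a b) <= N x.
Proof.
have := cnZ hN (x a b) (delta_mx a b); rewrite -delta_sandwich cn_unit mulr1 => <-.
apply: le_trans (cnM hN _ _) _; rewrite cn_unit mulr1.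
by apply: le_trans (cnM hN _ _) _; rewrite cn_unit mul1r.
Qed.

Lemma cn_le_entries (x : 'M[C]_r) : N x <= \sum_a \sum_b cabs (x a b).
Proof.
rewrite {1}[x]matrix_sum_delta; apply: le_trans (cn_sum _ _ _) _.
apply: ler_sum => a _; apply: le_trans (cn_sum _ _ _) _; apply: ler_sum => b _.
by rewrite (cnZ hN) cn_unit mulr1.
Qed.

Lemma cn_le_entries_bound (x : 'M[C]_r) M : (forall a b, cabs (x a b) <= M) ->
  N x <= (r * r)%:R * M.
Proof.
move=> h; apply: le_trans (cn_le_entries x) _.
apply: (@le_trans _ _ (\sum_(a < r) \sum_(b < r) M)).
  by apply: ler_sum => a _; apply: ler_sum => b _; exact: h.
by rewrite !sumr_const !card_ord -mulrnA mulr_natl.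
Qed.

Definition sqpow k (h : 'M[C]_r) := iter k (fun x => x *m x) h.

Lemma sqpow_adj k h : h^t* = h -> (sqpow k h)^t* = sqpow k h.
Proof. by move=> hA; elim: k => //= k IH; rewrite adjmxM IH. Qed.

Lemma cn_sqpow k h : h^t* = h -> N (sqpow k h) = N h ^+ (2 ^ k).
Proof.
move=> hA; elim: k => [|k IH] /=; first by rewrite expn0 expr1.
by rewrite -{1}(sqpow_adj k hA) (cnS hN) IH expnSr exprM.
Qed.

End One.

(** For self-adjoint h, N1(h)^(2^k) is the norm of h^(2^k), at most r^2 times its largest entry, and
    entries are bounded by any C*-norm, here by N2(h)^(2^k). [pow2_root_le] removes r^2.
    Consequently a matrix algebra has one C*-norm, and norms coming from different limits agree. *)
Lemma cnorm_le r (N1 N2 : 'M[C]_r -> R) : cnorm N1 -> cnorm N2 ->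
  forall x, N1 x <= N2 x.
Proof.
move=> h1 h2 x.
have hA : (x^t* *m x)^t* = x^t* *m x by rewrite adjmxM trmxCK.
have : N1 (x^t* *m x) <= N2 (x^t* *m x).
  apply: (pow2_root_le (K := (r * r)%:R)); first exact: (cn_ge0 h2).
  move=> k; rewrite -(cn_sqpow h1 k hA) -(cn_sqpow h2 k hA).
  by apply: cn_le_entries_bound => // a b; exact: cn_entry.
by rewrite (cnS h1) (cnS h2) ler_pXn2r ?nnegrE ?(cn_ge0 h1) ?(cn_ge0 h2).
Qed.

Lemma cnorm_uniq r (N1 N2 : 'M[C]_r -> R) : cnorm N1 -> cnorm N2 -> N1 =1 N2.
Proof. by move=> h1 h2 x; apply/eqP; rewrite eq_le !(cnorm_le h1 h2, cnorm_le h2 h1). Qed.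

Lemma cnorm_shom r r' (N : 'M[C]_r -> R) (N' : 'M[C]_r' -> R)
    (Phi : 'M[C]_r -> 'M[C]_r') :
  cnorm N -> cnorm N' -> star_hom Phi -> injective Phi ->
  forall x, N' (Phi x) = N x.
Proof.
move=> hN hN' hPhi PhiI; apply: (cnorm_uniq (N1 := fun x => N' (Phi x))) => //.
split.
- by move=> x y; rewrite (shomD hPhi) (cnD hN').
- by move=> c x; rewrite (shomZ hPhi) (cnZ hN').
- by move=> x y; rewrite (mhomM hPhi) (cnM hN').
- by move=> x; rewrite (mhomM hPhi) (mhomA hPhi) (cnS hN').
- by move=> x; exact: (cn_ge0 hN').
- by move=> x /(cn_eq0 hN') fx; apply: PhiI; rewrite fx (shom0 hPhi).
Qed.

Section Spectral.
Variables (r : nat) (N : 'M[C]_r -> R).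
Hypothesis hN : cnorm N.

Definition dg (d : 'I_r -> R) : 'M[C]_r := locked (diag_mx (\row_i (d i)%:C%C)).

Lemma dgE d : dg d = diag_mx (\row_i (d i)%:C%C).
Proof. by rewrite /dg -lock. Qed.

Lemma dgM d d' : dg d *m dg d' = dg (fun i => d i * d' i).
Proof.
rewrite !dgE mulmx_diag; apply/matrixP=> i j; rewrite !mxE.
by rewrite rmorphM.
Qed.

Lemma dg_entry d i j : dg d i j = (d i)%:C%C *+ (i == j).
Proof. by rewrite dgE !mxE; case: eqP => [->|]. Qed.

Lemma dgA d : (dg d)^t* = dg d.
Proof.
apply/matrixP=> i j; rewrite adjmxE !dg_entry eq_sym.
case: eqP => [->|_]; last by rewrite !mulr0n conjC0.
by rewrite !mulr1n; apply: conj_Creal; apply/complex_realP; exists (d j).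
Qed.

Lemma dg1 : dg (fun _ => 1) = 1%:M.
Proof. by apply/matrixP=> i j; rewrite dg_entry mxE. Qed.

Lemma dgB d d' : dg d - dg d' = dg (fun i => d i - d' i).
Proof. by apply/matrixP=> i j; rewrite !mxE !dg_entry rmorphB mulrnBl. Qed.

Lemma dg_comm d Z : Z *m dg d = dg d *m Z <->
  forall i j, Z i j * (d j)%:C%C = (d i)%:C%C * Z i j.
Proof.
split=> [/matrixP h i j|h].
  by have := h i j; rewrite dgE mul_mx_diag mul_diag_mx !mxE.
by apply/matrixP=> i j; have := h i j; rewrite dgE mul_mx_diag mul_diag_mx !mxE.
Qed.

Definition udiag (U : 'M[C]_r) (d : 'I_r -> R) : 'M[C]_r := U^t* *m dg d *m U.

Lemma udiag_ext U d d' : d =1 d' -> udiag U d = udiag U d'.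
Proof. by move=> /funext ->. Qed.

Lemma herm_udiag (h : 'M[C]_r) : h^t* = h ->
  exists U d, [/\ U *m U^t* = 1%:M, U^t* *m U = 1%:M & h = udiag U d].
Proof.
move=> hA; have hh : h \is hermsymmx.
  by apply/is_hermitianmxP; rewrite expr0 scale1r hA.
have /orthomx_spectralP e := hermitian_normalmx hh.
have dr := hermitian_spectral_diag_real hh.
have Uu := spectral_unitarymx h.
exists (spectralmx h), (fun i => complex.Re (spectral_diag h 0 i)).
have UU : spectralmx h *m (spectralmx h)^t* = 1%:M by apply/unitarymxP.
split=> //; first exact: mulmx1C.
rewrite {1}e invmx_unitary // /udiag dgE.
have -> : \row_i (complex.Re (spectral_diag h 0 i))%:C%C = spectral_diag h.
  by apply/rowP=> i; rewrite mxE RRe_real //; apply: (mxOverP dr).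
by [].
Qed.

Section Diag.
Variable U : 'M[C]_r.
Hypotheses (UU : U *m U^t* = 1%:M) (UU' : U^t* *m U = 1%:M).

Lemma udiagM d d' : udiag U d *m udiag U d' = udiag U (fun i => d i * d' i).
Proof.
by rewrite /udiag (conjmx_mul _ _ UU) dgM.
Qed.

Lemma udiagA d : (udiag U d)^t* = udiag U d.
Proof. by rewrite /udiag !adjmxM trmxCK dgA mulmxA. Qed.

Lemma udiag1 : udiag U (fun _ => 1) = 1%:M.
Proof. by rewrite /udiag dg1 mulmx1 UU'. Qed.

Lemma udiagB d d' : udiag U d - udiag U d' = udiag U (fun i => d i - d' i).
Proof. by rewrite /udiag -mulmxBl -mulmxBr dgB. Qed.

Lemma udiagK d : U *m udiag U d *m U^t* = dg d.
Proof. exact: conjmx_canc. Qed.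

Lemma cn_unitary : N U <= 1.
Proof. by apply: (cn_pisom hN (k := 1%:M)) => //; rewrite ?adjmx1 ?mulmx1. Qed.

Lemma sqpow_udiag k d : sqpow k (udiag U d) = udiag U (fun i => d i ^+ (2 ^ k)).
Proof.
elim: k => [|k IH] /=; first by apply: udiag_ext => i; rewrite expn0 expr1.
rewrite IH udiagM; apply: udiag_ext => i.
by rewrite -exprD addnn -mul2n expnS.
Qed.

Lemma cn_uconj X : N (U^t* *m X *m U) <= N X.
Proof.
have U1 := cn_unitary; have U2 : N (U^t*) <= 1 by rewrite (cnA hN).
apply: le_trans (cnM hN _ _) _; rewrite -[X in _ <= X]mulr1.
apply: ler_pM; rewrite ?(cn_ge0 hN) //.
apply: le_trans (cnM hN _ _) _; rewrite -[X in _ <= X]mul1r.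
by apply: ler_pM; rewrite ?(cn_ge0 hN).
Qed.

Lemma cn_uconj' X : N (U *m X *m U^t*) <= N X.
Proof.
have U1 := cn_unitary; have U2 : N (U^t*) <= 1 by rewrite (cnA hN).
apply: le_trans (cnM hN _ _) _; rewrite -[X in _ <= X]mulr1.
apply: ler_pM; rewrite ?(cn_ge0 hN) //.
apply: le_trans (cnM hN _ _) _; rewrite -[X in _ <= X]mul1r.
by apply: ler_pM; rewrite ?(cn_ge0 hN).
Qed.

Lemma cn_udiag_le d L : 0 <= L -> (forall i, `|d i| <= L) -> N (udiag U d) <= L.
Proof.
move=> L0 dL; apply: (pow2_root_le (K := (r * r)%:R) L0) => k.
rewrite -(cn_sqpow hN) ?udiagA // sqpow_udiag.
apply: le_trans (cn_uconj _) _; apply: (cn_le_entries_bound hN) => a b; rewrite dg_entry.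
case: eqP => [_|_]; last by rewrite mulr0n cabs0 exprn_ge0.
by rewrite mulr1n cabs_real normrX lerXn2r ?nnegrE.
Qed.

Lemma cn_udiag_ge d i : `|d i| <= N (udiag U d).
Proof.
have -> : `|d i| = cabs ((U *m udiag U d *m U^t*) i i).
  by rewrite udiagK dg_entry eqxx mulr1n cabs_real.
by apply: le_trans (cn_entry hN _ _ _) (cn_uconj' _).
Qed.

(** Commuting with a diagonal matrix kills the entries between different eigenvalues. Functions of a
    self-adjoint matrix thus commute with everything that commutes with it; every later correction
    keeps its symmetries for this reason. *)
Lemma udiag_comm d d' z : (forall i j, d i = d j -> d' i = d' j) ->
  z *m udiag U d = udiag U d *m z -> z *m udiag U d' = udiag U d' *m z.
Proof.
move=> dd'; rewrite /udiag !(conjmx_mulr _ _ UU') !(conjmx_mull _ _ UU').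
move: (U *m z *m U^t*) => Z zd.
have /dg_comm {}zd : Z *m dg d = dg d *m Z := conjmx_inj UU zd.
suff -> : Z *m dg d' = dg d' *m Z by [].
apply/dg_comm => i j; have /eqP := zd i j.
rewrite mulrC -subr_eq0 -mulrBl mulf_eq0 subr_eq0 => /orP[/eqP/complexI e|/eqP ->].
  by rewrite mulrC (dd' _ _ e).
by rewrite mul0r mulr0.
Qed.

End Diag.

(** The inverse square root of [h] inside the corner of [p], obtained from that of h + (1 - p),
    which is invertible on the whole space. *)
Lemma isqrt_exists (h p : 'M[C]_r) :
  h^t* = h -> p^t* = p -> p *m p = p -> p *m h = h -> h *m p = h ->
  N (h - p) <= 1 / 2%:R ->
  exists s, [/\ s^t* = s, p *m s = s /\ s *m p = s, s *m s *m h = p,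
    N (s - p) <= 2%:R * N (h - p) &
    forall z, z *m h = h *m z -> z *m p = p *m z -> z *m s = s *m z].
Proof.
move=> hA pA pp ph hp hN2; pose k := h + (1%:M - p).
have kA : k^t* = k by rewrite adjmxD adjmxB adjmx1 hA pA.
have [U [d [UU UU' kE]]] := herm_udiag kA.
have kp : k - 1%:M = h - p by rewrite /k addrA addrAC [h + _]addrC addrK addrC.
have de i : `|d i - 1| <= N (h - p).
  by rewrite -kp kE -(udiag1 UU') udiagB; exact: (cn_udiag_ge UU UU' (fun i => d i - 1)).
have d2 i : 1 / 2%:R <= d i.
  by have := le_trans (de i) hN2; rewrite ler_norml => /andP[]; lra.
have dp i : 0 < d i by apply: lt_le_trans (d2 i); lra.
pose f (x : R) := (Num.sqrt x)^-1.
pose s0 := udiag U (f \o d).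
have s0k : s0 *m s0 *m k = 1%:M.
  rewrite kE !(udiagM UU) -[RHS](udiag1 UU'); apply: udiag_ext => i.
  rewrite /= /f -expr2 exprVn sqr_sqrtr ?ltW // mulVf // gt_eqF //.
have comm z : z *m k = k *m z -> z *m s0 = s0 *m z.
  by rewrite kE; apply: (udiag_comm UU UU') => i j /= ->.
have pk : p *m k = h by rewrite /k mulmxDr mulmxBr mulmx1 pp subrr addr0.
have kp' : k *m p = h by rewrite /k mulmxDl mulmxBl mul1mx pp subrr addr0.
have ps0 : p *m s0 = s0 *m p by apply: comm; rewrite pk kp'.
have s0A : s0^t* = s0 by exact: udiagA.
have s01 : s0 - 1%:M = udiag U (fun i => f (d i) - 1) by rewrite -[1%:M](udiag1 UU') udiagB.
clearbody s0; exists (p *m s0); split.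
- by rewrite adjmxM s0A pA ps0.
- by split; [rewrite mulmxA pp|rewrite -mulmxA -ps0 mulmxA pp].
- exact: corner_isqrt kp' _ _.
- have -> : p *m s0 - p = p *m (s0 - 1%:M) by rewrite mulmxBr mulmx1.
  apply: le_trans (cnM hN _ _) _.
  apply: (@le_trans _ _ (1 * (2%:R * N (h - p)))); last by rewrite mul1r.
  apply: ler_pM; rewrite ?(cn_ge0 hN) ?(cn_proj_le hN) // s01.
  apply: (cn_udiag_le UU UU') => [|i /=]; first by rewrite mulr_ge0 ?(cn_ge0 hN).
  apply: (@le_trans _ _ (2%:R * `|d i - 1|)); last by rewrite ler_pM2l.
  have := dp i; have := d2 i; rewrite /f; move: (d i) => x x2 xp.
  have q0 : 0 < Num.sqrt x by rewrite sqrtr_gt0.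
  have qq : Num.sqrt x ^+ 2 = x by rewrite sqr_sqrtr // ltW.
  (* With x at least 1/2 its root is at least 1/2, so the denominator is at least 3/4 and the factor
     2 is ample. *)
  have -> : (Num.sqrt x)^-1 - 1 = (1 - x) / (Num.sqrt x * (1 + Num.sqrt x)).
    rewrite -{2}qq; field; apply/andP; split; rewrite gt_eqF //; lra.
  rewrite normrM distrC mulrC; apply: ler_wpM2r => //.
  rewrite gtr0_norm; last by rewrite invr_gt0 mulr_gt0 //; lra.
  have q2 : 1 / 2%:R <= Num.sqrt x.
    by rewrite leNgt; apply/negP => ?; move: x2; rewrite -qq; nra.
  rewrite -div1r ler_pdivrMr ?mulr_gt0 //; nra.
- move=> z zh zp; rewrite mulmxA zp -!mulmxA; congr (_ *m _); apply: comm.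
  by rewrite /k mulmxDr mulmxDl mulmxBr mulmxBl mulmx1 mul1mx zh zp.
Qed.

(** A rank one spectral projection for the largest eigenvalue, which equals the squared norm of [y]
    by the C*-identity. Placed in a limit algebra it is an approximate eigenprojection for whatever
    [y] approximates. *)
Lemma approx_eigenproj (y : 'M[C]_r) : (0 < r)%N ->
  exists e, N e = 1 /\ y^t* *m y *m e = ((N y ^+ 2)%:C%C : C) *: e.
Proof.
move=> r0; have yA : (y^t* *m y)^t* = y^t* *m y by rewrite adjmxM trmxCK.
have [U [d [UU UU' yE]]] := herm_udiag yA.
pose i0 : 'I_r := Ordinal r0; pose i := [arg max_(i > i0) d i]%O.
have di j : d j <= d i by rewrite /i; case: arg_maxP => // k _ /(_ j isT).
have d0 j : 0 <= d j.
  have : 0 <= (U *m (y^t* *m y) *m U^t*) j j.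
    rewrite -[U *m _ *m _]mulmxA -mulmxA mulmxA -{1}[U]trmxCK -adjmxM mxE sumr_ge0 // => l _.
    by rewrite mulrC adjmxE mul_conjC_ge0.
  by rewrite yE udiagK // dg_entry eqxx mulr1n ler0c.
have NE : N y ^+ 2 = d i.
  rewrite -(cnS hN) yE; apply/eqP; rewrite eq_le; apply/andP; split.
    by apply: (cn_udiag_le UU UU') => // j; rewrite ger0_norm.
  by have := cn_udiag_ge UU UU' d i; rewrite ger0_norm.
exists (U^t* *m delta_mx i i *m U); split.
  have pA : (U^t* *m delta_mx i i *m U)^t* = U^t* *m delta_mx i i *m U.
    by rewrite !adjmxM trmxCK adjmx_delta mulmxA.
  have pp : (U^t* *m delta_mx i i *m U) *m (U^t* *m delta_mx i i *m U) = U^t* *m delta_mx i i *m U.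
    by rewrite (conjmx_mul _ _ UU) mul_delta_mx.
  case: (cn_proj hN pA pp) => // /(cn_eq0 hN) /(congr1 (fun z => U *m z *m U^t*)).
  rewrite (conjmx_canc _ UU) mulmx0 mul0mx => /matrixP/(_ i i).
  by rewrite !mxE !eqxx => /eqP; rewrite oner_eq0.
rewrite NE yE /udiag (conjmx_mul _ _ UU).
have -> : dg d *m delta_mx i i = (d i)%:C%C *: delta_mx i i.
  apply/matrixP=> a b; rewrite dgE mul_diag_mx !mxE.
  by case: (eqVneq a i) => [->|]; rewrite ?andFb ?mulr0.
by rewrite -scalemxAr -scalemxAl.
Qed.

End Spectral.
End CNorm.

Lemma dep_choice (A : Type) (T : A -> Type) (P : forall a, T a -> Prop) :
  (forall a, exists x, P a x) -> exists f : forall a, T a, forall a, P a (f a).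
Proof. by move=> h; exists (fun a => sval (cid (h a))) => a; exact: svalP. Qed.

(** * Towers and their limits *)

Section CstarCalc.
Variables (C : numClosedFieldType) (B : starAlgType C).
Implicit Types x y z : B.

Lemma amulDl x y z : amul (x + y) z = amul x z + amul y z.
Proof. by rewrite -[x]scale1r amulPl !scale1r. Qed.

Lemma amulDr x y z : amul z (x + y) = amul z x + amul z y.
Proof. by rewrite -[x]scale1r amulPr !scale1r. Qed.

Lemma amul0l z : amul 0 z = 0.
Proof. by have := amulDl 0 0 z; rewrite addr0 => /eqP; rewrite -[X in X == _]addr0 (inj_eq (addrI _)) eq_sym => /eqP. Qed.

Lemma amul0r z : amul z 0 = 0.
Proof. by have := amulDr 0 0 z; rewrite addr0 => /eqP; rewrite -[X in X == _]addr0 (inj_eq (addrI _)) eq_sym => /eqP. Qed.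

Lemma amulZl c x z : amul (c *: x) z = c *: amul x z.
Proof. by rewrite -[c *: x]addr0 amulPl amul0l addr0. Qed.

Lemma amulZr c x z : amul z (c *: x) = c *: amul z x.
Proof. by rewrite -[c *: x]addr0 amulPr amul0r addr0. Qed.

Lemma amulNl x z : amul (- x) z = - amul x z.
Proof. by rewrite -scaleN1r amulZl scaleN1r. Qed.

Lemma amulNr x z : amul z (- x) = - amul z x.
Proof. by rewrite -scaleN1r amulZr scaleN1r. Qed.

Lemma amulBl x y z : amul (x - y) z = amul x z - amul y z.
Proof. by rewrite amulDl amulNl. Qed.

Lemma amulBr x y z : amul z (x - y) = amul z x - amul z y.
Proof. by rewrite amulDr amulNr. Qed.

Lemma sadjP c x y : adj (c *: x + y) = c^* *: adj x + adj y.
Proof. exact: adjP. Qed.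

Lemma sadjD x y : adj (x + y) = adj x + adj y.
Proof. by rewrite -[x]scale1r sadjP conjC1 !scale1r. Qed.

Lemma sadj0 : adj (0 : B) = 0.
Proof. by have := sadjD 0 0; rewrite addr0 => /eqP; rewrite -[X in X == _]addr0 (inj_eq (addrI _)) eq_sym => /eqP. Qed.

Lemma sadjZ c x : adj (c *: x) = c^* *: adj x.
Proof. by rewrite -[c *: x]addr0 sadjP sadj0 addr0. Qed.

Lemma sadjN x : adj (- x) = - adj x.
Proof. by rewrite -scaleN1r sadjZ rmorphN1 scaleN1r. Qed.

Lemma sadjB x y : adj (x - y) = adj x - adj y.
Proof. by rewrite sadjD sadjN. Qed.

End CstarCalc.

Section Limits.
Variable R : realType.
Local Notation C := (R[i]).

Lemma closure_nm (V : normedModType C) (A : set V) (b : V) :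
  closure A b <-> forall e : R, 0 < e -> exists2 a, A a & nm (a - b) < e.
Proof.
split=> [h e e0|h U].
  have eC : 0 < e%:C%C by rewrite -(ltcR 0 e) in e0.
  have [a [Aa ba]] := h _ (nbhsx_ballx b _ eC).
  exists a => //; move: ba; rewrite -ball_normE /= => ba.
  by rewrite -ltcR -nmE distrC.
rewrite -nbhs_ballE => -[e /= e0 bU].
have er : e = (complex.Re e)%:C%C by rewrite RRe_real // gtr0_real.
have [|a Aa ab] := h (complex.Re e); first by rewrite -ltcR -er.
exists a; split => //; apply: bU; rewrite -ball_normE /= er distrC nmE ltcR.
by [].
Qed.

Lemma nm_cauchy (V : completeNormedModType C) (u : nat -> V) :
  (forall e : R, 0 < e -> exists M, forall m m', (M <= m)%N -> (m <= m')%N ->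
     nm (u m - u m') < e) ->
  exists b, forall e : R, 0 < e -> exists M, forall m, (M <= m)%N -> nm (u m - b) < e.
Proof.
move=> h; have cu : cvg (u @ \oo).
  apply/cauchy_cvgP/cauchy_ballP => e e0.
  have er : e = (complex.Re e)%:C%C by rewrite RRe_real // gtr0_real.
  have [|M hM] := h (complex.Re e / 2%:R); first by rewrite divr_gt0 // -ltcR -er.
  exists ([set u m | m in [set m | (M <= m)%N]], [set u m | m in [set m | (M <= m)%N]]).
    by split; exists M => // m /= Mm; exists m.
  move=> [x y] /= [[m Mm <-] [m' Mm' <-]]; rewrite -ball_normE /= er nmE ltcR.
  apply: le_lt_trans (nm_tri (u M) _ _) _.
  rewrite nmBC [complex.Re e]splitr.
  by apply: ltrD; apply: hM.
exists (lim (u @ \oo)) => e e0.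
have eC : 0 < e%:C%C by rewrite -(ltcR 0 e) in e0.
have /cvgrPdist_lt/(_ _ eC) [M _ hM] := cu.
by exists M => m /hM /=; rewrite nmE ltcR nmBC.
Qed.

(** A limit algebra seen through its stages. Compatibility is stated in [B], through [ti], so that
    elements of different stages are compared without transporting matrix sizes. *)
Record tower (B : cstarAlgType C) := Tower {
  ts : nat -> sizes;
  ts_gt0 : forall k i, (0 < ts k i)%N;
  ti : forall k, blockmx C (ts k) -> B;
  ti_hom : forall k, star_hom (@ti k);
  ti_inj : forall k, injective (@ti k);
  tcon : forall k, blockmx C (ts k) -> blockmx C (ts k.+1);
  tcon_good : forall k, good (@tcon k);
  tconE : forall k x, ti (tcon x) = @ti k x;
  ti_dense : forall (b : B) (e : R), 0 < e -> exists k x, nm (@ti k x - b) < e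
}.
Arguments ti {B} t {k} x.
Arguments tcon {B} t {k} x.

Section TowerTheory.
Variables (B : cstarAlgType C) (T : tower B).
Local Notation M k := (blockmx C (ts T k)).
Local Notation seqT := (forall m, M m).
Implicit Types (y z : seqT) (b : B).

Definition tc k : 'I_(\sum_(i < 4) ts T k i) := tagnat.Rank _ (Ordinal (ts_gt0 T k 0)).
Definition td k : 'I_(\sum_(i < 4) ts T k i) :=
  tagnat.Rank _ (Ordinal (ts_gt0 T k (2%:R : 'I_4))).

Lemma tcd k : base_pair C (tc k) (td k).
Proof.
by split; rewrite /btop /bsgn /blk ?tagnat.Rank1K //= expr0.
Qed.

Lemma tr_gt0 k : (0 < \sum_(i < 4) ts T k i)%N.
Proof. by apply: leq_ltn_trans (ltn_ord (tc k)). Qed.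

Lemma ti_cnorm k : cnorm (fun x : M k => nm (ti T x)).
Proof. by apply: shom_cnorm; [exact: ti_hom|exact: ti_inj]. Qed.

Lemma tower_map k n : (k <= n)%N -> exists al : M k -> M n,
  good al /\ forall x, ti T (al x) = ti T x.
Proof.
elim: n => [|n IH]; first by rewrite leqn0 => /eqP ->; exists id; split; [exact: good_id|].
rewrite leq_eqVlt => /orP[/eqP->|]; first by exists id; split; [exact: good_id|].
rewrite ltnS => /IH [al [gal ale]].
exists (tcon T \o al); split; first exact: (good_comp gal (tcon_good _ _)).
by move=> x /=; rewrite tconE ale.
Qed.

(** One element in each stage, converging in [B]. Identities valid stage by stage pass to the limit,
    and block or sign parts can be taken at the stages even though they are not defined in [B]. *)
Definition tends y b : Prop :=
  forall e : R, 0 < e -> exists K, forall m, (K <= m)%N -> nm (ti T (y m) - b) < e.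

Lemma tends_ev y z b : (exists K, forall m, (K <= m)%N -> y m = z m) ->
  tends y b -> tends z b.
Proof.
move=> [K hK] h e /h[K' hK']; exists (maxn K K') => m.
by rewrite geq_max => /andP[/hK <- /hK'].
Qed.

Lemma tends_uniq y b b' : tends y b -> tends y b' -> b = b'.
Proof.
move=> h h'; apply/eqP; rewrite -subr_eq0; apply/eqP/nm_eq0/eqP.
rewrite eq_le nm_ge0 andbT leNgt; apply/negP => e0.
have e2 : 0 < nm (b - b') / 2%:R by rewrite divr_gt0.
have [K hK] := h _ e2; have [K' hK'] := h' _ e2.
have := hK _ (leq_maxl K K'); have := hK' _ (leq_maxr K K').
move: (y _) => x; have := nm_tri (ti T x) b b'; rewrite [nm (b - ti T x)]nmBC.
by lra.
Qed.

Lemma tendsD y z b b' : tends y b -> tends z b' -> tends (fun m => y m + z m) (b + b').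
Proof.
move=> h h' e e0; have e2 : 0 < e / 2%:R by rewrite divr_gt0.
have [K hK] := h _ e2; have [K' hK'] := h' _ e2.
exists (maxn K K') => m; rewrite geq_max => /andP[/hK l /hK' l'].
rewrite (shomD (@ti_hom _ T m)) opprD addrACA.
by have := nmD (ti T (y m) - b) (ti T (z m) - b'); lra.
Qed.

Lemma tendsZ c y b : tends y b -> tends (fun m => c *: y m) (c *: b).
Proof.
move=> h e e0; have c0 := cabs_ge0 c.
have ec : 0 < e / (1 + cabs c) by rewrite divr_gt0 //; lra.
have [K hK] := h _ ec; exists K => m /hK.
rewrite (shomZ (@ti_hom _ T m)) -scalerBr nmZ ltr_pdivlMr; last lra.
by have := nm_ge0 (ti T (y m) - b); nra.
Qed.

Lemma tendsN y b : tends y b -> tends (fun m => - y m) (- b).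
Proof.
by move=> h e /h[K hK]; exists K => m /hK; rewrite (shomN (@ti_hom _ T m)) -opprD nmN.
Qed.

Lemma tendsB y z b b' : tends y b -> tends z b' -> tends (fun m => y m - z m) (b - b').
Proof. by move=> h /tendsN h'; exact: tendsD. Qed.

Lemma tendsA y b : tends y b -> tends (fun m => (y m)^t*) (adj b).
Proof.
move=> h e /h[K hK]; exists K => m /hK.
by rewrite (shomA (@ti_hom _ T m)) -sadjB nm_adj.
Qed.

Lemma tends_bound y b : tends y b -> exists K, forall m, (K <= m)%N -> nm (ti T (y m)) < nm b + 1.
Proof.
move=> h; have [K hK] := h 1 ltr01; exists K => m /hK.
by have := nmD (ti T (y m) - b) b; rewrite subrK; lra.
Qed.

Lemma tendsM y z b b' : tends y b -> tends z b' -> tends (fun m => y m *m z m) (amul b b').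
Proof.
move=> h h' e e0; have [K1 hK1] := tends_bound h.
have b0 := nm_ge0 b; have b'0 := nm_ge0 b'.
have e1 : 0 < e / (2%:R * (nm b' + 1)) by rewrite divr_gt0 // mulr_gt0 //; lra.
have e2 : 0 < e / (2%:R * (nm b + 1)) by rewrite divr_gt0 // mulr_gt0 //; lra.
have [K2 hK2] := h _ e1; have [K3 hK3] := h' _ e2.
exists (maxn K1 (maxn K2 K3)) => m; rewrite !geq_max => /and3P[/hK1 l1 /hK2 l2 /hK3 l3].
rewrite (shomM (@ti_hom _ T m)).
have -> : amul (ti T (y m)) (ti T (z m)) - amul b b' =
    amul (ti T (y m)) (ti T (z m) - b') + amul (ti T (y m) - b) b'.
  by rewrite amulBr amulBl addrA subrK.
apply: le_lt_trans (nmD _ _) _.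
have n1 := nmM (ti T (y m)) (ti T (z m) - b').
have n2 := nmM (ti T (y m) - b) b'.
move: l2 l3; rewrite !ltr_pdivlMr ?mulr_gt0 //; try lra.
have p1 := nm_ge0 (ti T (y m) - b); have p2 := nm_ge0 (ti T (z m) - b').
have p3 := nm_ge0 (ti T (y m)).
by move=> l2 l3; nra.
Qed.

Lemma tends0 : tends (fun m => 0) 0.
Proof. by move=> e e0; exists 0%N => m _; rewrite (shom0 (@ti_hom _ T m)) subr0 nm0. Qed.

Lemma tends_sum (I : Type) (s : seq I) (P : pred I) (y : I -> seqT) (b : I -> B) :
  (forall i, tends (y i) (b i)) ->
  tends (fun m => \sum_(i <- s | P i) y i m) (\sum_(i <- s | P i) b i).
Proof.
move=> h; elim: s => [|i s IH].
  by rewrite big_nil; apply: tends_ev tends0; exists 0%N => m _; rewrite big_nil.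
rewrite big_cons; case: ifP => Pi.
  apply: tends_ev (tendsD (h i) IH); exists 0%N => m _.
  by rewrite big_cons Pi.
by apply: tends_ev IH; exists 0%N => m _; rewrite big_cons Pi.
Qed.

Lemma tends_dom y z : (exists K, forall m, (K <= m)%N -> nm (ti T (z m)) <= nm (ti T (y m))) ->
  tends y 0 -> tends z 0.
Proof.
move=> [K hK] h e /h[K' hK']; exists (maxn K K') => m; rewrite geq_max subr0.
by move=> /andP[/hK l /hK']; rewrite subr0; exact: le_lt_trans.
Qed.

(** The copy of [x] in stage m, unique because [ti] is injective; the default 0 can occur only for m
    < k. *)
Definition tlift k (x : M k) : seqT := fun m => xget 0 [set y : M m | ti T y = ti T x].

Lemma tliftE k (x : M k) m : (k <= m)%N -> ti T (tlift x m) = ti T x.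
Proof.
move=> km; have [al [_ ale]] := tower_map km.
by rewrite /tlift; case: xgetP => [y -> //|/(_ (al x))]; rewrite /= ale.
Qed.

Lemma tlift_map k (x : M k) m (al : M k -> M m) : (k <= m)%N ->
  (forall x, ti T (al x) = ti T x) -> tlift x m = al x.
Proof. by move=> km ale; apply: (@ti_inj _ T m); rewrite tliftE // ale. Qed.

Lemma tends_lift k (x : M k) : tends (tlift x) (ti T x).
Proof.
by move=> e e0; exists k => m km; rewrite tliftE // subrr nm0.
Qed.

Lemma tends_cauchy y :
  (forall e : R, 0 < e -> exists K, forall m m', (K <= m)%N -> (m <= m')%N ->
     nm (ti T (y m) - ti T (y m')) < e) -> exists b, tends y b.
Proof. exact: nm_cauchy. Qed.

Lemma approx_seq (P : forall m, set (M m)) b :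
  (forall m, P m 0) ->
  (forall k x m, (k <= m)%N -> P k x -> exists2 x', P m x' & ti T x' = ti T x) ->
  (forall e : R, 0 < e -> exists k x, P k x /\ nm (ti T x - b) < e) ->
  exists y, (forall m, P m (y m)) /\ tends y b.
Proof.
move=> P0 nest app.
(* In stage m, choose an element meeting every tolerance 1/(i+1) with i <= j that some element of
   [P m] meets. The choice j = m converges, since by [nest] each tolerance is attainable from some
   stage on. *)
have near m j : exists x : M m, P m x /\ forall i, (i <= j)%N ->
    (exists2 x', P m x' & nm (ti T x' - b) < i.+1%:R^-1) -> nm (ti T x - b) < i.+1%:R^-1.
  elim: j => [|j [x [Px hx]]].
    have [[x' Px' hx']|no] := pselect (exists2 x', P m x' & nm (ti T x' - b) < 1%:R^-1).
      by exists x'; split=> // i; rewrite leqn0 => /eqP ->.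
    by exists 0; split=> // i; rewrite leqn0 => /eqP ->.
  have [[x' Px' hx']|no] := pselect (exists2 x', P m x' & nm (ti T x' - b) < j.+2%:R^-1).
    exists x'; split=> // i ij _; apply: lt_le_trans hx' _.
    by rewrite lef_pV2 ?posrE ?ltr0n // ler_nat.
  exists x; split=> // i; rewrite leq_eqVlt => /orP[/eqP-> //|].
  by rewrite ltnS; exact: hx.
have /dep_choice[y hy] : forall m, exists x : M m, P m x /\ forall i, (i <= m)%N ->
    (exists2 x', P m x' & nm (ti T x' - b) < i.+1%:R^-1) -> nm (ti T x - b) < i.+1%:R^-1.
  by move=> m; exact: near.
exists y; split=> [m|e e0]; first by case: (hy m).
pose j := Num.Def.truncn e^-1; have ei : 0 <= e^-1 by rewrite invr_ge0 ltW.
have je : j.+1%:R^-1 < e.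
  have /andP[_ h] := Num.Theory.truncn_itv ei.
  by rewrite -[e]invrK ltf_pV2 ?posrE ?invr_gt0 ?ltr0n.
have [k [x [Px xb]]] := app j.+1%:R^-1 ltac:(by rewrite invr_gt0 ltr0n).
exists (maxn k j) => m; rewrite geq_max => /andP[km jm].
apply: lt_trans je; have [_ h] := hy m; apply: h => //.
by have [x' Px' e'] := nest k x m km Px; exists x' => //; rewrite e'.
Qed.

End TowerTheory.
End Limits.

Arguments ti {R B} t {k} x.
Arguments tcon {R B} t {k} x.

(** * Automatic contractivity of homomorphisms into a limit *)

Section Contractive.
Variable R : realType.
Local Notation C := (R[i]).

Lemma expr_small (rho e : R) : 0 <= rho -> rho < 1 -> 0 < e ->
  exists K, forall n, (K <= n)%N -> rho ^+ n < e.
Proof.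
move=> r0 r1 e0; have := @cvg_expr R rho; rewrite ger0_norm // => /(_ r1).
move=> /cvgrPdist_lt/(_ _ e0) [K _ hK]; exists K => n /hK /=.
by rewrite sub0r normrN ger0_norm // exprn_ge0.
Qed.

(** The sum h + h^2 + h^3 + ..., which stands for h / (1 - h) in an algebra that may have no
    unit. *)
Lemma quasi_inverse (B : cstarAlgType C) (h : B) : nm h < 1 ->
  exists q, q = h + amul q h.
Proof.
set rho := nm h => r1; have r0 : 0 <= rho := nm_ge0 h.
pose s := fix s n : B := if n is m.+1 then h + amul (s m) h else 0.
pose b := rho / (1 - rho).
have b0 : 0 <= b by rewrite divr_ge0 //; lra.
have bE : b * (1 - rho) = rho by rewrite /b divfK // gt_eqF // subr_gt0.
have sb n : nm (s n) <= b.
  elim: n => [|n IH] /=; first by rewrite nm0.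
  apply: le_trans (nmD _ _) _; have := nmM (s n) h; rewrite -/rho.
  have := ler_wpM2r r0 IH; lra.
have sd n k : nm (s (n + k)%N - s n) <= rho ^+ n * b.
  elim: n => [|n IH]; first by rewrite add0n subr0 expr0 mul1r.
  rewrite addSn /= opprD addrACA subrr add0r -amulBl exprS.
  apply: le_trans (nmM _ _) _; rewrite -/rho -mulrA mulrC.
  by apply: ler_wpM2l.
have [q hq] : exists q, forall e : R, 0 < e -> exists M, forall m, (M <= m)%N -> nm (s m - q) < e.
  apply: nm_cauchy => e e0.
  have e1 : 0 < e / (b + 1) by rewrite divr_gt0 //; lra.
  have [K hK] := expr_small r0 r1 e1; exists K => m m' Km mm'.
  rewrite nmBC -(subnKC mm'); apply: le_lt_trans (sd _ _) _.
  have := hK m Km; rewrite ltr_pdivlMr; last lra.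
  by have := exprn_ge0 m r0; lra.
exists q; apply/eqP; rewrite -subr_eq0; apply/eqP/nm_eq0/eqP.
rewrite eq_le nm_ge0 andbT leNgt; apply/negP => e0.
have e1 : 0 < nm (q - (h + amul q h)) / 2%:R by rewrite divr_gt0.
have [K hK] := hq _ e1; have l1 := hK K.+1 (leqnSn K); have l2 := hK K (leqnn K).
have e2 : s K.+1 - (h + amul q h) = amul (s K - q) h.
  by rewrite /= opprD addrACA subrr add0r -amulBl.
have := nm_tri (s K.+1) q (h + amul q h); rewrite e2 [nm (q - s K.+1)]nmBC.
have := nmM (s K - q) h; rewrite -/rho.
have p := nm_ge0 (s K - q).
have : nm (s K - q) * rho <= nm (s K - q) by rewrite ler_piMr // ltW.
by lra.
Qed.

(** An isomorphism is given as a mere algebraic map, so its continuity must be derived. If |G x| >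
    |x|, put y = G x and let H be y^* y divided by |y|^2. It is the image of an element of norm < 1,
    hence has a quasi-inverse, and then no e of norm 1 can nearly satisfy H e = e. But y is close to
    a stage element, and the top eigenprojection of that element is such an e. *)
Lemma star_hom_contractive (B B' : cstarAlgType C) (T : tower B) (G : B' -> B) :
  star_hom G -> forall x, nm (G x) <= nm x.
Proof.
move=> hG x; rewrite leNgt; apply/negP => xy; set y := G x in xy.
set nu := nm y in xy; have nu0 : 0 < nu by apply: le_lt_trans xy; exact: nm_ge0.
pose k : C := (nu ^- 2)%:C%C.
have kE : cabs k = nu ^- 2.
  by rewrite cabs_real ger0_norm // invr_ge0 exprn_ge0 // ltW.
have [|q qE] := @quasi_inverse _ (k *: amul (adj x) x).
  rewrite nmZ nm_star kE mulrC ltr_pdivrMr ?exprn_gt0 // mul1r.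
  by rewrite ltr_pXn2r ?nnegrE ?nm_ge0 // ltW.
pose H := k *: amul (adj y) y.
have QE : G q = H + amul (G q) H.
  by rewrite {1}qE (shomD hG) (shomM hG) (shomZ hG) (shomM hG) (shomA hG).
have key e : nm e <= (1 + nm (G q)) * nm (e - amul H e).
  have e1 : e = (e - amul H e) + amul (G q) (e - amul H e).
    have e2 : amul (G q) e - amul (amul (G q) H) e = amul H e.
      by rewrite -amulBl {1}QE addrK.
    by rewrite amulBr amulA e2 subrK.
  rewrite {1}e1; apply: le_trans (nmD _ _) _.
  by have := nmM (G q) (e - amul H e); lra.
pose g := nm (G q); have g0 : 0 <= g := nm_ge0 _.
(* The defect e - H e will be bounded by 6 dl / nu, three units from each of two terms; with 7 in
   the denominator the resulting inequality reads 1 <= 6/7. *)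
have d0 : 0 < nu / (7%:R * (1 + g)) by rewrite divr_gt0 //; lra.
set dl := nu / _ in d0; have dlE : dl * (7%:R * (1 + g)) = nu.
  by rewrite /dl divfK // gt_eqF //; lra.
have [m [z zy]] := ti_dense T y d0.
have hN := ti_cnorm T m.
have [e [Ne eE]] := approx_eigenproj hN z (tr_gt0 T m).
rewrite /= in Ne eE.
have := key (ti T e); rewrite Ne -/g.
have hT := @ti_hom _ _ T m.
have split1 : ti T e - amul H (ti T e) =
   (k * ((nu ^+ 2 - nm (ti T z) ^+ 2)%:C%C)) *: ti T e
   + k *: amul (ti T (z^t* *m z) - amul (adj y) y) (ti T e).
  rewrite /H amulZl amulBl -(shomM hT) /amul /= eE (shomZ hT) scalerBr !scalerA.
  rewrite addrA -scalerDl -mulrDr -rmorphD subrK.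
  by rewrite /k -rmorphM mulVf ?rmorph1 ?scale1r // gt_eqF // exprn_gt0.
have z1 : nm (ti T z) - nu < dl /\ nu - nm (ti T z) < dl.
  have := nm_tri (ti T z) y 0; have := nm_tri y (ti T z) 0.
  rewrite !subr0 [nm (y - _)]nmBC -/nu; lra.
have dlnu : dl <= nu by nra.
have nz0 : 0 <= nm (ti T z) := nm_ge0 _.
have b1 : `|nu ^+ 2 - nm (ti T z) ^+ 2| <= 3%:R * nu * dl.
  by rewrite ler_norml; case: z1 => *; apply/andP; split; nra.
have b2 : nm (ti T (z^t* *m z) - amul (adj y) y) <= 3%:R * nu * dl.
  have -> : ti T (z^t* *m z) - amul (adj y) y =
     amul (adj (ti T z)) (ti T z - y) + amul (adj (ti T z - y)) y.
    by rewrite (shomM hT) (shomA hT) sadjB amulBr amulBl addrA subrK.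
  apply: le_trans (nmD _ _) _.
  have := nmM (adj (ti T z)) (ti T z - y); have := nmM (adj (ti T z - y)) y.
  rewrite !nm_adj -/nu.
  have := nm_ge0 (ti T z - y); case: z1 => *; nra.
have : nm (ti T e - amul H (ti T e)) <= nu ^- 2 * (6%:R * nu * dl).
  rewrite split1; apply: le_trans (nmD _ _) _; rewrite !nmZ Ne mulr1.
  have -> : cabs (k * (nu ^+ 2 - nm (ti T z) ^+ 2)%:C%C) = nu ^- 2 * `|nu ^+ 2 - nm (ti T z) ^+ 2|.
    by rewrite /k -rmorphM cabs_real normrM ger0_norm // invr_ge0 exprn_ge0 // ltW.
  rewrite kE -mulrDr; apply: ler_wpM2l; first by rewrite invr_ge0 exprn_ge0 // ltW.
  have := nmM (ti T (z^t* *m z) - amul (adj y) y) (ti T e); rewrite Ne mulr1.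
  by lra.
have -> : nu ^- 2 * (6%:R * nu * dl) = 6%:R * (dl / nu) by field; rewrite gt_eqF.
have -> : dl / nu = (7%:R * (1 + g))^-1.
  by rewrite -dlE; field; rewrite !gt_eqF //; lra.
set w := nm _ => w1 w2.
have : (1 + g) * w <= (1 + g) * (6%:R * (7%:R * (1 + g))^-1) by rewrite ler_pM2l //; lra.
have -> : (1 + g) * (6%:R * (7%:R * (1 + g))^-1) = 6%:R / 7%:R by field; rewrite gt_eqF //; lra.
by lra.
Qed.

End Contractive.

(** * Side parts and sign parts at a stage *)

Section SidedBlocks.
Variables (C : numClosedFieldType) (n : sizes).
Implicit Types x y : blockmx C n.

Definition Fs (s : bool) : blockmx C n := if s then Fg n else 1%:M - Fg n.

Lemma Fs_adj s : (Fs s)^t* = Fs s.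
Proof. by case: s; rewrite /= ?adjmxB ?adjmx1 Fg_adj. Qed.

Lemma Fs_idem s : Fs s *m Fs s = Fs s.
Proof.
by case: s; rewrite /= ?Fg_idem // mulmxBr mulmx1 mulmxBl mul1mx Fg_idem subrr subr0.
Qed.

Lemma Fs_S s : Sg n *m Fs s = Fs s *m Sg n.
Proof. by case: s; rewrite /= ?Sg_Fg // mulmxBr mulmxBl mulmx1 mul1mx Sg_Fg. Qed.

Lemma Fs_delta s (a b : 'I_(\sum_(i < 4) n i)) : btop a = s ->
  Fs s *m delta_mx a b = delta_mx a b.
Proof.
case: s => /= ta; rewrite ?mulmxBl ?mul1mx Fg_delta ta ?scale1r //.
by rewrite scale0r subr0.
Qed.

Lemma Fs_deltar s (a b : 'I_(\sum_(i < 4) n i)) : btop b = s ->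
  delta_mx a b *m Fs s = delta_mx a b.
Proof.
case: s => /= ta; rewrite ?mulmxBr ?mulmx1 Fg_deltar ta ?scale1r //.
by rewrite scale0r subr0.
Qed.

Lemma Fs_ortho s : Fs s *m Fs (~~ s) = 0.
Proof.
by case: s; rewrite /= ?mulmxBr ?mulmxBl ?mulmx1 ?mul1mx Fg_idem subrr.
Qed.

Lemma Fs_sum : Fs true + Fs false = 1%:M.
Proof. by rewrite addrC subrK. Qed.

Lemma fourCycle_evenpart x : fourCycle C n x -> diagalg (evenpart x).
Proof. by case/fourCycleP. Qed.

Lemma fourCycle_low x : fourCycle C n x -> Fs false *m x *m Fs true = 0.
Proof.
move=> /fourCycleE h; apply/matrixP=> a b; rewrite FgrE FcE [RHS]mxE.
have [ta|] := boolP (btop a); first by rewrite mul0r mul0r.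
have [tb ta|tb ta] := boolP (btop b); last by rewrite mulr0.
rewrite h ?mulr0 ?mul0r // (negPf ta) orbF.
by apply/negP => /eqP e; move: ta tb; rewrite /btop e => /negPf ->.
Qed.

Lemma evenpart_mul x y : Fs false *m x *m Fs true = 0 -> Fs false *m y *m Fs true = 0 ->
  evenpart (x *m y) = evenpart x *m evenpart y.
Proof.
move=> hx hy; apply/matrixP=> a b.
have ex : forall i j, ~~ btop i -> btop j -> x i j = 0.
  move=> i j ti tj; move/matrixP: hx => /(_ i j); rewrite FgrE FcE (negPf ti) tj.
  by rewrite mul1r mulr1 mxE.
have ey : forall i j, ~~ btop i -> btop j -> y i j = 0.
  move=> i j ti tj; move/matrixP: hy => /(_ i j); rewrite FgrE FcE (negPf ti) tj.
  by rewrite mul1r mulr1 mxE.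
rewrite evenpartE [in RHS]mxE; case: eqP => [tab|tab]; last first.
  rewrite big1 // => i _; rewrite !evenpartE; case: eqP => [e1|]; last by rewrite mul0r.
  by case: eqP => [e2|]; rewrite ?mulr0 //; case: tab; rewrite e1.
rewrite mxE; apply eq_bigr => i _; rewrite !evenpartE -tab.
have [ti|ti] := boolP (btop i); have [ta|ta] := boolP (btop a); rewrite ?eqxx //=.
  by rewrite (ex _ _ ta ti) !mul0r.
by rewrite (ey i b ti) -?tab ?ta ?mulr0.
Qed.

Definition Spart (s : bool) x := 2%:R^-1 *: (x + (-1) ^+ s *: (Sg n *m x *m Sg n)).

Lemma Spart_sum x : Spart false x + Spart true x = x.
Proof.
rewrite /Spart expr0 expr1 scale1r scaleN1r -scalerDr addrACA subrr addr0.
by rewrite -mulr2n -[x *+ 2]scaler_nat scalerA mulVf ?scale1r // pnatr_eq0.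
Qed.

Lemma SpartB s x y : Spart s x - Spart s y = Spart s (x - y).
Proof.
rewrite /Spart -scalerBr; congr (_ *: _).
by rewrite mulmxBr mulmxBl scalerBr opprD addrACA.
Qed.

Lemma Spart_S s x : Sg n *m Spart s x *m Sg n = (-1) ^+ s *: Spart s x.
Proof.
rewrite /Spart -scalemxAr -scalemxAl [RHS]scalerA [_ * _^-1]mulrC -scalerA; congr (_ *: _).
rewrite mulmxDr mulmxDl -scalemxAr -scalemxAl !mulmxA Sg_sqr mul1mx Sg_sqrl.
by rewrite scalerDr scalerA -expr2 sqrr_sign scale1r addrC.
Qed.

End SidedBlocks.

Section TowerNorm.
Variable R : realType.
Local Notation C := (R[i]).
Variables (B : cstarAlgType C) (T : tower B).
Local Notation M k := (blockmx C (ts T k)).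
Local Notation seqT := (forall m, M m).
Local Notation tn x := (nm (ti T x)).

Lemma tnM m (x y : M m) : tn (x *m y) <= tn x * tn y.
Proof. exact: (cnM (ti_cnorm T m)). Qed.

Lemma tnMM m (u x v : M m) : tn u <= 1 -> tn v <= 1 -> tn (u *m x *m v) <= tn x.
Proof.
move=> u1 v1; apply: le_trans (tnM _ _) _; rewrite -[X in _ <= X]mulr1.
apply: ler_pM; rewrite ?nm_ge0 //.
apply: le_trans (tnM _ _) _; rewrite -[X in _ <= X]mul1r.
by apply: ler_pM; rewrite ?nm_ge0.
Qed.

Lemma tn_proj m (p : M m) : p^t* = p -> p *m p = p -> tn p <= 1.
Proof. exact: (cn_proj_le (ti_cnorm T m)). Qed.

Lemma tn_Fs m s : tn (Fs C (ts T m) s) <= 1.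
Proof. by apply: tn_proj; rewrite ?Fs_adj ?Fs_idem. Qed.

Lemma tn_pisom m (k v : M m) : k^t* = k -> k *m k = k -> v^t* *m v = k -> tn v <= 1.
Proof. exact: (cn_pisom (ti_cnorm T m)). Qed.

Lemma tn_S m : tn (Sg (ts T m) : M m) <= 1.
Proof. by apply: (@tn_pisom m 1%:M); rewrite ?adjmx1 ?mulmx1 // Sg_adj Sg_sqr. Qed.

Lemma tn_sign m (x : M m) : tn (Sg _ *m x *m Sg _) <= tn x.
Proof. by apply: tnMM; exact: tn_S. Qed.

Lemma tn_Spart m s (x : M m) : tn (Spart s x) <= tn x.
Proof.
rewrite /Spart (shomZ (@ti_hom _ _ T m)) nmZ (shomD (@ti_hom _ _ T m)).
have -> : cabs (2%:R^-1 : C) = 2%:R^-1 :> R.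
  by rewrite -(rmorph_nat (real_complex R)) -fmorphV cabs_real ger0_norm.
rewrite mulrC ler_pdivrMr //; apply: le_trans (nmD _ _) _.
have := tn_sign x; rewrite (shomZ (@ti_hom _ _ T m)) nmZ cabs_sign; lra.
Qed.

(** The even part is the average of x and U x U for the symmetry U = F - (1 - F). *)
Lemma tn_evenpart m (x : M m) : tn (evenpart x) <= tn x.
Proof.
pose U : M m := Fg _ - (1%:M - Fg _).
have FF := Fs_idem C (ts T m) true; have GG := Fs_idem C (ts T m) false.
have FG := Fs_ortho C (ts T m) true; have GF := Fs_ortho C (ts T m) false.
have FS := Fs_sum C (ts T m).
rewrite /= in FF GG FG GF FS.
have Ul (z : M m) a b : (U *m z) a b = (if btop a then 1 else -1) * z a b.
  rewrite /U mulmxBl mxE [(- _ : 'M[C]_(_, _)) _ _]mxE FgE FcE.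
  by case: (btop a); rewrite /= ?mul1r ?mul0r ?subr0 ?sub0r ?mulN1r.
have Ur (z : M m) a b : (z *m U) a b = z a b * (if btop b then 1 else -1).
  rewrite /U mulmxBr mxE [(- _ : 'M[C]_(_, _)) _ _]mxE FgrE FcrE.
  by case: (btop b); rewrite /= ?mulr1 ?mulr0 ?subr0 ?sub0r ?mulrN1.
have h2 : 2%:R != 0 :> C by rewrite pnatr_eq0.
have UE : evenpart x = 2%:R^-1 *: (x + U *m x *m U).
  apply/matrixP=> a b; rewrite evenpartE [RHS]mxE [X in _ = _ * X]mxE Ur Ul.
  case: (btop a); case: (btop b); rewrite /= ?mul1r ?mulr1 ?mulN1r ?mulrN1 ?opprK ?subrr ?mulr0 //.
    by rewrite -mulr2n -[x a b *+ 2]mulr_natl mulKf.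
  by rewrite -mulr2n -[x a b *+ 2]mulr_natl mulKf.
have UA : U^t* = U by rewrite /U !adjmxB adjmx1 Fg_adj.
have UU : U *m U = 1%:M.
  by rewrite /U mulmxBl !(mulmxBr _ (Fg _) (1%:M - Fg _)) FF GG FG GF subr0 sub0r opprK.
have U1 : tn U <= 1 by apply: (@tn_pisom m 1%:M); rewrite ?adjmx1 ?mulmx1 // UA.
rewrite UE (shomZ (@ti_hom _ _ T m)) nmZ (shomD (@ti_hom _ _ T m)).
have -> : cabs (2%:R^-1 : C) = 2%:R^-1 :> R.
  by rewrite -(rmorph_nat (real_complex R)) -fmorphV cabs_real ger0_norm.
rewrite mulrC ler_pdivrMr //; apply: le_trans (nmD _ _) _.
have := tnMM x U1 U1; lra.
Qed.

End TowerNorm.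

Lemma mulmx_sandB (K : pzRingType) r (u a b v : 'M[K]_r) :
  u *m (a - b) *m v = u *m a *m v - u *m b *m v.
Proof. by rewrite mulmxBr mulmxBl. Qed.

Lemma evenpartB (C : numClosedFieldType) n (x y : blockmx C n) :
  evenpart (x - y) = evenpart x - evenpart y.
Proof. by rewrite /evenpart !mulmx_sandB opprD addrACA. Qed.

(** * Membership in the operator algebra limit *)

Section InLimit.
Variable R : realType.
Local Notation C := (R[i]).
Variables (B : cstarAlgType C) (T : tower B).
Local Notation M k := (blockmx C (ts T k)).
Local Notation seqT := (forall m, M m).
Local Notation tn x := (nm (ti T x)).

Definition inA (b : B) : Prop := forall e : R, 0 < e ->
  exists k (x : M k), fourCycle C _ x /\ nm (ti T x - b) < e.

Lemma fourCycle_nest k (x : M k) m : (k <= m)%N -> fourCycle C _ x ->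
  exists2 x' : M m, fourCycle C _ x' & ti T x' = ti T x.
Proof.
move=> km hx; have [al [gal ale]] := tower_map T km.
by exists (al x); [exact: good_fourCycle|exact: ale].
Qed.

Lemma inA_seq b : inA b -> exists y : seqT, (forall m, fourCycle C _ (y m)) /\ tends y b.
Proof.
apply: (approx_seq (P := fun m => fourCycle C (ts T m))).
- by move=> m; exact: fourCycle0.
- by move=> k x m km /(fourCycle_nest km).
Qed.

Lemma seq_inA (y : seqT) b : (forall m, fourCycle C _ (y m)) -> tends y b -> inA b.
Proof.
by move=> hy h e /h[K hK]; exists K, (y K); split; [exact: hy|exact: hK].
Qed.

Lemma ti_inA k (x : M k) : fourCycle C _ x -> inA (ti T x).
Proof. by move=> hx e e0; exists k, x; rewrite subrr nm0. Qed.

Lemma dense_seq b : exists y : seqT, tends y b.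
Proof.
have [] := @approx_seq R B T (fun m => setT) b.
- by [].
- by move=> k x m km _; have [al [_ ale]] := tower_map T km; exists (al x) => //.
- by move=> e /(ti_dense T b)[k [x xb]]; exists k, x.
- by move=> y [_ h]; exists y.
Qed.

(** Let [y] and [z] approximate [b] and its adjoint by 4-cycle elements. The adjoint of [z] has no
    upper right corner, so the corner of [y] is that of the difference of the two, which tends to
    0. *)
Lemma inA_diag b : inA b -> inA (adj b) ->
  exists d : seqT, (forall m, diagalg (d m)) /\ tends d b.
Proof.
move=> /inA_seq[y [yA yb]] /inA_seq[z [zA zb]].
exists (fun m => evenpart (y m)); split; first by move=> m; exact: fourCycle_evenpart.
have h0 : tends (fun m => y m - (z m)^t*) 0.
  by rewrite -(subrr b) -[X in _ - X]adjK; apply: tendsB => //; exact: tendsA.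
have h1 : tends (fun m => y m - evenpart (y m)) 0.
  apply: (tends_dom _ h0); exists 0%N => m _.
  have [_ ->] := (fourCycleP _).1 (yA m).
  have -> : Fg (ts T m) *m y m *m (1%:M - Fg (ts T m)) =
      Fs C _ true *m (y m - (z m)^t*) *m Fs C _ false.
    rewrite mulmx_sandB; suff -> : Fs C _ true *m (z m)^t* *m Fs C _ false = 0 by rewrite subr0.
    transitivity ((Fs C _ false *m z m *m Fs C _ true)^t*).
      by rewrite !adjmxM !Fs_adj mulmxA.
    by rewrite (fourCycle_low (zA m)) adjmx0.
  by apply: tnMM; exact: tn_Fs.
rewrite -[b]subr0; apply: (tends_ev _ (tendsB yb h1)).
by exists 0%N => m _; rewrite opprB addrC subrK.
Qed.

Lemma diag_inA (d : seqT) b : (forall m, diagalg (d m)) -> tends d b ->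
  inA b /\ inA (adj b).
Proof.
move=> hd h; split; first by apply: seq_inA h => m; exact: fourCycle_diagalg.
by apply: seq_inA (tendsA h) => m; apply: fourCycle_diagalg; exact: diagalgA.
Qed.

Lemma good_evenpart (D : numClosedFieldType) n n' (Phi : blockmx D n -> blockmx D n') x : good Phi ->
  evenpart (Phi x) = Phi (evenpart x).
Proof.
move=> g; have h := good_hom g.
rewrite /evenpart !mulmxBl !mulmxBr !mulmx1 !mul1mx !(good_F g) !(good_Fr g).
by rewrite !(shomD h, shomN h) -!mulmxA.
Qed.

Lemma good_Spart n n' (Phi : blockmx C n -> blockmx C n') s x : good Phi ->
  Fg n *m x = x *m Fg n -> Spart s (Phi x) = Phi (Spart s x).
Proof.
move=> g xF; have h := good_hom g; rewrite /Spart.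
by have [_ _ ->] := g; rewrite // (shomZ h) (shomD h) (shomZ h).
Qed.

Lemma tends_evenpart (y : seqT) b : tends y b -> exists c, tends (fun m => evenpart (y m)) c.
Proof.
move=> h; apply: tends_cauchy => e e0.
have e2 : 0 < e / 2%:R by rewrite divr_gt0.
have [K hK] := h _ e2; exists K => m m' Km mm'.
have [al [gal ale]] := tower_map T mm'.
rewrite -ale -(good_evenpart _ gal) -(shomB (@ti_hom _ _ T m')).
rewrite -evenpartB.
apply: le_lt_trans (tn_evenpart _) _; rewrite (shomB (@ti_hom _ _ T m')) ale.
have := nm_tri b (ti T (y m)) (ti T (y m')); rewrite [nm (b - _)]nmBC.
by have := hK _ Km; have := hK _ (leq_trans Km mm'); lra.
Qed.

Lemma tends_Spart s (y : seqT) b : (forall m, Fg _ *m y m = y m *m Fg _) ->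
  tends y b -> exists c, tends (fun m => Spart s (y m)) c.
Proof.
move=> yF h; apply: tends_cauchy => e e0.
have e2 : 0 < e / 2%:R by rewrite divr_gt0.
have [K hK] := h _ e2; exists K => m m' Km mm'.
have [al [gal ale]] := tower_map T mm'.
rewrite -ale -(good_Spart _ gal) // -(shomB (@ti_hom _ _ T m')).
have -> : Spart s (al (y m)) - Spart s (y m') = Spart s (al (y m) - y m').
  rewrite /Spart mulmxBr mulmxBl -scalerBr; congr (_ *: _).
  by rewrite scalerBr opprD addrACA.
apply: le_lt_trans (tn_Spart _ _) _; rewrite (shomB (@ti_hom _ _ T m')) ale.
have := nm_tri b (ti T (y m)) (ti T (y m')); rewrite [nm (b - _)]nmBC.
by have := hK _ Km; have := hK _ (leq_trans Km mm'); lra.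
Qed.

Lemma tends_Spart0 s (y : seqT) : tends y 0 -> tends (fun m => Spart s (y m)) 0.
Proof. by move=> h; apply: (tends_dom _ h); exists 0%N => m _; exact: tn_Spart. Qed.

Lemma tends_evenpart0 (y : seqT) : tends y 0 -> tends (fun m => evenpart (y m)) 0.
Proof. by move=> h; apply: (tends_dom _ h); exists 0%N => m _; exact: tn_evenpart. Qed.

(** At each stage the product x y x passes through the lower left corner of y, which is zero. The
    relation mentions only A, so it survives an isomorphism. *)
Lemma rad_ann k (x : M k) a : x = Fg _ *m x *m (1%:M - Fg _) -> inA a ->
  amul (amul (ti T x) a) (ti T x) = 0.
Proof.
move=> hx /inA_seq[y [yA ya]].
have h := tendsM (tendsM (tends_lift x) ya) (tends_lift x).
apply: (tends_uniq h); apply: (tends_ev _ (tends0 T)); exists k => m km.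
have [al [gal ale]] := tower_map T km; rewrite (tlift_map x km ale).
have e : al x = Fs C _ true *m al x *m Fs C _ false.
  by rewrite /= mulmxBr mulmx1 (good_F gal) (good_Fr gal) -(shomB (good_hom gal))
    -{1}[Fg _ *m x]mulmx1 -mulmxBr -hx.
rewrite e !mulmxA -[_ *m y m *m Fs _ _ true]mulmxA -[_ *m Fs _ _ false *m (y m *m _)]mulmxA.
by rewrite [Fs _ _ false *m (y m *m _)]mulmxA (fourCycle_low (yA m)) mulmx0 !mul0mx.
Qed.

Lemma nm_cube0 (d : B) : amul (amul d (adj d)) d = 0 -> d = 0.
Proof.
move=> h; have : nm (amul (adj d) d) = 0.
  apply/eqP; rewrite -sqrf_eq0 -nm_star adjM adjK -amulA.
  by rewrite [amul d (amul _ _)]amulA h amul0r nm0.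
by rewrite nm_star => /eqP; rewrite sqrf_eq0 => /eqP/nm_eq0.
Qed.

End InLimit.

Record tower_iso (R : realType) (B B' : cstarAlgType R[i]) (T : tower B)
    (T' : tower B') (F : B -> B') (G : B' -> B) : Prop := TowerIso {
  iso_homF : star_hom F;
  iso_homG : star_hom G;
  iso_FK : cancel F G;
  iso_GK : cancel G F;
  iso_FA : forall b, inA T b -> inA T' (F b);
  iso_GA : forall b, inA T' b -> inA T (G b)
}.

Lemma tower_iso_sym (R : realType) (B B' : cstarAlgType R[i]) (T : tower B)
    (T' : tower B') F G : tower_iso T T' F G -> tower_iso T' T G F.
Proof. by case. Qed.

Lemma sand_fixl (C : numClosedFieldType) r (p y q : 'M[C]_r) :
  p *m p = p -> y = p *m y *m q -> p *m y = y.
Proof. by move=> pp e; rewrite e !mulmxA pp. Qed.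

Lemma sand_fixr_adj (C : numClosedFieldType) r (p y q : 'M[C]_r) :
  q *m q = q -> q^t* = q -> y = p *m y *m q -> q *m y^t* = y^t*.
Proof. by move=> qq qA e; rewrite e !adjmxM qA mulmxA qq. Qed.

Lemma sand_mul_adj (C : numClosedFieldType) r (p y z : 'M[C]_r) :
  p^t* = p -> p *m y = y -> p *m z = z -> y *m z^t* = p *m (y *m z^t*) *m p.
Proof.
move=> pA py pz; rewrite !mulmxA py -mulmxA; congr (_ *m _).
by rewrite -{1}pz adjmxM pA.
Qed.

Lemma Spart_Fs (C : numClosedFieldType) n s t (x : blockmx C n) :
  Fs C n s *m Spart t x *m Fs C n s = Spart t (Fs C n s *m x *m Fs C n s).
Proof.
rewrite /Spart -scalemxAr -scalemxAl mulmxDr mulmxDl -scalemxAr -scalemxAl.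
congr (_ *: (_ + _ *: _)).
by rewrite !mulmxA -Fs_S -!mulmxA Fs_S.
Qed.

(** * Approximating an isomorphism of limits *)

Section HomogeneousApproximants.
Variable R : realType.
Local Notation C := (R[i]).
Variables (B B' : cstarAlgType C) (T : tower B) (T' : tower B').
Variables (F : B -> B') (G : B' -> B).
Hypothesis FG : tower_iso T T' F G.
Let hF := iso_homF FG.
Let hG := iso_homG FG.
Local Notation M k := (blockmx C (ts T k)).
Local Notation M' k := (blockmx C (ts T' k)).
Local Notation seqT' := (forall m, M' m).
Local Notation rho x := (F (ti T x)).

Lemma iso_nm b : nm (F b) = nm b.
Proof.
apply/eqP; rewrite eq_le (star_hom_contractive T' hF) /=.
by rewrite -{1}(iso_FK FG b) (star_hom_contractive T hG).
Qed.

Lemma rho_hom k : star_hom (fun x : M k => rho x).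
Proof. exact: (shom_comp (@ti_hom _ _ T k) hF). Qed.

(** Let c be the limit of the block-diagonal parts of 4-cycle approximants y. Since c and its
    adjoint lie in the image algebra, [rad_ann] pulled back by [G] shows that x c^* x vanishes for
    the image x. On upper triangular matrices the block-diagonal part is multiplicative, so that of
    y d^* y, for d the block-diagonal part of y, is d d^* d; in the limit c c^* c = 0, hence c = 0,
    and only the radical part of y matters. *)
Lemma rad_approx k (x : M k) : x = Fg _ *m x *m (1%:M - Fg _) ->
  exists y : seqT', (forall m, y m = Fg _ *m y m *m (1%:M - Fg _)) /\ tends y (rho x).
Proof.
move=> hx; have xA : inA T (ti T x) by apply: ti_inA; exact: fourCycle_rad.
have [y [yA yb]] := inA_seq (iso_FA FG xA).
have [c yc] := tends_evenpart yb.
have dA m : diagalg (evenpart (y m)) by exact: fourCycle_evenpart.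
have [_ cA] := diag_inA dA yc.
have ann : amul (amul (rho x) (adj c)) (rho x) = 0.
  have := rad_ann hx (iso_GA FG cA) => /(congr1 F).
  by rewrite !(shomM hF) (iso_GK FG) (shom0 hF).
have h0 := tendsM (tendsM yb (tendsA yc)) yb; rewrite ann in h0.
have h1 : tends (fun m => evenpart (y m) *m (evenpart (y m))^t* *m evenpart (y m)) 0.
  apply: (tends_ev _ (tends_evenpart0 h0)); exists 0%N => m _.
  have low := fourCycle_low (yA m).
  have ev : Fs C _ false *m (evenpart (y m))^t* *m Fs C _ true = 0.
    by apply: fourCycle_low; apply: fourCycle_diagalg; apply: diagalgA.
  have dd : evenpart ((evenpart (y m))^t*) = (evenpart (y m))^t*.
    apply/matrixP=> a b; rewrite evenpartE adjmxE evenpartE eq_sym.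
    by case: eqP; rewrite ?conjC0.
  rewrite (evenpart_mul _ low) ?(evenpart_mul low ev) ?dd //.
  have -> : Fs C _ false *m (y m *m (evenpart (y m))^t*) =
    Fs C _ false *m y m *m (Fs C _ true + Fs C _ false) *m (evenpart (y m))^t*.
    by rewrite Fs_sum mulmx1 mulmxA.
  rewrite mulmxDr low add0r -!mulmxA.
  by rewrite [Fs C _ false *m (_^t* *m _)]mulmxA ev !mulmx0.
have c0 : c = 0.
  by apply: nm_cube0; apply: tends_uniq (tendsM (tendsM yc (tendsA yc)) yc) h1.
exists (fun m => Fg _ *m y m *m (1%:M - Fg _)); split.
  move=> m; rewrite !mulmxA Fg_idem -[RHS]mulmxA.
  by have := Fs_idem C (ts T' m) false => /= ->.
rewrite -[rho x]subr0 -c0; apply: (tends_ev _ (tendsB yb yc)).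
by exists 0%N => m _; have [_ ->] := (fourCycleP _).1 (yA m).
Qed.

Variable k : nat.
Implicit Types a b : 'I_(\sum_(i < 4) ts T k i).
Local Notation E a b := (delta_mx a b : M k).

Lemma delta_rad a b : btop a -> ~~ btop b ->
  E a b = Fg _ *m E a b *m (1%:M - Fg _).
Proof.
move=> ta tb; have := @Fs_delta C _ true a b ta => /= ->.
by have := @Fs_deltar C _ false a b (negPf tb) => /= ->.
Qed.

(** A unit within one side is the product of a radical unit and the adjoint of a radical unit,
    through an index on the other side. *)
Lemma side_approx s a b : btop a = s -> btop b = s ->
  exists y : seqT', (forall m, y m = Fs C _ s *m y m *m Fs C _ s) /\ tends y (rho (E a b)).
Proof.
have [tct ntd _ _] := tcd T k; have hr := rho_hom k.
case: s => ta tb.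
  have [y [yr ya]] := rad_approx (delta_rad ta ntd).
  have [z [zr zb]] := rad_approx (delta_rad tb ntd).
  exists (fun m => y m *m (z m)^t*); split.
    by move=> m; apply: sand_mul_adj (Fg_adj _ _) (sand_fixl (Fg_idem _ _) (yr m)) (sand_fixl (Fg_idem _ _) (zr m)).
  have -> : rho (E a b) = amul (rho (E a (td T k))) (adj (rho (E b (td T k)))).
    by rewrite -(shomA hr) -(shomM hr) /amul /adj /= adjmx_delta mul_delta_mx.
  exact: tendsM ya (tendsA zb).
have [y [yr ya]] := rad_approx (delta_rad tct (negbT ta)).
have [z [zr zb]] := rad_approx (delta_rad tct (negbT tb)).
exists (fun m => (y m)^t* *m z m); split.
  move=> m; rewrite -[X in _ *m X]trmxCK.
  have e := Fs_idem C (ts T' m) false; have eA := Fs_adj C (ts T' m) false.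
  by apply: (sand_mul_adj eA); exact: (sand_fixr_adj e eA).
have -> : rho (E a b) = amul (adj (rho (E (tc T k) a))) (rho (E (tc T k) b)).
  by rewrite -(shomA hr) -(shomM hr) /amul /adj /= adjmx_delta mul_delta_mx.
exact: tendsM (tendsA ya) zb.
Qed.

(** The unit and its adjoint both lie in A, so [inA_diag] gives block-diagonal approximants;
    comparison with [side_approx] shows that cutting them to side [s] does not change the limit. *)
Lemma diag_approx s a b : btop a = s -> blk a = blk b ->
  exists y : seqT', (forall m, diagalg (y m) /\ y m = Fs C _ s *m y m *m Fs C _ s) /\
    tends y (rho (E a b)).
Proof.
move=> ta ab; have tb : btop b = s by rewrite -ta /btop ab.
have hr := rho_hom k.
have iA : inA T' (rho (E a b)) by apply: (iso_FA FG); apply: ti_inA; apply: fourCycle_delta; rewrite ab eqxx.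
have iA' : inA T' (adj (rho (E a b))).
  rewrite -(shomA hr) /adj /= adjmx_delta.
  by apply: (iso_FA FG); apply: ti_inA; apply: fourCycle_delta; rewrite ab eqxx.
have [d [dA db]] := inA_diag iA iA'.
have [y [yF yb]] := side_approx ta tb.
have h0 : tends (fun m => d m - y m) 0 by rewrite -(subrr (rho (E a b))); exact: tendsB.
exists (fun m => Fs C _ s *m d m *m Fs C _ s); split.
  move=> m; split.
    have FsD : diagalg (Fs C (ts T' m) s).
      by split; [case: s {ta tb y yF yb h0} => //=; rewrite mulmxBr mulmxBl mulmx1 mul1mx|exact: Fs_S].
    by apply: diagalgM => //; apply: diagalgM.
  by rewrite !mulmxA Fs_idem -!mulmxA Fs_idem.
rewrite -[rho _]add0r.
have h1 : tends (fun m => Fs C _ s *m (d m - y m) *m Fs C _ s) 0.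
  by apply: (tends_dom _ h0); exists 0%N => m _; apply: tnMM; exact: tn_Fs.
apply: (tends_ev _ (tendsD h1 yb)); exists 0%N => m _.
by rewrite mulmx_sandB -yF subrK.
Qed.

Lemma Fs_even (n : sizes) s (y : blockmx C n) : y = Fs C n s *m y *m Fs C n s ->
  Fg n *m y = y *m Fg n.
Proof.
move=> ->; have e : Fg n *m Fs C n s = Fs C n s *m Fg n.
  by case: s {y}; rewrite //= mulmxBr mulmxBl mulmx1 mul1mx.
have e2 : Fs C n s *m Fg n = if s then Fs C n s else 0.
  by case: s {y e}; rewrite /= ?Fg_idem // mulmxBl mul1mx Fg_idem subrr.
rewrite !mulmxA e e2 -[RHS]mulmxA e2.
by case: s {e e2}; rewrite ?mul0mx ?mulmx0.
Qed.

(** It must be shown that the sign-even parts of the side approximants tend to 0. Their limit [c]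
    lies in A and so does its adjoint; the pullback [g] of [c] is therefore a limit of
    block-diagonal elements, and these admit a symmetry that rules out a nonzero [g]. *)
Lemma odd_approx s a b : btop a = s -> btop b = s -> bsgn a != bsgn b :> C ->
  exists y : seqT', (forall m, Sg _ *m y m *m Sg _ = - y m /\
    y m = Fs C _ s *m y m *m Fs C _ s) /\ tends y (rho (E a b)).
Proof.
move=> ta tb sab; have hr := rho_hom k.
have [y [yF yb]] := side_approx ta tb.
have [c yc] := tends_Spart false (fun m => Fs_even (yF m)) yb.
pose w m := Spart false (y m).
have wS m : Sg _ *m w m = w m *m Sg _.
  by rewrite -[LHS]Sg_sqrl Spart_S expr0 scale1r.
have wD m : diagalg (w m).
  split=> //; rewrite /w /Spart -scalemxAr -scalemxAl; congr (_ *: _).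
  rewrite expr0 scale1r mulmxDr mulmxDl; congr (_ + _); first exact: Fs_even (yF m).
  by rewrite !mulmxA -Sg_Fg -[_ *m Fg _ *m y m]mulmxA (Fs_even (yF m)) -[RHS]mulmxA Sg_Fg !mulmxA.
have [cA cA'] := diag_inA wD yc.
have [d1 [d1D d1a]] := diag_approx ta (erefl (blk a)).
have [d2 [d2D d2b]] := diag_approx tb (erefl (blk b)).
have sandw (u v : seqT') : (forall m, diagalg (u m)) -> (forall m, diagalg (v m)) ->
    forall m, Spart false (u m *m y m *m v m) = u m *m w m *m v m.
  move=> uD vD m; have [_ uS] := uD m; have [_ vS] := vD m.
  rewrite /w /Spart expr0 !scale1r -scalemxAr -scalemxAl mulmxDr mulmxDl; congr (_ *: (_ + _)).
  by rewrite !mulmxA uS -[_ *m v m *m Sg _]mulmxA -vS !mulmxA.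
have c_corner : amul (amul (rho (E a a)) c) (rho (E b b)) = c.
  have h0 : tends (fun m => d1 m *m y m *m d2 m - y m) 0.
    rewrite -(subrr (rho (E a b))); apply: (tendsB _ yb).
    have -> : E a b = E a a *m E a b *m E b b by rewrite !mul_delta_mx.
    rewrite (shomM hr) (shomM hr); exact: tendsM (tendsM d1a yb) d2b.
  have := tendsB (tendsM (tendsM d1a yc) d2b) yc => h1.
  apply/eqP; rewrite -subr_eq0; apply/eqP; apply: (tends_uniq h1).
  apply: (tends_ev _ (tends_Spart0 false h0)); exists 0%N => m _.
  rewrite -(sandw d1 d2 (fun m => (d1D m).1) (fun m => (d2D m).1)) /w.
  by rewrite SpartB.
pose g := G c; have gc : F g = c by rewrite /g (iso_GK FG).
have Finj := can_inj (iso_FK FG).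
have g_corner : amul (amul (ti T (E a a)) g) (ti T (E b b)) = g.
  by apply: Finj; rewrite !(shomM hF) gc.
have gA : inA T g := iso_GA FG cA.
have gA' : inA T (adj g) by rewrite /g -(shomA hG); exact: (iso_GA FG).
have [z [zD zg]] := inA_diag gA gA'.
(* Taking the sign-even part commutes with multiplication by block-diagonal elements, so a
   commutation relation of the unit with such an element is inherited by [c], hence by [g]. *)
have comm n (Ab : M n) : diagalg Ab ->
    amul (ti T Ab) (ti T (E a b)) = amul (ti T (E a b)) (ti T Ab) ->
    amul (ti T Ab) g = amul g (ti T Ab).
  move=> AbD e; apply: Finj; rewrite !(shomM hF) gc.
  have iA : inA T' (rho Ab) by apply: (iso_FA FG); apply: ti_inA; exact: fourCycle_diagalg.
  have iA' : inA T' (adj (rho Ab)).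
    rewrite -(shomA (rho_hom n)); apply: (iso_FA FG); apply: ti_inA.
    by apply: fourCycle_diagalg; exact: diagalgA.
  have [h [hD hb]] := inA_diag iA iA'.
  have h0 : tends (fun m => h m *m y m - y m *m h m) 0.
    have -> : 0 = amul (rho Ab) (rho (E a b)) - amul (rho (E a b)) (rho Ab).
      by rewrite -!(shomM hF) e subrr.
    by apply: tendsB; exact: tendsM.
  apply/eqP; rewrite -subr_eq0; apply/eqP.
  apply: (tends_uniq (tendsB (tendsM hb yc) (tendsM yc hb))).
  apply: (tends_ev _ (tends_Spart0 false h0)); exists 0%N => m _.
  have one m' : diagalg (1%:M : M' m') by exact: diagalg1.
  have e1 := sandw h (fun=> 1%:M) hD one m; have e2 := sandw (fun=> 1%:M) h one hD m.
  rewrite !mulmx1 in e1; rewrite !mul1mx in e2; rewrite -e1 -e2.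
  by rewrite SpartB.
suff g0 : g = 0.
  exists (fun m => Spart true (y m)); split.
    move=> m; split; first by rewrite Spart_S expr1 scaleN1r.
    by rewrite Spart_Fs -yF.
  rewrite -[rho _]subr0; have -> : 0 = c by rewrite -gc g0 (shom0 hF).
  apply: (tends_ev _ (tendsB yb yc)); exists 0%N => m _.
  by rewrite -{1}[y m]Spart_sum addrC addKr.
have wg : tends (fun m => tlift (E a a) m *m z m *m tlift (E b b) m) g.
  by rewrite -g_corner; exact: tendsM (tendsM (tends_lift _) zg) (tends_lift _).
apply/nm_eq0/eqP; rewrite eq_le nm_ge0 andbT leNgt; apply/negP => e0.
have [K hK] := wg _ e0.
set n := maxn k K; have kn : (k <= n)%N := leq_maxl _ _.
have := hK n (leq_maxr _ _).
have [al [gal ale]] := tower_map T kn; rewrite !(tlift_map _ kn ale).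
have hal := good_hom gal; have hn := @ti_hom _ _ T n.
(* On images of elements commuting with [Fg] the two signatures act by the same conjugation, so [A]
   commutes with the image of the unit e_ab. In the corners at a and b it is the signature of stage
   n times [bsgn a] and [bsgn b]. These signs differ, so conjugation by [A] negates block-diagonal
   elements between the corners. *)
pose A : M n := Sg _ *m al (Sg _).
have SF : (Fg _ : M k) *m Sg _ = Sg _ *m Fg _ by rewrite -Sg_Fg.
have alSS : Sg _ *m al (Sg _) = al (Sg _) *m Sg _.
  by rewrite (good_S gal SF) Sg_sqr mul1mx.
have Acomm (x : M k) : Fg _ *m x = x *m Fg _ -> A *m al x = al x *m A.
  move=> xF; have e : Fg _ *m (Sg _ *m x) = (Sg _ *m x) *m Fg _.
    by rewrite mulmxA SF -[LHS]mulmxA xF mulmxA.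
  rewrite /A -[LHS]mulmxA -(mhomM hal) (good_S gal e).
  by rewrite [X in al (X *m _)]mulmxA Sg_sqr mul1mx (mhomM hal) -[LHS]mulmxA -alSS.
have AA : A *m A = al 1%:M.
  rewrite {1}/A alSS /A mulmxA -[_ *m Sg _ *m Sg _]mulmxA Sg_sqr mulmx1.
  by rewrite -(mhomM hal) Sg_sqr.
have At : A^t* = A by rewrite /A adjmxM -(mhomA hal) !Sg_adj alSS.
have AD : diagalg A.
  by apply: diagalgM; [split; rewrite ?Sg_Fg|apply: (good_diagalg gal); split; rewrite ?Sg_Fg].
have A1 : nm (ti T A) <= 1.
  apply: (@tn_pisom _ _ _ _ (al 1%:M)); rewrite -?(mhomA hal) ?adjmx1 -?(mhomM hal) ?mulmx1 //.
  by rewrite At AA.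
have Ag : amul (ti T A) g = amul g (ti T A).
  apply: comm => //; rewrite -ale -!(shomM hn); congr (ti T _).
  by apply: Acomm; apply: delta_even; rewrite ta tb.
have gAA : amul (amul (ti T A) g) (ti T A) = g.
  rewrite Ag -amulA -(shomM hn) [amul A A]AA ale -{1}g_corner -!amulA.
  by rewrite -(shomM (@ti_hom _ _ T k)) [amul _ 1%:M]mulmx1 amulA g_corner.
have aD : diagalg (al (E a a)) by apply: (good_diagalg gal); exact: diagalg_delta.
have bD : diagalg (al (E b b)) by apply: (good_diagalg gal); exact: diagalg_delta.
pose w' := al (E a a) *m z n *m al (E b b).
have w'D : diagalg w' by apply: diagalgM => //; exact: diagalgM.
have Aw : A *m w' *m A = - w'.
  have Al : A *m al (E a a) = bsgn a *: (Sg _ *m al (E a a)).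
    by rewrite /A -mulmxA -(mhomM hal) Sg_delta (shomZ hal) -scalemxAr.
  have Ar : al (E b b) *m A = bsgn b *: (al (E b b) *m Sg _).
    by rewrite /A alSS mulmxA -(mhomM hal) Sg_deltar (shomZ hal) -scalemxAl.
  have -> : A *m w' *m A = (A *m al (E a a)) *m z n *m (al (E b b) *m A).
    by rewrite /w' !mulmxA.
  rewrite Al Ar -scalemxAr -!scalemxAl scalerA.
  have -> : Sg _ *m al (E a a) *m z n *m (al (E b b) *m Sg _) = Sg _ *m w' *m Sg _.
    by rewrite /w' !mulmxA.
  have [_ ->] := w'D; rewrite Sg_sqrl.
  suff -> : bsgn b * bsgn a = -1 :> C by rewrite scaleN1r.
  move: sab; rewrite /bsgn; case: (odd _); case: (odd _); rewrite ?eqxx // => _.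
    by rewrite expr0 expr1 mul1r.
  by rewrite expr0 expr1 mulr1.
(* Conjugation by [A] fixes [g] and negates [w'], so both [w'] and - [w'] are within |g - w'| of
   [g]. Adding up, 2 |g| <= 2 |g - w'| < 2 |g|. *)
rewrite -/w' => w'g; clearbody w'.
have e1 : nm (g - ti T (A *m w' *m A)) <= nm (ti T w' - g).
  have -> : ti T (A *m w' *m A) = amul (amul (ti T A) (ti T w')) (ti T A).
    by rewrite (shomM hn) (shomM hn).
  rewrite -{1}gAA -amulBl -amulBr [nm (ti T w' - g)]nmBC.
  apply: le_trans (nmM _ _) _; rewrite -[X in _ <= X]mulr1.
  apply: ler_pM; rewrite ?nm_ge0 //.
  apply: le_trans (nmM _ _) _; rewrite -[X in _ <= X]mul1r.
  by apply: ler_pM; rewrite ?nm_ge0.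
have e2 : nm (g + g) = 2%:R * nm g.
  rewrite -mulr2n -scaler_nat nmZ -(rmorph_nat (real_complex R)) cabs_real.
  by rewrite ger0_norm.
have e3 : g + g = (g - ti T (A *m w' *m A)) + (g - ti T w').
  by rewrite Aw (shomN hn) opprK addrACA subrr addr0.
have := nmD (g - ti T (A *m w' *m A)) (g - ti T w'); rewrite -e3 e2 [nm (g - ti T w')]nmBC.
by lra.
Qed.

Lemma homogeneous_approx s a b : btop a = s -> btop b = s ->
  exists y : seqT', (forall m, Sg _ *m y m *m Sg _ = (bsgn a * bsgn b) *: y m /\
    y m = Fs C _ s *m y m *m Fs C _ s) /\ tends y (rho (E a b)).
Proof.
move=> ta tb; case: (eqVneq (bsgn a : C) (bsgn b)) => [e|ne].
  have ab : blk a = blk b by apply/eqP; rewrite (@blk_eq C) e eqxx ta tb eqxx.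
  have [y [yD yb]] := diag_approx ta ab; exists y; split=> // m.
  have [[_ yS] yF] := yD m; split=> //.
  by rewrite yS Sg_sqrl e bsgn_sqr scale1r.
have [y [yD yb]] := odd_approx ta tb ne; exists y; split=> // m.
have [yS yF] := yD m; split=> //; rewrite yS -scaleN1r; congr (_ *: _).
move: ne; rewrite /bsgn; case: (odd _); case: (odd _); rewrite ?eqxx // => _.
  by rewrite expr0 expr1 mulr1.
by rewrite expr0 expr1 mul1r.
Qed.

End HomogeneousApproximants.

(** * Homomorphisms from orthogonal frames *)

Section FrameHom.
Variables (C : numClosedFieldType) (n n' : sizes).
Local Notation r := (\sum_(i < 4) n i)%N.
Variables (u : 'I_r -> blockmx C n') (p : blockmx C n').
Hypothesis uu : forall a b, (u a)^t* *m u b = if a == b then p else 0.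
Hypothesis up : forall a, u a *m p = u a.

(** The [u a] are partial isometries with common initial projection [p] and orthogonal ranges, that
    is, one column of a system of matrix units; the column determines the whole system. *)
Definition frame_hom (x : blockmx C n) : blockmx C n' :=
  \sum_a \sum_b x a b *: (u a *m (u b)^t*).

Lemma frame_delta a b : frame_hom (delta_mx a b) = u a *m (u b)^t*.
Proof.
rewrite /frame_hom (bigD1 a) //= [X in _ + X]big1 ?addr0 => [|i /negPf ia]; last first.
  by apply big1 => j _; rewrite mxE ia scale0r.
rewrite (bigD1 b) //= [X in _ + X]big1 ?addr0 => [|j /negPf jb]; last first.
  by rewrite mxE jb andbF scale0r.
by rewrite mxE !eqxx scale1r.
Qed.

Lemma frame_u x b : frame_hom x *m u b = \sum_a x a b *: u a.
Proof.
rewrite /frame_hom mulmx_suml; apply: eq_bigr => a _.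
rewrite mulmx_suml (bigD1 b) //= [X in _ + X]big1 ?addr0 => [|j /negPf jb]; last first.
  by rewrite -scalemxAl -mulmxA uu jb mulmx0 scaler0.
by rewrite -scalemxAl -mulmxA uu eqxx up.
Qed.

Lemma frame_star_hom : star_hom frame_hom.
Proof.
apply: star_homP => [k x y|x y|x].
- rewrite /frame_hom scaler_sumr -big_split; apply: eq_bigr => a _ /=.
  rewrite scaler_sumr -big_split; apply: eq_bigr => b _ /=.
  by rewrite !mxE scalerDl scalerA.
- rewrite /amul /= [X in _ = _ *m X]/frame_hom mulmx_sumr.
  transitivity (\sum_a \sum_b \sum_k (x a k * y k b) *: (u a *m (u b)^t*)).
    rewrite /frame_hom; apply: eq_bigr => a _; apply: eq_bigr => b _.
    by rewrite mxE scaler_suml.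
  transitivity (\sum_k \sum_b y k b *: (\sum_a x a k *: (u a *m (u b)^t*))); last first.
    apply: eq_bigr => k _; rewrite mulmx_sumr; apply: eq_bigr => b _.
    rewrite -scalemxAr mulmxA frame_u mulmx_suml; congr (_ *: _).
    by apply: eq_bigr => a _; rewrite -scalemxAl.
  rewrite (eq_bigr (fun a => \sum_k \sum_b (x a k * y k b) *: (u a *m (u b)^t*))); last first.
    by move=> a _; rewrite exchange_big.
  rewrite exchange_big; apply: eq_bigr => k _ /=.
  rewrite exchange_big; apply: eq_bigr => b _ /=.
  by rewrite scaler_sumr; apply: eq_bigr => a _; rewrite scalerA mulrC.
- rewrite /adj /= /frame_hom adjmx_sum exchange_big; apply: eq_bigr => b _ /=.
  rewrite adjmx_sum; apply: eq_bigr => a _.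
  by rewrite adjmxZ adjmxM trmxCK adjmxE.
Qed.

Hypothesis uF : forall a, Fg n' *m u a = (btop a)%:R *: u a.
Hypothesis uS : forall a b, btop a = btop b ->
  Sg n' *m (u a *m (u b)^t*) *m Sg n' = (bsgn a * bsgn b) *: (u a *m (u b)^t*).

Lemma frame_good : good frame_hom.
Proof.
split; first exact: frame_star_hom.
- rewrite /frame_hom mulmx_sumr; apply: eq_bigr => a _.
  rewrite mulmx_sumr; apply: eq_bigr => b _.
  rewrite -scalemxAr mulmxA uF -scalemxAl scalerA; congr (_ *: _).
  by rewrite !mxE; case: eqP => [->|]; rewrite ?mulr1n ?mul1r ?mulr0n ?mul0r.
- move=> x xF; rewrite /frame_hom mulmx_sumr mulmx_suml; apply: eq_bigr => a _.
  rewrite mulmx_sumr mulmx_suml; apply: eq_bigr => b _.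
  rewrite SgrE SgE -scalemxAr -scalemxAl.
  have [ab|ab] := eqVneq (btop a) (btop b).
    by rewrite uS // scalerA mulrA -mulrA mulrC -!mulrA [bsgn b * _]mulrC !mulrA.
  move/matrixP: xF => /(_ a b); rewrite FgE FgrE => e.
  have -> : x a b = 0.
    move: ab e; case: (btop a); case: (btop b) => //= _; rewrite ?mul1r ?mul0r ?mulr0 ?mulr1 //.
  by rewrite !(mulr0, mul0r, scale0r).
Qed.

End FrameHom.

(** * Perturbation to exact projections and partial isometries *)

Section Near.
Variables (R : realType) (r : nat) (N : 'M[R[i]]_r -> R).
Hypothesis hN : cnorm N.

Lemma cn_one_le : N 1%:M <= 1.
Proof. by apply: (cn_proj_le hN); rewrite ?adjmx1 ?mulmx1. Qed.

Lemma cn_nat k x : N (k%:R *: x) = k%:R * N x.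
Proof. by rewrite (cnZ hN) -(rmorph_nat (real_complex R)) cabs_real ger0_norm. Qed.

(** The projection is (1 + sgn k) / 2 for k = 2h - 1, with sgn k = k (k^2)^(-1/2). Since k^2 - 1 = 4
    (h^2 - h), the bound 1/8 is what keeps k^2 within 1/2 of 1, the range of [isqrt_exists]. *)
Lemma proj_near (h : 'M[R[i]]_r) : h^t* = h -> N (h *m h - h) <= 1 / 8%:R ->
  exists p, [/\ p^t* = p, p *m p = p,
    N (p - h) <= (2%:R * N h + 1) * (4%:R * N (h *m h - h)) &
    forall z, z *m h = h *m z -> z *m p = p *m z].
Proof.
move=> hA hh; have [k kE] : exists k, k = 2%:R *: h - 1%:M by eexists.
have kA : k^t* = k by rewrite kE adjmxB adjmxZ hA adjmx1 conjC_nat.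
have kk : k *m k - 1%:M = 4%:R *: (h *m h - h).
  rewrite kE mulmxBr mulmxBl mulmx1 mul1mx -scalemxAl -scalemxAr.
  move: (h *m h) => H; apply/matrixP=> i j; rewrite !mxE; ring.
have kkA : (k *m k)^t* = k *m k by rewrite adjmxM kA.
have nkk : N (k *m k - 1%:M) <= 1 / 2%:R by rewrite kk cn_nat; lra.
have [s [sA _ ssk sN sc]] := isqrt_exists hN kkA (adjmx1 _ _) (mulmx1 _) (mul1mx _) (mulmx1 _) nkk.
have ks : k *m s = s *m k by apply: sc; rewrite ?mulmxA ?mulmx1 ?mul1mx.
have [q qE] : exists q, q = k *m s by eexists.
have qA : q^t* = q by rewrite qE adjmxM sA kA ks.
have qq : q *m q = 1%:M.
  by rewrite qE {1}ks -!mulmxA ks [k *m (s *m k)]mulmxA ks -ssk !mulmxA.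
have h2 : 2%:R != 0 :> R[i] by rewrite pnatr_eq0.
exists (2%:R^-1 *: (1%:M + q)); split.
- by rewrite adjmxZ adjmxD adjmx1 qA fmorphV /= conjC_nat.
- rewrite -scalemxAl -scalemxAr scalerA mulmxDr mulmx1 mulmxDl mul1mx qq.
  by apply/matrixP=> i j; rewrite !mxE; field.
- have -> : 2%:R^-1 *: (1%:M + q) - h = 2%:R^-1 *: (k *m (s - 1%:M)).
    rewrite mulmxBr mulmx1 -qE kE; apply/matrixP=> i j; by rewrite !mxE; field.
  rewrite (cnZ hN).
  have -> : cabs (2%:R^-1 : R[i]) = 2%:R^-1 :> R.
    by rewrite -(rmorph_nat (real_complex R)) -fmorphV cabs_real ger0_norm.
  have := cnM hN k (s - 1%:M); have k1 : N k <= 2%:R * N h + 1.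
    by rewrite kE; apply: le_trans (cnB hN _ _) _; rewrite cn_nat lerD2l cn_one_le.
  move: sN; rewrite kk cn_nat; have := cn_ge0 hN k; have := cn_ge0 hN (s - 1%:M).
  have := cn_ge0 hN (h *m h - h); have := cn_ge0 hN h.
  move: (N k) (N (s - 1%:M)) (N (h *m h - h)) (N h) k1 => a b c d k1 d0 c0 b0 a0 bc abk.
  rewrite mulrC ler_pdivrMr //; nra.
- move=> z zh; have zk : z *m k = k *m z.
    by rewrite kE mulmxBr mulmxBl mulmx1 mul1mx -scalemxAl -scalemxAr zh.
  have zs : z *m s = s *m z.
    by apply: sc; rewrite ?mulmx1 ?mul1mx // mulmxA zk -!mulmxA zk.
  rewrite -scalemxAl -scalemxAr mulmxDr mulmxDl mulmx1 mul1mx; congr (_ *: (_ + _)).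
  by rewrite qE mulmxA zk -!mulmxA zs.
Qed.

(** Polar decomposition within the corner: [s] is the inverse square root of y^* y. *)
Lemma pisom_near (y p : 'M[R[i]]_r) : p^t* = p -> p *m p = p -> y *m p = y ->
  N (y^t* *m y - p) <= 1 / 2%:R ->
  exists s, [/\ (y *m s)^t* *m (y *m s) = p, y *m s *m p = y *m s,
    N (y *m s - y) <= N y * (2%:R * N (y^t* *m y - p)) &
    forall z, z *m (y^t* *m y) = (y^t* *m y) *m z -> z *m p = p *m z -> z *m s = s *m z].
Proof.
move=> pA pp yp hN2; have hA : (y^t* *m y)^t* = y^t* *m y by rewrite adjmxM trmxCK.
have py : p *m y^t* = y^t* by rewrite -{2}yp adjmxM pA.
have [||s [sA [ps sp] ssh sN sc]] := isqrt_exists hN hA pA pp _ _ hN2.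
- by rewrite mulmxA py.
- by rewrite -mulmxA yp.
exists s; split => //.
- have Hs : y^t* *m y *m s = s *m (y^t* *m y).
    by apply: sc; rewrite // -mulmxA yp mulmxA py.
  by rewrite adjmxM sA -mulmxA [y^t* *m _]mulmxA Hs mulmxA.
- by rewrite -mulmxA sp.
- have -> : y *m s - y = y *m (s - p) by rewrite mulmxBr yp.
  apply: le_trans (cnM hN _ _) _; apply: ler_wpM2l => //; exact: (cn_ge0 hN).
Qed.

End Near.

Definition near_infty (P : nat -> Prop) : Prop := exists K, forall m, (K <= m)%N -> P m.

Lemma near_and (P Q : nat -> Prop) :
  near_infty P -> near_infty Q -> near_infty (fun m => P m /\ Q m).
Proof.
move=> [K hK] [K' hK']; exists (maxn K K') => m.
by rewrite geq_max => /andP[/hK ? /hK' ?].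
Qed.

Lemma near_imp (P Q : nat -> Prop) :
  (forall m, P m -> Q m) -> near_infty P -> near_infty Q.
Proof. by move=> h [K hK]; exists K => m /hK /h. Qed.

Section ExactSequences.
Variable R : realType.
Local Notation C := (R[i]).
Variables (B : cstarAlgType C) (T : tower B).
Local Notation M k := (blockmx C (ts T k)).
Local Notation seqT := (forall m, M m).
Local Notation tn x := (nm (ti T x)).
Implicit Types y z p : seqT.

Lemma tends_dom_mul (L : R) y z : 0 <= L ->
  near_infty (fun m => tn (z m) <= L * tn (y m)) -> tends y 0 -> tends z 0.
Proof.
move=> L0 h y0; have := tendsZ (L%:C%C) y0; rewrite scaler0; apply: tends_dom.
apply: near_imp h => m; rewrite (shomZ (@ti_hom _ _ T m)) nmZ cabs_real.
by rewrite ger0_norm.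
Qed.

Lemma tends_sub y z b : tends y b -> tends (fun m => z m - y m) 0 -> tends z b.
Proof.
move=> h /tendsD/(_ h); rewrite add0r; apply: tends_ev.
by exists 0%N => m _; rewrite subrK.
Qed.

Lemma tends0_lt y e : 0 < e -> tends y 0 -> near_infty (fun m => tn (y m) < e).
Proof. by move=> e0 /(_ e e0); apply: near_imp => m; rewrite subr0. Qed.

Lemma tends_proj (h : seqT) b : (forall m, (h m)^t* = h m) -> amul b b = b -> tends h b ->
  exists p, (forall m, [/\ (p m)^t* = p m, p m *m p m = p m &
    forall z : M m, z *m h m = h m *m z -> z *m p m = p m *m z]) /\ tends p b.
Proof.
move=> hA bb hb.
have /dep_choice[p hp] m : exists p : M m, [/\ p^t* = p, p *m p = p,
    forall z : M m, z *m h m = h m *m z -> z *m p = p *m z &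
    tn (h m *m h m - h m) <= 1 / 8%:R ->
    tn (p - h m) <= (2%:R * tn (h m) + 1) * (4%:R * tn (h m *m h m - h m))].
  have [small|big] := lerP (tn (h m *m h m - h m)) (1 / 8%:R).
    have [p [pA pp pN pC]] := proj_near (ti_cnorm T m) (hA m) small.
    by exists p.
  (* Stages where [h m] is not yet nearly idempotent receive 0; there are finitely many of them. *)
  exists 0; split; [by rewrite adjmx0|by rewrite mulmx0|by move=> z _; rewrite mulmx0 mul0mx|].
  by [].
exists p; split; first by move=> m; case: (hp m).
have h0 : tends (fun m => h m *m h m - h m) 0.
  by rewrite -(subrr b) -{1}bb; apply: tendsB => //; exact: tendsM.
apply: (tends_sub hb).
have n0 := nm_ge0 b.
apply: (@tends_dom_mul ((2%:R * (nm b + 1) + 1) * 4%:R) _ _ _ _ h0); first lra.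
have e8 : 0 < 1 / 8%:R :> R by lra.
apply: near_imp (near_and (tends_bound hb) (tends0_lt e8 h0)) => m [hm /ltW small].
have [_ _ _ /(_ small)] := hp m; have := nm_ge0 (ti T (h m *m h m - h m)).
have := nm_ge0 (ti T (h m)).
move: (nm (ti T (h m *m h m - h m))) (nm (ti T (h m))) (nm (ti T (p m - h m))) hm n0 => u v w.
by nra.
Qed.

Lemma tends_pisom y p b e :
  near_infty (fun m => [/\ (p m)^t* = p m, p m *m p m = p m & y m *m p m = y m]) ->
  tends y b -> tends p e -> amul (adj b) b = e ->
  exists s : seqT, near_infty (fun m =>
    [/\ (y m *m s m)^t* *m (y m *m s m) = p m, y m *m s m *m p m = y m *m s m &
    forall z : M m, z *m ((y m)^t* *m y m) = ((y m)^t* *m y m) *m z -> z *m p m = p m *m z ->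
      z *m s m = s m *m z]) /\ tends (fun m => y m *m s m) b.
Proof.
move=> hp yb pe be.
have /dep_choice[s hs] m : exists s : M m,
    [/\ (p m)^t* = p m, p m *m p m = p m & y m *m p m = y m] ->
    tn ((y m)^t* *m y m - p m) <= 1 / 2%:R ->
    [/\ (y m *m s)^t* *m (y m *m s) = p m, y m *m s *m p m = y m *m s,
    tn (y m *m s - y m) <= tn (y m) * (2%:R * tn ((y m)^t* *m y m - p m)) &
    forall z : M m, z *m ((y m)^t* *m y m) = ((y m)^t* *m y m) *m z -> z *m p m = p m *m z ->
      z *m s = s *m z].
  have [[[pA pp yp] small]|no] := pselect ([/\ (p m)^t* = p m, p m *m p m = p m & y m *m p m = y m] /\
     tn ((y m)^t* *m y m - p m) <= 1 / 2%:R).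
    by have [s hs] := pisom_near (ti_cnorm T m) pA pp yp small; exists s.
  by exists 0 => h1 h2; case: no.
exists s.
have h0 : tends (fun m => (y m)^t* *m y m - p m) 0.
  by rewrite -(subrr e) -{1}be; apply: tendsB => //; apply: tendsM => //; exact: tendsA.
have e2 : 0 < 1 / 2%:R :> R by lra.
have ev := near_and hp (tends0_lt e2 h0).
split; first by apply: near_imp ev => m [h1 /ltW h2]; case: (hs m h1 h2).
apply: (tends_sub yb); have n0 := nm_ge0 b.
apply: (@tends_dom_mul ((nm b + 1) * 2%:R) _ _ _ _ h0); first lra.
apply: near_imp (near_and ev (tends_bound yb)) => m [[h1 /ltW h2] h3].
have [_ _ + _] := hs m h1 h2; have := nm_ge0 (ti T ((y m)^t* *m y m - p m)).
have := nm_ge0 (ti T (y m)); nra.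
Qed.

(** A nonzero projection has norm 1. This turns relations between projections that hold in the limit
    into exact ones at late stages. *)
Lemma tends_proj0 p : near_infty (fun m => (p m)^t* = p m /\ p m *m p m = p m) ->
  tends p 0 -> near_infty (fun m => p m = 0).
Proof.
move=> hp p0; apply: near_imp (near_and hp (tends0_lt ltr01 p0)) => m [[pA pp] p1].
exact: (cn_proj1 (ti_cnorm T m)).
Qed.

End ExactSequences.

Section Frames.
Variable C : numClosedFieldType.

(** A partial column of matrix units with initial projection [p], defined for the indices in [L]
    only, so that it can be extended one index at a time. The vector at a has range on side [s] and
    degree [Sx a] for conjugation by the signature. *)
Definition frame_on n (k : nat) (Sx : 'I_k -> C) (s : bool) (L : pred 'I_k)
    (p : blockmx C n) (v : 'I_k -> blockmx C n) : Prop :=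
  [/\ forall a, L a -> [/\ Sg n *m v a = Sx a *: (v a *m Sg n),
        Fs C n s *m v a = v a & v a *m p = v a],
      forall a b, L a -> L b -> (v a)^t* *m v b = (if a == b then p else 0),
      p^t* = p, p *m p = p & Sg n *m p = p *m Sg n /\ Fs C n s *m p = p].

(** A Gram-Schmidt step: y' is y with the ranges of the frame projected away, and [sq] normalises
    it. As y' is homogeneous for the signature, y'^* y' commutes with it; hence [sq] does too, and
    homogeneity is not lost. *)
Lemma frame_step n k (Sx : 'I_k -> C) s (L : seq 'I_k) (p : blockmx C n) v a
    (y sq : blockmx C n) :
  (forall b, Sx b * Sx b = 1) -> (forall b, (Sx b)^* = Sx b) ->
  a \notin L -> frame_on Sx s [in L] p v ->
  Sg n *m y = Sx a *: (y *m Sg n) -> Fs C n s *m y = y ->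
  let y' := (1%:M - \sum_(b <- L) v b *m (v b)^t*) *m y *m p in
  (y' *m sq)^t* *m (y' *m sq) = p -> y' *m sq *m p = y' *m sq ->
  (forall z, z *m (y'^t* *m y') = (y'^t* *m y') *m z -> z *m p = p *m z ->
    z *m sq = sq *m z) ->
  uniq L ->
  frame_on Sx s [in a :: L] p (fun b => if b == a then y' *m sq else v b).
Proof.
move=> S1 SR aL [hv vv pA pp [pS pF]] yS yF y' nn np nc uL.
have y'S : Sg n *m y' = Sx a *: (y' *m Sg n).
  have qS : Sg n *m (\sum_(b <- L) v b *m (v b)^t*) = (\sum_(b <- L) v b *m (v b)^t*) *m Sg n.
    rewrite mulmx_sumr mulmx_suml; apply: eq_big_seq => b bL; have [vS _ _] := hv b bL.
    have vS' : (v b)^t* *m Sg n = Sx b *: (Sg n *m (v b)^t*).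
      have := congr1 (fun z : 'M[C]_(_, _) => z^t*) vS.
      by rewrite adjmxZ !adjmxM Sg_adj SR.
    by rewrite mulmxA vS -scalemxAl -[RHS]mulmxA vS' -scalemxAr mulmxA.
  rewrite /y' !mulmxA [Sg n *m (_ - _)]mulmxBr mulmx1 qS -{1}[Sg n]mul1mx -mulmxBl.
  rewrite -[_ *m Sg n *m y]mulmxA yS -scalemxAr -scalemxAl; congr (_ *: _).
  by rewrite mulmxA -[LHS]mulmxA pS mulmxA.
have y'F : Fs C n s *m y' = y'.
  rewrite /y' !mulmxA [Fs C n s *m (_ - _)]mulmxBr mulmx1; congr (_ *m _).
  rewrite !mulmxBl mul1mx yF; congr (_ - _ *m _).
  rewrite mulmx_sumr; apply: eq_big_seq => b bL.
  by have [_ vF _] := hv b bL; rewrite mulmxA vF.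
have vy b : b \in L -> (v b)^t* *m y' = 0.
  move=> bL; rewrite /y' !mulmxA mulmxBr mulmx1 mulmx_sumr.
  rewrite (bigD1_seq b) //= [X in _ - (_ + X)]big_seq_cond [X in _ - (_ + X)]big1 ?addr0.
    rewrite mulmxA vv // eqxx; have [_ _ vp] := hv b bL.
    have -> : p *m (v b)^t* = (v b)^t* by rewrite -{2}vp adjmxM pA.
    by rewrite subrr !mul0mx.
  by move=> d /andP[dL db]; rewrite mulmxA vv // eq_sym (negPf db) mul0mx.
have y's : forall z, z *m (y'^t* *m y') = (y'^t* *m y') *m z -> z *m p = p *m z ->
    z *m sq = sq *m z by [].
have SH : Sg n *m (y'^t* *m y') = (y'^t* *m y') *m Sg n.
  have y'S' : y'^t* *m Sg n = Sx a *: (Sg n *m y'^t*).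
    have := congr1 (fun z : 'M[C]_(_, _) => z^t*) y'S.
    by rewrite adjmxZ !adjmxM Sg_adj SR.
  have e : y'^t* *m (Sg n *m y') = Sx a *: (y'^t* *m y' *m Sg n).
    by rewrite y'S -scalemxAr mulmxA.
  have e2 : y'^t* *m (Sg n *m y') = Sx a *: (Sg n *m (y'^t* *m y')).
    by rewrite mulmxA y'S' -scalemxAl mulmxA.
  have := congr1 (fun z => Sx a *: z) (etrans (esym e2) e).
  by rewrite !scalerA S1 !scale1r.
have Ssq : Sg n *m sq = sq *m Sg n := nc _ SH pS.
clearbody y'.
split=> //.
- move=> b; rewrite inE; case: (eqVneq b a) => [->|ba] /=; last exact: hv.
  move=> _; split=> //; last by rewrite mulmxA y'F.
  by rewrite mulmxA y'S -scalemxAl -!mulmxA Ssq.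
- move=> b d; rewrite !inE; case: (eqVneq b a) => [->|ba]; case: (eqVneq d a) => [->|da] //=.
  + move=> _ dL; rewrite adjmxM -mulmxA.
    have -> : y'^t* *m v d = 0 by rewrite -[LHS]trmxCK adjmxM trmxCK vy // adjmx0.
    by rewrite mulmx0.
  + by move=> bL _; rewrite (negPf ba) mulmxA vy // mul0mx.
  + exact: vv.
Qed.

End Frames.

Section LinkFrames.
Variables (C : numClosedFieldType) (n n' : sizes).
Local Notation r := (\sum_(i < 4) n i)%N.
Local Notation side s := [pred a : 'I_r | btop a == s].
Local Notation sframe s := (frame_on (fun a : 'I_r => bsgn a : C) s (side s)).

Lemma bsgn_conj (a : 'I_r) : (bsgn a : C)^* = bsgn a.
Proof. by rewrite /bsgn rmorph_sign. Qed.

Lemma sframe_S s (p : blockmx C n') v a b : sframe s p v -> side s a -> side s b ->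
  Sg n' *m (v a *m (v b)^t*) *m Sg n' = (bsgn a * bsgn b) *: (v a *m (v b)^t*).
Proof.
case=> hv _ _ _ _ /hv[aS _ _] /hv[bS _ _].
have bS' : (v b)^t* *m Sg n' = bsgn b *: (Sg n' *m (v b)^t*).
  have := congr1 (fun z : 'M[C]_(_, _) => z^t*) bS.
  by rewrite adjmxZ !adjmxM Sg_adj bsgn_conj.
rewrite !mulmxA aS -!scalemxAl -[_ *m (v b)^t* *m Sg n']mulmxA bS' -scalemxAr scalerA.
by rewrite mulmxA Sg_sqrl.
Qed.

Variables (p q w : blockmx C n') (v z : 'I_r -> blockmx C n').
Hypotheses (hv : sframe true p v) (hz : sframe false q z).
Hypotheses (wq : w^t* *m w = q) (wp : w *m w^t* = p).

(** The bottom frame starts at the corner [q] of e_dd. Composition with the adjoint of [w], which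
    stands for e_dc, moves it to the corner [p] of e_cc, and the two frames become one column. *)
Definition link_vec a := if btop a then v a else z a *m w^t*.

Lemma link_up a : link_vec a *m p = link_vec a.
Proof.
rewrite /link_vec; case: ifP => ta.
  by case: hv => h _ _ _ _; have [] := h a; rewrite ?inE ?ta.
have [h _ _ _ _] := hz; have [_ _ zq] := h a (introT eqP ta).
by rewrite -wp -mulmxA [w^t* *m _]mulmxA wq mulmxA zq.
Qed.

Lemma link_uu a b : (link_vec a)^t* *m link_vec b = if a == b then p else 0.
Proof.
have [hv1 hv2 pA pp _] := hv; have [hz1 hz2 qA qq _] := hz.
rewrite /link_vec; case: ifP => ta; case: ifP => tb.
- by rewrite hv2 //= ?ta ?tb.
- have -> : (a == b) = false by apply/eqP => e; move: ta tb; rewrite e => ->.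
  have [_ va _] := hv1 a (introT eqP ta); have [_ zb _] := hz1 b (introT eqP tb).
  rewrite -va -zb adjmxM Fs_adj -!mulmxA [Fs C n' true *m (_ *m _)]mulmxA.
  by rewrite (Fs_ortho C n' true) mul0mx mulmx0.
- have -> : (a == b) = false by apply/eqP => e; move: ta tb; rewrite e => ->.
  have [_ vb _] := hv1 b (introT eqP tb); have [_ za _] := hz1 a (introT eqP ta).
  rewrite -vb -za !adjmxM Fs_adj -!mulmxA [Fs C n' false *m (_ *m _)]mulmxA.
  by rewrite (Fs_ortho C n' false) mul0mx !mulmx0.
- rewrite adjmxM trmxCK -mulmxA [(z a)^t* *m _]mulmxA hz2 ?inE ?ta ?tb //.
  case: eqP => _; last by rewrite mul0mx mulmx0.
  by rewrite -wq -mulmxA wp mulmxA wp pp.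
Qed.

Lemma link_good : good (frame_hom link_vec).
Proof.
have [hv1 hv2 pA pp _] := hv; have [hz1 hz2 qA qq _] := hz.
apply: (frame_good link_uu link_up).
- move=> a; rewrite /link_vec; case: ifP => ta.
    by have [_ va _] := hv1 a (introT eqP ta); rewrite -[Fg n']/(Fs C n' true) va scale1r.
  have [_ za _] := hz1 a (introT eqP ta).
  rewrite -[Fg n']/(Fs C n' true) -za !mulmxA (Fs_ortho C n' true) !mul0mx.
  by rewrite scale0r.
- move=> a b ab; rewrite /link_vec -ab; case: ifP => ta.
    by apply: (sframe_S hv); rewrite /= -?ab ta.
  have -> : z a *m w^t* *m (z b *m w^t*)^t* = z a *m (z b)^t*.
    rewrite adjmxM trmxCK mulmxA -[z a *m _ *m w]mulmxA wq.
    by have [_ _ ->] := hz1 a (introT eqP ta).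
  by apply: (sframe_S hz); rewrite /= -?ab ta.
Qed.

End LinkFrames.

Section GoodApprox.
Variable R : realType.
Local Notation C := (R[i]).
Variables (B B' : cstarAlgType C) (T : tower B) (T' : tower B').
Variables (F : B -> B') (G : B' -> B).
Hypothesis FG : tower_iso T T' F G.
Variable k : nat.
Local Notation M k := (blockmx C (ts T k)).
Local Notation M' k := (blockmx C (ts T' k)).
Local Notation seqT' := (forall m, M' m).
Local Notation rho x := (F (ti T x)).
Local Notation r := (\sum_(i < 4) ts T k i)%N.
Local Notation E a b := (delta_mx a b : M k).
Local Notation side s := [pred a : 'I_r | btop a == s].
Let hr := rho_hom FG k.

Lemma rhoM (a b d : 'I_r) : amul (rho (E a b)) (rho (E b d)) = rho (E a d).
Proof. by rewrite -(shomM hr) /amul /= mul_delta_mx. Qed.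

Lemma rhoM0 (a b b' d : 'I_r) : b != b' -> amul (rho (E a b)) (rho (E b' d)) = 0.
Proof. by move=> /negPf h; rewrite -(shomM hr) /amul /= mul_delta_mx_cond h mulr0n (shom0 hr). Qed.

Lemma rhoA (a b : 'I_r) : adj (rho (E a b)) = rho (E b a).
Proof. by rewrite -(shomA hr) /adj /= adjmx_delta. Qed.

Lemma tends_sum_seq (I : eqType) (s : seq I) (y : I -> seqT') (b : I -> B') :
  (forall i, i \in s -> tends (y i) (b i)) ->
  tends (fun m => \sum_(i <- s) y i m) (\sum_(i <- s) b i).
Proof.
elim: s => [|i s IH] h.
  by rewrite big_nil; apply: (tends_ev _ (tends0 T')); exists 0%N => m _; rewrite big_nil.
rewrite big_cons; have h1 := h i (mem_head _ _).
have h2 : tends (fun m => \sum_(i <- s) y i m) (\sum_(i <- s) b i).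
  by apply: IH => j js; apply: h; rewrite inE js orbT.
apply: (tends_ev _ (tendsD h1 h2)); exists 0%N => m _.
by rewrite big_cons.
Qed.

Lemma corner_proj s (c : 'I_r) : btop c = s ->
  exists p : seqT', (forall m, [/\ (p m)^t* = p m, p m *m p m = p m,
     Sg _ *m p m = p m *m Sg _ & Fs C _ s *m p m = p m]) /\ tends p (rho (E c c)).
Proof.
move=> ts; have [h [hD hc]] := diag_approx FG ts (erefl (blk c)).
pose h1 m := 2%:R^-1 *: (h m + (h m)^t*).
have hA m : (h1 m)^t* = h1 m.
  by rewrite adjmxZ adjmxD trmxCK fmorphV /= conjC_nat addrC.
have h1c : tends h1 (rho (E c c)).
  have -> : rho (E c c) = 2%:R^-1 *: (rho (E c c) + adj (rho (E c c))).
    have h2 : 2%:R != 0 :> C by rewrite pnatr_eq0.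
    by rewrite rhoA -mulr2n -[rho _ *+ 2]scaler_nat scalerA mulVf ?scale1r.
  by apply: tendsZ; apply: tendsD => //; exact: tendsA.
have hF m : Fs C _ s *m h m = h m /\ h m *m Fs C _ s = h m.
  have [_ e] := hD m; split; first by rewrite e !mulmxA Fs_idem.
  by rewrite e -[LHS]mulmxA Fs_idem.
have h1F m : Fs C _ s *m h1 m = h1 m /\ h1 m *m Fs C _ s = h1 m.
  have [e1 e2] := hF m.
  have e3 : Fs C _ s *m (h m)^t* = (h m)^t* by rewrite -{2}e2 adjmxM Fs_adj.
  have e4 : (h m)^t* *m Fs C _ s = (h m)^t* by rewrite -{2}e1 adjmxM Fs_adj.
  by rewrite /h1 -scalemxAl -scalemxAr mulmxDl mulmxDr e1 e2 e3 e4.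
have h1S m : Sg _ *m h1 m = h1 m *m Sg _.
  have [hd _] := hD m; have [_ e] := hd; have [_ e'] := diagalgA hd.
  by rewrite /h1 -scalemxAl -scalemxAr mulmxDl mulmxDr e e'.
have [p [hp pc]] := tends_proj hA (rhoM c c c) h1c.
have pF m : Fs C _ s *m p m = p m *m Fs C _ s.
  by have [_ _ pC] := hp m; apply: pC; have [-> ->] := h1F m.
exists (fun m => p m *m Fs C _ s); split.
  move=> m; have [pA pp pC] := hp m; split.
  - by rewrite adjmxM Fs_adj pA pF.
  - by rewrite -[LHS]mulmxA [Fs C _ s *m (_ *m _)]mulmxA pF -[_ *m Fs C _ s *m _]mulmxA Fs_idem mulmxA pp.
  - by rewrite mulmxA (pC _ (h1S m)) -[LHS]mulmxA Fs_S mulmxA.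
  - by rewrite mulmxA pF -[LHS]mulmxA Fs_idem.
have h0 : tends (fun m => p m - h1 m) 0 by rewrite -(subrr (rho (E c c))); exact: tendsB.
apply: (tends_sub h1c); apply: (tends_dom _ h0); exists 0%N => m _.
have [_ {1}<-] := h1F m; rewrite -mulmxBl.
apply: le_trans (tnM _ _) _; rewrite -[X in _ <= X]mulr1.
by apply: ler_pM; rewrite ?nm_ge0 // tn_Fs.
Qed.

Lemma side_frame s (c : 'I_r) : btop c = s -> bsgn c = 1 :> C ->
  exists (p : seqT') (v : 'I_r -> seqT'),
    [/\ near_infty (fun m => frame_on (fun a : 'I_r => bsgn a : C) s (side s) (p m) (fun a => v a m)),
      tends p (rho (E c c)) & forall a, btop a = s -> tends (v a) (rho (E a c))].
Proof.
move=> tsc sc; have [p [hp pc]] := corner_proj tsc; exists p.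
have step (L : seq 'I_r) : uniq L -> all (side s) L -> exists v : 'I_r -> seqT',
    near_infty (fun m => frame_on (fun a : 'I_r => bsgn a : C) s [in L] (p m) (fun a => v a m)) /\
    forall a, a \in L -> tends (v a) (rho (E a c)).
  elim: L => [|a L IH] /=.
    move=> _ _; exists (fun _ => p); split=> //; exists 0%N => m _.
    by have [pA pp pS pF] := hp m; split.
  move=> /andP[aL uL] /andP[/eqP ta sL]; have [v [hv va]] := IH uL sL.
  have [y [hy ya]] := homogeneous_approx FG ta tsc.
  pose y' m : M' m := (1%:M - \sum_(b <- L) v b m *m (v b m)^t*) *m y m *m p m.
  have y'a : tends y' (rho (E a c)).
    pose X m : M' m := \sum_(b <- L) v b m *m (v b m)^t*.
    have Xa : tends (fun m => X m *m y m *m p m)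
        (amul (amul (\sum_(b <- L) amul (rho (E b c)) (adj (rho (E b c)))) (rho (E a c))) (rho (E c c))).
      apply: tendsM pc; apply: (tendsM _ ya); rewrite /X.
      apply: (@tends_sum_seq _ L (fun b m => v b m *m (v b m)^t*)) => b bL.
      by apply: tendsM (va b bL) (tendsA (va b bL)).
    have X0 : amul (\sum_(b <- L) amul (rho (E b c)) (adj (rho (E b c)))) (rho (E a c)) = 0.
      rewrite (big_morph (fun x => amul x (rho (E a c))) (fun x y => amulDl x y _) (amul0l _)).
      rewrite big_seq_cond big1 // => b; rewrite andbT => bL.
      rewrite rhoA rhoM rhoM0 //; apply: contra aL => /eqP <-; exact: bL.
    rewrite X0 amul0l in Xa.
    have yp : tends (fun m => y m *m p m) (rho (E a c)).
      by rewrite -(rhoM a c c); exact: tendsM.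
    rewrite -[rho _]subr0; apply: (tends_ev _ (tendsB yp Xa)); exists 0%N => m _.
    by rewrite /y' !mulmxBl mul1mx.
  have [||sq [hs sa]] := @tends_pisom _ _ T' y' p (rho (E a c)) (rho (E c c)) _ y'a pc.
  - exists 0%N => m _; have [pA pp _ _] := hp m; split=> //.
    by rewrite /y' -[LHS]mulmxA pp.
  - by rewrite rhoA rhoM.
  exists (fun b m => if b == a then y' m *m sq m else v b m); split; last first.
    move=> b; rewrite inE; case: (eqVneq b a) => [->|ba] /=; first by move=> _; exact: sa.
    exact: va.
  apply: near_imp (near_and hv hs) => m [hvm [nn np nc]].
  have [yS yF] := hy m.
  apply: (@frame_step _ _ _ _ _ _ _ (fun b => v b m) a (y m) (sq m)) => //.
  - by move=> b; exact: bsgn_sqr.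
  - by move=> b; exact: bsgn_conj.
  - by rewrite -[LHS]Sg_sqrl yS sc mulr1 scalemxAl.
  - by rewrite yF !mulmxA Fs_idem.
have [v [hv va]] := step (enum (side s)) (enum_uniq _) ltac:(by apply/allP => a; rewrite mem_enum).
exists v; split=> //; last by move=> a ta; apply: va; rewrite mem_enum inE ta.
apply: near_imp hv => m [h1 h2 pA pp pS]; split=> //.
- by move=> a ha; apply: h1; rewrite /= mem_enum.
- by move=> a b ha hb; apply: h2; rewrite /= mem_enum.
Qed.

Lemma good_approx : exists Phi : forall m, M k -> M' m,
  near_infty (fun m => good (Phi m)) /\
  forall a b, tends (fun m => Phi m (E a b)) (rho (E a b)).
Proof.
have [tct ntd sc sd] := tcd T k; set c := tc T k in tct sc; set d := td T k in ntd sd.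
have [p [v [hv pc va]]] := side_frame tct sc.
have [q [z [hz qd za]]] := side_frame (negbTE ntd) sd.
have [x [xF xa]] := rad_approx FG (delta_rad tct ntd).
pose x' m : M' m := p m *m x m *m q m.
have x'a : tends x' (rho (E c d)).
  have -> : rho (E c d) = amul (amul (rho (E c c)) (rho (E c d))) (rho (E d d)).
    by rewrite !rhoM.
  by apply: tendsM qd; exact: tendsM.
have [||sq [hs wa]] := @tends_pisom _ _ T' x' q (rho (E c d)) (rho (E d d)) _ x'a qd.
- apply: near_imp hz => m [_ _ qA qq _]; split=> //.
  by rewrite /x' -[LHS]mulmxA qq.
- by rewrite rhoA rhoM.
pose w m : M' m := x' m *m sq m.
have pw m : p m *m p m = p m -> p m *m w m = w m by move=> pp; rewrite /w /x' !mulmxA pp.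
(* [tends_pisom] fixes only the initial projection of [w]. Its range projection lies under [p] and
   has the same limit, so the difference is a projection tending to 0 and vanishes at late
   stages. *)
have hE : near_infty (fun m => p m - w m *m (w m)^t* = 0).
  apply: tends_proj0; last first.
    rewrite -(subrr (rho (E c c))); apply: tendsB => //.
    by rewrite -(rhoM c d c) -(rhoA c d); apply: tendsM => //; exact: tendsA.
  apply: near_imp (near_and hv hs) => m [[_ _ pA pp _] [ww wq _]].
  have wA : (w m *m (w m)^t*)^t* = w m *m (w m)^t* by rewrite adjmxM trmxCK.
  have pww : p m *m (w m *m (w m)^t*) = w m *m (w m)^t* by rewrite mulmxA pw.
  have wwp : w m *m (w m)^t* *m p m = w m *m (w m)^t*.
    by rewrite -[LHS]trmxCK adjmxM pA wA pww wA.
  have w4 : w m *m (w m)^t* *m (w m *m (w m)^t*) = w m *m (w m)^t*.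
    by rewrite -[LHS]mulmxA [(w m)^t* *m (_ *m _)]mulmxA ww mulmxA wq.
  split; first by rewrite adjmxB pA wA.
  by rewrite mulmxBr !mulmxBl pp pww wwp w4 subrr subr0.
exists (fun m => frame_hom (link_vec (w m) (fun a => v a m) (fun a => z a m))); split.
  apply: near_imp (near_and (near_and hv hz) (near_and hs hE)) => m [[hvm hzm] [[ww _ _] e]].
  by apply: (link_good hvm hzm ww); apply/eqP; rewrite eq_sym -subr_eq0; apply/eqP.
have ua a : tends (fun m => link_vec (w m) (fun a => v a m) (fun a => z a m) a) (rho (E a c)).
  rewrite /link_vec; case ta: (btop a); first exact: va.
  rewrite -(rhoM a d c) -(rhoA c d); by apply: (tendsM (za _ ta)); exact: tendsA.
move=> a b; rewrite -(rhoM a c b) -(rhoA b c).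
apply: (tends_ev _ (tendsM (ua a) (tendsA (ua b)))); exists 0%N => m _.
by rewrite frame_delta.
Qed.

End GoodApprox.

(** * Making the symmetries commute *)

Section CommutingRotation.
Variables (R : realType) (r : nat) (N : 'M[R[i]]_r -> R).
Hypothesis hN : cnorm N.
Local Notation half := (2%:R^-1 : R[i]).

Lemma cn_half x : N (half *: x) = N x / 2%:R.
Proof.
rewrite (cnZ hN) mulrC; congr (_ * _).
by rewrite -(rmorph_nat (real_complex R)) -fmorphV cabs_real ger0_norm.
Qed.

Lemma cnM_le x y u v : N x <= u -> N y <= v -> N (x *m y) <= u * v.
Proof.
move=> xu yv; apply: le_trans (cnM hN _ _) _; apply: ler_pM => //; exact: (cn_ge0 hN).
Qed.

(** The unitary w = ab of the corner is conjugated to its adjoint by both a and b, so its real part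
    k commutes with both. If w^2 is close to p, then w is close to k and to the symmetry sgn k.
    Hence b = a w is close to the symmetry a sgn k, which commutes with a; [g] is a rotation
    carrying b to it. *)
Lemma commuting_rotation (a b p : 'M[R[i]]_r) (dl : R) :
  p^t* = p -> p *m p = p -> a^t* = a -> b^t* = b -> a *m a = p -> b *m b = p ->
  p *m a = a -> a *m p = a -> p *m b = b -> b *m p = b ->
  N (a *m b *m (a *m b) - p) <= dl -> dl <= 1 / 8%:R ->
  exists g, [/\ g *m g^t* = p, g^t* *m g = p, p *m g = g /\ g *m p = g,
    N (g - p) <= 5%:R * dl & a *m (g *m b *m g^t*) = g *m b *m g^t* *m a].
Proof.
move=> pA pp aA bA aa bb pa ap pb bp; move def_w : (a *m b) => w wN dl8.
have wA : w^t* = b *m a by rewrite -def_w adjmxM aA bA.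
have ww1 : w *m w^t* = p by rewrite wA -def_w -mulmxA [b *m (b *m a)]mulmxA bb pa aa.
have ww2 : w^t* *m w = p by rewrite wA -def_w -mulmxA [a *m (a *m b)]mulmxA aa pb bb.
have pw : p *m w = w by rewrite -def_w mulmxA pa.
have wp : w *m p = w by rewrite -def_w -mulmxA bp.
have pw' : p *m w^t* = w^t* by rewrite wA mulmxA pb.
have w'p : w^t* *m p = w^t* by rewrite wA -mulmxA ap.
have aw : a *m w = w^t* *m a by rewrite wA -def_w mulmxA aa pb -mulmxA aa bp.
have aw' : a *m w^t* = w *m a by rewrite wA -def_w mulmxA.
have bw : b *m w = w^t* *m b by rewrite wA -def_w mulmxA.
have bw' : b *m w^t* = w *m b by rewrite wA -def_w mulmxA bb pa -mulmxA bb ap.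
have dl0 : 0 <= dl by apply: le_trans wN; exact: (cn_ge0 hN).
have Nw : N w <= 1 by exact: (cn_pisom hN pA pp ww2).
have Np : N p <= 1 by exact: (cn_proj_le hN).
have [k kE] : exists k, k = half *: (w + w^t*) by eexists.
have kA : k^t* = k by rewrite kE adjmxZ adjmxD trmxCK fmorphV /= conjC_nat addrC.
have ak : a *m k = k *m a by rewrite kE -scalemxAr -scalemxAl mulmxDr mulmxDl aw aw' addrC.
have bk : b *m k = k *m b by rewrite kE -scalemxAr -scalemxAl mulmxDr mulmxDl bw bw' addrC.
have pk : p *m k = k by rewrite kE -scalemxAr mulmxDr pw pw'.
have kp : k *m p = k by rewrite kE -scalemxAl mulmxDl wp w'p.
have kkE : k *m k - p = half *: (half *: ((w *m w - p) + (w *m w - p)^t*)).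
  rewrite kE -scalemxAr -scalemxAl mulmxDr !mulmxDl ww1 ww2 adjmxB pA adjmxM.
  by move: (w *m w) (w^t* *m w^t*) => x y; apply/matrixP=> i j; rewrite !mxE; field.
have Nkk : N (k *m k - p) <= dl / 2%:R.
  rewrite kkE !cn_half; have := cnD hN (w *m w - p) ((w *m w - p)^t*).
  by rewrite (cnA hN); lra.
have kkA : (k *m k)^t* = k *m k by rewrite adjmxM kA.
have pkk : p *m (k *m k) = k *m k by rewrite mulmxA pk.
have kkp : k *m k *m p = k *m k by rewrite -mulmxA kp.
have [|s [sA [ps sp] ssk Ns sC]] := isqrt_exists hN kkA pA pp pkk kkp; first lra.
have {}Ns : N (s - p) <= dl by lra.
have Cs z : z *m k = k *m z -> z *m p = p *m z -> z *m s = s *m z.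
  by move=> zk; apply: sC; rewrite mulmxA zk -!mulmxA zk.
have as_ : a *m s = s *m a by apply: Cs; rewrite // ap pa.
have bs : b *m s = s *m b by apply: Cs; rewrite // bp pb.
have ks : k *m s = s *m k by apply: Cs; rewrite // kp pk.
(* [ka] is the sign of [k]. *)
have [ka kaE] : exists x, x = k *m s by eexists.
have kaA : ka^t* = ka by rewrite kaE adjmxM kA sA ks.
have kaka : ka *m ka = p by rewrite kaE {1}ks -mulmxA ks [k *m (s *m k)]mulmxA ks -ssk !mulmxA.
have aka : a *m ka = ka *m a by rewrite kaE mulmxA ak -!mulmxA as_.
have bka : b *m ka = ka *m b by rewrite kaE mulmxA bk -!mulmxA bs.
have pka : p *m ka = ka by rewrite kaE mulmxA pk.
have kap : ka *m p = ka by rewrite kaE -mulmxA sp.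
have kka : k *m ka = ka *m k by rewrite kaE mulmxA -!mulmxA ks.
have [h hE] : exists x, x = half *: (p + ka *m k) by eexists.
have hA : h^t* = h by rewrite hE adjmxZ adjmxD adjmxM kA kaA pA kka fmorphV /= conjC_nat.
have ph : p *m h = h by rewrite hE -scalemxAr mulmxDr pp mulmxA pka.
have hp : h *m p = h by rewrite hE -scalemxAl mulmxDl pp -mulmxA kp.
have hpE : h - p = half *: ((k *m k - p) *m s + (s - p)).
  rewrite hE mulmxBl ps addrA subrK -kka kaE mulmxA.
  by move: (k *m k *m s) => x; apply/matrixP=> i j; rewrite !mxE; field.
have Nps : N s <= 1 + dl.
  have := cnD hN (s - p) p; rewrite subrK; lra.
have Nh : N (h - p) <= dl.
  rewrite hpE cn_half; have := cnD hN ((k *m k - p) *m s) (s - p).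
  have := cnM_le Nkk Nps; nra.
have [|t [tA [pt tp] tth Nt tC]] := isqrt_exists hN hA pA pp ph hp; first lra.
have {}Nt : N (t - p) <= 2%:R * dl by lra.
have ah : a *m h = h *m a.
  by rewrite hE -scalemxAr -scalemxAl mulmxDr mulmxDl ap pa mulmxA aka -!mulmxA ak.
have bh : b *m h = h *m b.
  by rewrite hE -scalemxAr -scalemxAl mulmxDr mulmxDl bp pb mulmxA bka -!mulmxA bk.
have kah : ka *m h = h *m ka.
  by rewrite hE -scalemxAr -scalemxAl mulmxDr mulmxDl kap pka -mulmxA kka.
have at_ : a *m t = t *m a by apply: tC; rewrite // ap pa.
have bt : b *m t = t *m b by apply: tC; rewrite // bp pb.
have kat : ka *m t = t *m ka by apply: tC; rewrite // kap pka.
have [b2 b2E] : exists x, x = a *m ka by eexists.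
have b2A : b2^t* = b2 by rewrite b2E adjmxM kaA aA aka.
have pb2 : p *m b2 = b2 by rewrite b2E mulmxA pa.
have b2p : b2 *m p = b2 by rewrite b2E -mulmxA kap.
have b2b2 : b2 *m b2 = p by rewrite {1}b2E b2E aka -mulmxA [a *m (_ *m a)]mulmxA aka -mulmxA aa kap kaka.
have b2b : b2 *m b = ka *m w by rewrite b2E aka -mulmxA def_w.
have kaw' : ka *m w^t* = w^t* *m ka by rewrite wA mulmxA -bka -mulmxA -aka mulmxA.
have bb2 : b *m b2 = ka *m w^t* by rewrite b2E mulmxA -wA kaw'.
(* The standard intertwiner of two nearby symmetries: [g0] satisfies g0 b = b2 g0 and is close to
   [p]. Its unitary part, formed with [t], is the required rotation. *)
have [g0 g0E] : exists x, x = half *: (p + b2 *m b) by eexists.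
have g0A : g0^t* = half *: (p + b *m b2).
  by rewrite g0E adjmxZ adjmxD adjmxM bA b2A pA fmorphV /= conjC_nat.
have h2E : h = half *: (half *: (p + p + ka *m w + ka *m w^t*)).
  rewrite hE kE -scalemxAr mulmxDr.
  by move: (ka *m w) (ka *m w^t*) => x y; apply/matrixP=> i j; rewrite !mxE; field.
have gg1 : g0 *m g0^t* = h.
  rewrite g0A g0E h2E -scalemxAl -scalemxAr; congr (_ *: (_ *: _)).
  rewrite mulmxDr !mulmxDl pp -[b2 *m b *m p]mulmxA bp -mulmxA [b *m (b *m _)]mulmxA bb pb2 b2b2.
  by rewrite mulmxA pb b2b bb2; move: (ka *m w) (ka *m w^t*) => x y;
    apply/matrixP=> i j; rewrite !mxE; ring.
have gg2 : g0^t* *m g0 = h.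
  rewrite g0A g0E h2E -scalemxAl -scalemxAr; congr (_ *: (_ *: _)).
  rewrite mulmxDr !mulmxDl pp -[b *m b2 *m p]mulmxA b2p -mulmxA [b2 *m (b2 *m _)]mulmxA b2b2 pb bb.
  by rewrite mulmxA pb2 b2b bb2; move: (ka *m w) (ka *m w^t*) => x y;
    apply/matrixP=> i j; rewrite !mxE; ring.
have b2t : b2 *m t = t *m b2 by rewrite b2E -mulmxA kat mulmxA at_ -mulmxA.
have g0t : g0 *m t = t *m g0.
  rewrite g0E -scalemxAl -scalemxAr mulmxDl mulmxDr pt tp; congr (_ *: (_ + _)).
  by rewrite -mulmxA bt mulmxA b2t -mulmxA.
have g0t' : g0^t* *m t = t *m g0^t*.
  by have := congr1 (fun x : 'M[R[i]]_r => x^t*) g0t; rewrite !adjmxM tA => ->.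
have pg0 : p *m g0 = g0 by rewrite g0E -scalemxAr mulmxDr pp mulmxA pb2.
have ht : h *m t = t *m h by apply: tC; rewrite // hp ph.
have g0b : g0 *m b = b2 *m g0.
  rewrite g0E -scalemxAl -scalemxAr mulmxDl mulmxDr pb -mulmxA bb b2p mulmxA b2b2 pb.
  by rewrite addrC.
have Ng0 : N (g0 - p) <= 5%:R / 4%:R * dl.
  have -> : g0 - p = half *: ((ka - w) *m w + (w *m w - p)).
    rewrite g0E b2b mulmxBl; move: (ka *m w) (w *m w) => x y.
    by apply/matrixP=> i j; rewrite !mxE; field.
  have -> : ka - w = k *m (s - p) + half *: (w^t* *m (p - w *m w)).
    rewrite mulmxBr kp -kaE mulmxBr w'p mulmxA ww2 pw kE.
    by apply/matrixP=> i j; rewrite !mxE; field.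
  have Nk : N k <= 1.
    rewrite kE cn_half; have := cnD hN w (w^t*); rewrite (cnA hN); lra.
  have Nw' : N (w^t*) <= 1 by rewrite (cnA hN).
  have n1 := cnM_le Nk Ns; have n2 : N (w^t* *m (p - w *m w)) <= 1 * dl.
    by apply: cnM_le; rewrite // (cnBC hN).
  have n3 := cnD hN (k *m (s - p)) (half *: (w^t* *m (p - w *m w))).
  rewrite cn_half in n3.
  rewrite cn_half; have := cnD hN ((k *m (s - p) + half *: (w^t* *m (p - w *m w))) *m w) (w *m w - p).
  have := cnM hN (k *m (s - p) + half *: (w^t* *m (p - w *m w))) w.
  have := cn_ge0 hN (k *m (s - p) + half *: (w^t* *m (p - w *m w))).
  have := cn_ge0 hN w; nra.
have gg : (g0 *m t) *m (g0 *m t)^t* = p.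
  by rewrite adjmxM tA -g0t' {1}g0t -!mulmxA [g0 *m (_ *m t)]mulmxA gg1 ht mulmxA.
exists (g0 *m t); split; first exact: gg.
- by rewrite adjmxM tA -mulmxA [g0^t* *m _]mulmxA gg2 ht mulmxA.
- by split; [rewrite mulmxA pg0|rewrite -mulmxA tp].
- have -> : g0 *m t - p = (g0 - p) *m t + (t - p) by rewrite mulmxBl pt addrA subrK.
  have Nt' : N t <= 1 + 2%:R * dl.
    have := cnD hN (t - p) p; rewrite subrK; lra.
  have := cnD hN ((g0 - p) *m t) (t - p); have := cnM_le Ng0 Nt'; nra.
- have -> : g0 *m t *m b *m (g0 *m t)^t* = b2.
    have e : g0 *m t *m b = b2 *m (g0 *m t) by rewrite -mulmxA -bt mulmxA g0b mulmxA.
    by rewrite e -mulmxA gg b2p.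
  by rewrite b2E mulmxA aa pka -mulmxA -aka mulmxA aa pka.
Qed.

End CommutingRotation.

(** * Ranks and the parity estimate *)

Lemma kernel_meet (C : fieldType) (r : nat) (p q : 'M[C]_r) : (\rank q < \rank p)%N ->
  exists v : 'rV[C]_r, [/\ v != 0, (v <= p)%MS & v *m q = 0].
Proof.
move=> h; have : (p :&: kermx q)%MS != 0.
  rewrite -mxrank_eq0 -lt0n; have := mxrank_mul_ker p q.
  have := mxrankM_maxr p q; lia.
case/rowV0Pn=> v; rewrite sub_capmx => /andP[vp /sub_kermxP vq] v0.
by exists v.
Qed.

(** The rank of a projection is its trace, and a homomorphism multiplies traces by the rank of the
    image of a minimal projection. The parity of a composite is thus odd only if both factors are
    odd. *)
Lemma hom_rank_comp (C : numClosedFieldType) r r' r'' (Phi : 'M[C]_r -> 'M[C]_r')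
    (Psi : 'M[C]_r' -> 'M[C]_r'') c c' : star_hom Phi -> star_hom Psi ->
  \rank (Psi (Phi (delta_mx c c))) = (\rank (Psi (delta_mx c' c')) * \rank (Phi (delta_mx c c)))%N.
Proof.
move=> hPhi hPsi; apply/eqP; rewrite -(eqr_nat C) natrM.
have h1 := mhom_unitMM hPhi c c c; have h2 := mhom_unitMM hPsi c' c' c'.
have h3 : Psi (Phi (delta_mx c c)) *m Psi (Phi (delta_mx c c)) = Psi (Phi (delta_mx c c)).
  by rewrite -(mhomM hPsi) h1.
by rewrite -(idem_trace h1) -(idem_trace h2) -(idem_trace h3) (mhom_tr hPsi c').
Qed.

Section RankClose.
Variables (R : realType) (r : nat) (N : 'M[R[i]]_r -> R).
Hypothesis hN : cnorm N.

Lemma rank_close_le (p q : 'M[R[i]]_r) : p^t* = p -> p *m p = p -> N (p - q) < 1 ->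
  (\rank p <= \rank q)%N.
Proof.
move=> pA pp pq; rewrite leqNgt; apply/negP => /kernel_meet [v [v0 vp vq]].
have {vp} vp : v *m p = v by case/submxP: vp => y ->; rewrite -mulmxA pp.
have [e eE] : exists e, e = v^t* *m v by eexists.
have e0 : N e != 0.
  by apply: contra_neq v0 => /(cn_eq0 hN) e0; apply: adjmx_mul_eq0; rewrite -eE.
have ee : e = e *m (p - q) by rewrite mulmxBr eE -!mulmxA vp vq mulmx0 subr0.
have := cnM hN e (p - q); rewrite -ee; have := cn_ge0 hN e; have : 0 < N e by rewrite lt0r e0 (cn_ge0 hN).
move: (N e) (N _) pq => x y; nra.
Qed.

Lemma rank_close (p q : 'M[R[i]]_r) : p^t* = p -> p *m p = p -> q^t* = q -> q *m q = q ->
  N (p - q) < 1 -> \rank p = \rank q.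
Proof.
move=> pA pp qA qq pq; apply/eqP; rewrite eqn_leq !rank_close_le //.
by rewrite -opprB (cnN hN).
Qed.

(** The norm that [N] induces on the smaller algebra through y -> W y W^* is a C*-norm, so it is
    [N']; what remains is multiplication by a projection on each side. *)
Lemma cn_isom r' (W : 'M[R[i]]_(r, r')) (N' : 'M[R[i]]_r' -> R) (x : 'M[R[i]]_r) (y : 'M[R[i]]_r') :
  cnorm N' -> W^t* *m W = 1%:M -> W^t* *m x *m W = y -> N' y <= N x.
Proof.
move=> hN' WW <-; have hW := conj_hom WW.
have WA : W *m W^t* *m (W *m W^t*) = W *m W^t* by rewrite mulmxA -[_ *m W]mulmxA WW mulmx1.
have NW : N (W *m W^t*) <= 1 by apply: (cn_proj_le hN); rewrite // adjmxM trmxCK.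
have <- : N (W *m (W^t* *m x *m W) *m W^t*) = N' (W^t* *m x *m W).
  apply: (cnorm_shom hN' hN hW) => a b /(congr1 (fun z => W^t* *m z *m W)).
  by rewrite !mulmxA WW !mul1mx -!mulmxA WW !mulmx1.
have -> : W *m (W^t* *m x *m W) *m W^t* = (W *m W^t*) *m x *m (W *m W^t*) by rewrite !mulmxA.
have := cnM hN (W *m W^t* *m x) (W *m W^t*); have := cnM hN (W *m W^t*) x.
move: NW (cn_ge0 hN (W *m W^t*)) (cn_ge0 hN x) (cn_ge0 hN (W *m W^t* *m x)).
move: (N (W *m W^t*)) (N x) (N (_ *m x)) (N _) => a b d e; nra.
Qed.

End RankClose.

Lemma mxcomm_sqr (C : pzRingType) r (x y : 'M[C]_r) : x *m y = y *m x ->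
  x *m y *m (x *m y) = x *m x *m (y *m y).
Proof. by move=> h; rewrite mulmxA -[x *m y *m x]mulmxA -h !mulmxA. Qed.

Lemma gsabE (C : numClosedFieldType) (n n' : sizes) (Phi : blockmx C n -> blockmx C n') c d :
  star_hom Phi -> gsa Phi c *m gsb Phi c d =
  Sg n' *m Phi (delta_mx c d) *m (Sg n' *m (Phi (delta_mx c d))^t*).
Proof.
move=> h; rewrite /gsa /gsb !mulmxA -[_ *m Phi (delta_mx c d)]mulmxA (mhom_unitMM h).
by rewrite (mhom_unitA h).
Qed.

Lemma gcomm_sqr (C : numClosedFieldType) (n n' : sizes) (Phi : blockmx C n -> blockmx C n') c d :
  good Phi -> base_pair C c d -> gcomm Phi c d ->
  (gsa Phi c *m gsb Phi c d) *m (gsa Phi c *m gsb Phi c d) = Phi (delta_mx c c).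
Proof.
move=> g cd k; rewrite mxcomm_sqr //.
by rewrite (gsa_sqr g cd) (gsb_sqr g cd) (mhom_unitMM (good_hom g)).
Qed.

(** The two factors of ab for the composite commute, so its square is the image of the square for
    [Phi] times the spread of the square for [Psi], and the latter is trivial on the range of
    [W]. *)
Lemma parity_twine (C : numClosedFieldType) (n n' n'' : sizes)
    (Phi : blockmx C n -> blockmx C n') (Psi : blockmx C n' -> blockmx C n'') c d c' d' :
  good Phi -> good Psi -> base_pair C c d -> base_pair C c' d' ->
  odd (\rank (Psi (delta_mx c' c'))) ->
  exists W : 'M[C]_(_, _), W^t* *m W = 1%:M /\
    let z := gsa (Psi \o Phi) c *m gsb (Psi \o Phi) c d in
    let y := gsa Phi c *m gsb Phi c d in
    W^t* *m (z *m z - Psi (Phi (delta_mx c c))) *m W = y *m y - Phi (delta_mx c c).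
Proof.
move=> gPhi gPsi cd cd' od; have hPsi := good_hom gPsi.
have [W [WW WP Wh]] := odd_fixed_isometry gPsi cd' od; exists W; split=> //=.
rewrite (gs_comp gPhi gPsi cd cd'); move: Wh.
move: (gsa Phi c *m _) => y; set q := gsa Psi c' *m _ => Wh.
have hh : hat Psi Psi c' q *m hat Psi Psi c' q = hat Psi Psi c' (q *m q).
  rewrite (hatM _ _ hPsi); congr (hat _ _ _ (_ *m _)).
  by rewrite /q -mulmxA (gsb_p gPsi).
have hc : hat Psi Psi c' q *m Psi y = Psi y *m hat Psi Psi c' q by rewrite (hat_twine hPsi hPsi).
have -> : hat Psi Psi c' q *m Psi y *m (hat Psi Psi c' q *m Psi y) =
          Psi (y *m y) *m hat Psi Psi c' (q *m q).
  by rewrite -hh (mhomM hPsi) hc mxcomm_sqr.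
move: (hat _ _ _ _) Wh => h Wh; rewrite mulmxBr mulmxBl -!mulmxA Wh !WP !mulmxA WW !mul1mx.
by [].
Qed.

Section Parity.
Variables (R : realType) (n n' n'' : sizes).
Local Notation C := R[i].
Variables (N' : blockmx C n' -> R) (N'' : blockmx C n'' -> R).
Hypotheses (hN' : cnorm N') (hN'' : cnorm N'').

Lemma cn_Sg : N'' (Sg n'') <= 1.
Proof.
by apply: (cn_pisom hN'' (adjmx1 _ _) (mulmx1 _)); rewrite Sg_adj Sg_sqr.
Qed.

Lemma cn_SgM x : N'' (Sg n'' *m x) <= N'' x.
Proof. by rewrite -[leRHS]mul1r; apply: (cnM_le hN'') => //; exact: cn_Sg. Qed.

Lemma cnM_close x y u v (e : R) : N'' x <= 1 -> N'' v <= 1 -> N'' (x - u) <= e ->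
  N'' (y - v) <= e -> N'' (x *m y - u *m v) <= 2%:R * e.
Proof.
move=> x1 v1 xu yv; have -> : x *m y - u *m v = x *m (y - v) + (x - u) *m v.
  by rewrite mulmxBr mulmxBl addrA subrK.
apply: le_trans (cnD hN'' _ _) _; rewrite mulrDl mul1r; apply: lerD.
  by rewrite -[e]mul1r; apply: (cnM_le hN'').
by rewrite -[e]mulr1; apply: (cnM_le hN'').
Qed.

(** The commuting symmetries of [al] make (ab)^2 exactly al(e_cc). The product ab of the composite
    has two factors, each e-close to that of [al], so it is 2e-close and its square 4e-close; one
    more e replaces al(e_cc) by the corner of the composite. Close projections have equal rank,
    which makes both multiplicities odd. *)
Lemma parity_bound (Phi : blockmx C n -> blockmx C n') (Psi : blockmx C n' -> blockmx C n'')
    (al : blockmx C n -> blockmx C n'') (c d : 'I_(\sum_(i < 4) n i)) (c' d' : 'I_(\sum_(i < 4) n' i)) (e : R) :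
  good Phi -> good Psi -> good al -> base_pair C c d -> base_pair C c' d' ->
  gcomm al c d -> odd (\rank (al (delta_mx c c))) ->
  N'' (Psi (Phi (delta_mx c c)) - al (delta_mx c c)) <= e ->
  N'' (Psi (Phi (delta_mx c d)) - al (delta_mx c d)) <= e -> e < 1 ->
  let y := gsa Phi c *m gsb Phi c d in
  N' (y *m y - Phi (delta_mx c c)) <= 5%:R * e /\ odd (\rank (Phi (delta_mx c c))).
Proof.
move=> gPhi gPsi gal cd cd' kal oal e1 e2 el; have hPhi := good_hom gPhi.
have hPsi := good_hom gPsi; have hal := good_hom gal.
have gb := good_comp gPhi gPsi; have hb := good_hom gb.
have : odd (\rank (Psi (Phi (delta_mx c c)))).
  rewrite (rank_close hN'' _ _ _ _ (le_lt_trans e1 el)); first exact: oal.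
  - exact: (mhom_unitA hb c c).
  - exact: (mhom_unitMM hb c c c).
  - exact: (mhom_unitA hal c c).
  - exact: (mhom_unitMM hal c c c).
rewrite (hom_rank_comp c c' hPhi hPsi) oddM => /andP[od od2] y; split; last exact: od2.
have [W [WW WE]] := parity_twine gPhi gPsi cd cd' od.
apply: le_trans (cn_isom hN'' hN' WW WE) _; move=> {WE WW W}.
set z := _ *m gsb _ c d; rewrite -/y.
have [w wE] : exists w, w = gsa al c *m gsb al c d by eexists.
have N1 (P : blockmx C n -> blockmx C n'') : star_hom P -> N'' (P (delta_mx c d)) <= 1.
  move=> hP; apply: (cn_pisom hN'' (mhom_unitA hP d d) (mhom_unitMM hP d d d)).
  by rewrite (mhom_unitA hP) (mhom_unitMM hP).
have S1 (P : blockmx C n -> blockmx C n'') : star_hom P -> N'' (Sg n'' *m P (delta_mx c d)) <= 1.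
  by move=> hP; apply: le_trans (cn_SgM _) (N1 P hP).
have S2 (P : blockmx C n -> blockmx C n'') : star_hom P -> N'' (Sg n'' *m (P (delta_mx c d))^t*) <= 1.
  by move=> hP; apply: le_trans (cn_SgM _) _; rewrite (cnA hN''); exact: N1.
have zN : N'' z <= 1.
  by rewrite /z (gsabE _ _ hb) -[1]mulr1; apply: (cnM_le hN''); [exact: S1|exact: S2].
have wN : N'' w <= 1.
  by rewrite wE (gsabE _ _ hal) -[1]mulr1; apply: (cnM_le hN''); [exact: S1|exact: S2].
have zw : N'' (z - w) <= 2%:R * e.
  rewrite /z wE (gsabE _ _ hb) (gsabE _ _ hal); apply: cnM_close.
  - exact: S1.
  - exact: S2.
  - by rewrite -mulmxBr; apply: le_trans (cn_SgM _) _.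
  - by rewrite -mulmxBr -adjmxB; apply: le_trans (cn_SgM _) _; rewrite (cnA hN'').
have := cnM_close zN wN zw zw; have -> : w *m w = al (delta_mx c c) by rewrite wE gcomm_sqr.
move=> h; have := cn_tri hN'' (al (delta_mx c c)) (z *m z) (Psi (Phi (delta_mx c c))).
move: e1; rewrite -(cnN hN'') opprB => e1; lra.
Qed.
End Parity.

Section Rotate.
Variables (C : numClosedFieldType) (n n' : sizes) (Phi : blockmx C n -> blockmx C n').
Local Notation r := (\sum_(i < 4) n i)%N.
Variables (c d : 'I_r) (g : blockmx C n').
Hypotheses (gPhi : good Phi) (cd : base_pair C c d).
Local Notation E x y := (Phi (delta_mx x y)).
Local Notation p := (E c c).
Hypotheses (gg : g *m g^t* = p) (gg' : g^t* *m g = p) (pg : p *m g = g) (gp : g *m p = g).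
Let hPhi := good_hom gPhi.

(** Only the bottom part of the column is turned. Units within one side keep their images, so a is
    unchanged, while b is conjugated by [g]. *)
Definition rotate_vec x := E x c *m (if btop x then p else g^t*).
Definition rotate := frame_hom rotate_vec.

Let gp' : g^t* *m p = g^t*.
Proof. by rewrite -{1}(mhom_unitA hPhi c c) -adjmxM pg. Qed.

Lemma rotate_delta x y : rotate (delta_mx x y) =
  E x c *m (if btop x then if btop y then p else g else if btop y then g^t* else p) *m E c y.
Proof.
rewrite /rotate frame_delta /rotate_vec adjmxM (mhom_unitA hPhi) !mulmxA; congr (_ *m _).
rewrite -[LHS]mulmxA; congr (_ *m _); do 2 case: ifP => _.
- by rewrite (mhom_unitA hPhi) (mhom_unitMM hPhi).
- by rewrite trmxCK pg.
- by rewrite (mhom_unitA hPhi) gp'.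
- by rewrite trmxCK gg'.
Qed.

Lemma rotate_same x y : btop x = btop y -> rotate (delta_mx x y) = E x y.
Proof.
move=> xy; rewrite rotate_delta xy.
by case: (btop y); rewrite !(mhom_unitMM hPhi).
Qed.

Lemma rotate_good : good rotate.
Proof.
apply: (@frame_good _ _ _ _ p) => [a b|a|a|a b ab].
- rewrite /rotate_vec adjmxM (mhom_unitA hPhi) !mulmxA -[_ *m E c a *m E b c]mulmxA.
  rewrite (mhom_unitM hPhi); case: eqP => [<-|_]; last by rewrite mulmx0 mul0mx.
  case: ifP => _; first by rewrite (mhom_unitA hPhi) !(mhom_unitMM hPhi).
  by rewrite trmxCK gp gg.
- by rewrite /rotate_vec; case: ifP => _; rewrite ?(mhom_unitMMl hPhi) // -mulmxA gp'.
- rewrite /rotate_vec mulmxA (good_F gPhi) Fg_delta (shomZ hPhi) -scalemxAl.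
  by [].
- by rewrite -(frame_delta) -/rotate rotate_same // (good_Sunit gPhi ab) -scalemxAl -mulmxA Sg_sqr mulmx1.
Qed.

Lemma rotate_cc x : rotate (delta_mx x x) = E x x. Proof. exact: rotate_same. Qed.

Lemma rotate_gsa : gsa rotate c = gsa Phi c. Proof. by rewrite /gsa rotate_cc. Qed.

Lemma rotate_gsb : gsb rotate c d = g *m gsb Phi c d *m g^t*.
Proof.
have [tc /negbTE td _ _] := cd.
by rewrite /gsb !rotate_delta tc td !mulmxA pg -[_ *m g^t* *m p]mulmxA gp'.
Qed.

Lemma rotate_gcomm :
  gsa Phi c *m (g *m gsb Phi c d *m g^t*) = g *m gsb Phi c d *m g^t* *m gsa Phi c ->
  gcomm rotate c d.
Proof. by rewrite /gcomm rotate_gsa rotate_gsb. Qed.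

End Rotate.

Section Fix.
Variables (R : realType) (n n' : sizes).
Local Notation C := R[i].
Variables (N : blockmx C n' -> R) (Phi : blockmx C n -> blockmx C n').
Local Notation r := (\sum_(i < 4) n i)%N.
Variables (c d : 'I_r).
Hypotheses (hN : cnorm N) (gPhi : good Phi) (cd : base_pair C c d).

Lemma cn_hom_unit x y : N (Phi (delta_mx x y)) <= 1.
Proof.
have hPhi := good_hom gPhi.
apply: (cn_pisom hN (mhom_unitA hPhi y y) (mhom_unitMM hPhi y y y)).
by rewrite (mhom_unitA hPhi) (mhom_unitMM hPhi).
Qed.

Lemma gcomm_fix (dl : R) : dl <= 1 / 8%:R ->
  let y := gsa Phi c *m gsb Phi c d in N (y *m y - Phi (delta_mx c c)) <= dl ->
  exists Phi' : blockmx C n -> blockmx C n', [/\ good Phi', gcomm Phi' c d,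
    forall x, Phi' (delta_mx x x) = Phi (delta_mx x x) &
    forall x y, N (Phi' (delta_mx x y) - Phi (delta_mx x y)) <= 5%:R * dl].
Proof.
move=> dl8 y yN; have hPhi := good_hom gPhi; have dl0 := le_trans (cn_ge0 hN _) yN.
have [g [gg gg' [pg gp] gN gC]] := commuting_rotation hN (mhom_unitA hPhi c c)
  (mhom_unitMM hPhi c c c) (gsa_adj gPhi cd) (gsb_adj gPhi c d) (gsa_sqr gPhi cd)
  (gsb_sqr gPhi cd) (p_gsa gPhi cd) (gsa_p gPhi c) (p_gsb gPhi c d) (gsb_p gPhi c d) yN dl8.
exists (rotate Phi c g); split.
- exact: rotate_good.
- exact: rotate_gcomm.
- by move=> x; apply: rotate_cc.
- move=> x z; have [xz|xz] := eqVneq (btop x) (btop z).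
    by rewrite rotate_same // subrr (cn0 hN) mulr_ge0.
  have -> : Phi (delta_mx x z) = Phi (delta_mx x c) *m Phi (delta_mx c c) *m Phi (delta_mx c z).
    by rewrite !(mhom_unitMM hPhi).
  rewrite rotate_delta // -mulmxBl -mulmxBr.
  have w : N ((if btop x then if btop z then Phi (delta_mx c c) else g
     else if btop z then g^t* else Phi (delta_mx c c)) - Phi (delta_mx c c)) <= 5%:R * dl.
    move: xz; case: (btop x); case: (btop z) => // _.
    by rewrite -{1}(mhom_unitA hPhi c c) -adjmxB (cnA hN).
  rewrite -[5%:R * dl]mulr1; apply: (cnM_le hN); last exact: cn_hom_unit.
  by rewrite -[5%:R * dl]mul1r; apply: (cnM_le hN); first exact: cn_hom_unit.
Qed.

End Fix.

(** What remains of an odd generic system once the finitely many connecting maps of even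
    multiplicity are discarded. *)
Definition strict (R : realType) (B : cstarAlgType R[i]) (T : tower B) : Prop :=
  forall k, gcomm (@tcon _ _ T k) (tc T k) (td T k) /\
    odd (\rank (tcon T (delta_mx (tc T k) (tc T k)))).

Lemma gcomm_id (C : numClosedFieldType) (n : sizes) (c d : 'I_(\sum_(i < 4) n i)) :
  base_pair C c d -> gcomm (@id (blockmx C n)) c d.
Proof.
case=> tc td sc sd; rewrite /gcomm /gsa /gsb Sg_delta sc scale1r.
by rewrite Sg_deltar sd scale1r mul_delta_mx.
Qed.

Lemma strict_map (R : realType) (B : cstarAlgType R[i]) (T : tower B) k n :
  strict T -> (k <= n)%N -> exists al : blockmx R[i] (ts T k) -> blockmx R[i] (ts T n),
  [/\ good al, forall x, ti T (al x) = ti T x, gcomm al (tc T k) (td T k) &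
      odd (\rank (al (delta_mx (tc T k) (tc T k))))].
Proof.
move=> sT; have h0 m : exists al : blockmx R[i] (ts T m) -> blockmx R[i] (ts T m),
  [/\ good al, forall x, ti T (al x) = ti T x, gcomm al (tc T m) (td T m) &
      odd (\rank (al (delta_mx (tc T m) (tc T m))))].
  exists id; split; [exact: good_id|by []| |by rewrite mxrank_delta].
  by apply: gcomm_id; exact: tcd.
elim: n => [|n IH]; first by rewrite leqn0 => /eqP ->.
rewrite leq_eqVlt => /orP[/eqP->|]; first exact: h0.
rewrite ltnS => /IH [al [gal ale kal oal]]; have [s1 s2] := sT n.
exists (@tcon _ _ T n \o al); split.
- exact: (good_comp gal (@tcon_good _ _ T n)).
- by move=> x /=; rewrite tconE.
- exact: (gcomm_comp gal (@tcon_good _ _ T n) (tcd T k) (tcd T n)).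
- rewrite /= (hom_rank_comp _ (tc T n) (good_hom gal) (good_hom (@tcon_good _ _ T n))).
  by rewrite oddM s2 oal.
Qed.

Lemma near_fin (I : finType) (P : I -> nat -> Prop) :
  (forall i, near_infty (P i)) -> near_infty (fun m => forall i, P i m).
Proof.
move=> h; have [K hK] := choice h; exists (\max_i K i)%N => m le i.
by apply: hK; apply: leq_trans le; exact: leq_bigmax.
Qed.

Section GcommApprox.
Variable R : realType.
Local Notation C := (R[i]).
Variables (B B' : cstarAlgType C) (T : tower B) (T' : tower B').
Variables (F : B -> B') (G : B' -> B).
Hypotheses (FG : tower_iso T T' F G) (sT : strict T).
Variable k : nat.
Local Notation M k := (blockmx C (ts T k)).
Local Notation M' k := (blockmx C (ts T' k)).
Local Notation r := (\sum_(i < 4) ts T k i)%N.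
Local Notation E a b := (delta_mx a b : M k).

Lemma hom_tends (Phi : forall m, M k -> M' m) : near_infty (fun m => star_hom (Phi m)) ->
  (forall a b, tends (fun m => Phi m (E a b)) (F (ti T (E a b)))) ->
  forall x, tends (fun m => Phi m x) (F (ti T x)).
Proof.
move=> hPhi te x; have hr := rho_hom FG k.
have -> : F (ti T x) = \sum_a \sum_b x a b *: F (ti T (E a b)).
  rewrite [x in LHS]matrix_sum_delta (shom_sum hr); apply: eq_bigr => a _.
  by rewrite (shom_sum hr); apply: eq_bigr => b _; rewrite (shomZ hr).
apply: (@tends_ev _ _ _ (fun m => \sum_a \sum_b x a b *: Phi m (E a b))).
  case: hPhi => K hK; exists K => m /hK h; by rewrite (mhom_sum h x).
apply: tends_sum => a; apply: tends_sum => b; apply: tendsZ; exact: te.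
Qed.

End GcommApprox.

Section CloseMap.
Variable R : realType.
Local Notation C := (R[i]).
Variables (B B' : cstarAlgType C) (T : tower B) (T' : tower B').
Variables (F : B -> B') (G : B' -> B).
Hypotheses (FG : tower_iso T T' F G) (sT : strict T).
Variable k : nat.
Local Notation M k := (blockmx C (ts T k)).
Local Notation M' k := (blockmx C (ts T' k)).
Local Notation r := (\sum_(i < 4) ts T k i)%N.
Local Notation E a b := (delta_mx a b : M k).
Local Notation c := (tc T k).
Local Notation d := (td T k).
Let GF := tower_iso_sym FG.

(** [Phi] is followed by an approximant of the inverse at a late stage n. The composite is 2e-close
    to the connecting map, and [parity_bound] turns this into 5 (2e). *)
Lemma gcomm_defect m (Phi : M k -> M' m) (e : R) : 0 < e -> e < 1 -> good Phi ->
  nm (ti T' (Phi (E c c)) - F (ti T (E c c))) < e ->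
  nm (ti T' (Phi (E c d)) - F (ti T (E c d))) < e ->
  forall y, y = gsa Phi c *m gsb Phi c d -> nm (ti T' (y *m y - Phi (E c c))) <= 10%:R * e.
Proof.
move=> e0 e1 gPhi hc hd y yE.
have [Psi [hgood te]] := good_approx GF m.
have hhom : near_infty (fun n => star_hom (Psi n)) by apply: near_imp hgood => n /good_hom.
have tx := hom_tends GF hhom te.
have [K hK] : near_infty (fun n => good (Psi n) /\
    (nm (ti T (Psi n (Phi (E c c))) - G (ti T' (Phi (E c c)))) < e /\
     nm (ti T (Psi n (Phi (E c d))) - G (ti T' (Phi (E c d)))) < e)).
  by apply: near_and hgood (near_and (tx _ e e0) (tx _ e e0)).
have [gPsi [nc nd]] := hK _ (leq_maxl K k).
have [al [gal ale kal oal]] := strict_map sT (leq_maxr K k).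
set n := maxn K k in gPsi nc nd al gal ale kal oal.
have close x : nm (ti T (Psi n (Phi x)) - G (ti T' (Phi x))) < e ->
    nm (ti T' (Phi x) - F (ti T x)) < e -> nm (ti T (Psi n (Phi x) - al x)) <= 2%:R * e.
  move=> h1 h2; rewrite (shomB (@ti_hom _ _ T n)) ale.
  have := nm_tri (G (ti T' (Phi x))) (ti T (Psi n (Phi x))) (ti T x).
  have <- : nm (ti T' (Phi x) - F (ti T x)) = nm (G (ti T' (Phi x)) - ti T x).
    by rewrite -{2}(iso_FK FG (ti T x)) -(shomB (iso_homG FG)) (iso_nm GF).
  lra.
(* The parity argument asks for 2e < 1; otherwise the trivial bound 2 is already below 10e. *)
have [e2|e2] := lerP (1 / 2%:R) e; last first.
  have [h _] := parity_bound (ti_cnorm T' m) (ti_cnorm T n) gPhi gPsi gal (tcd T k)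
    (tcd T' m) kal oal (close _ nc hc) (close _ nd hd) ltac:(lra).
  by rewrite -yE in h; apply: le_trans h _; lra.
have hPhi := good_hom gPhi; have N := ti_cnorm T' m.
have p1 := cn_hom_unit N gPhi c c.
have y1 : nm (ti T' y) <= 1.
  apply: (cn_pisom N (mhom_unitA hPhi c c) (mhom_unitMM hPhi c c c)).
  rewrite yE (gsab_adj gPhi (tcd T k)) mulmxA -[gsb Phi c d *m gsa Phi c *m gsa Phi c]mulmxA (gsa_sqr gPhi (tcd T k)).
  by rewrite (gsb_p gPhi) (gsb_sqr gPhi (tcd T k)).
have := cnM_le N y1 y1; have := cnB N (y *m y) (Phi (E c c)); lra.
Qed.

Lemma close_map K (e : R) : 0 < e -> exists m (Phi : M k -> M' m),
  [/\ (K <= m)%N, good Phi, gcomm Phi c d &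
      forall a b, nm (ti T' (Phi (E a b)) - F (ti T (E a b))) < e].
Proof.
(* The defect is at most 10e', which must not exceed 1/8 for the rotation to exist: 1/100 is enough.
   The rotation then moves units by 50e', so the total error 51e' is below e when e' <= e/200. *)
move=> e0; pose e' := Num.min (e / 200%:R) (1 / 100%:R).
have e'0 : 0 < e' by rewrite lt_min; apply/andP; split; [apply: divr_gt0|]; lra.
have e'e : e' <= e / 200%:R by rewrite ge_min lexx.
have e'1 : e' <= 1 / 100%:R by rewrite ge_min lexx orbT.
clearbody e'.
have [Phi [[K1 h1] te]] := good_approx FG k.
have [K2 h2] : near_infty (fun m => forall ab : 'I_r * 'I_r,
    nm (ti T' (Phi m (E ab.1 ab.2)) - F (ti T (E ab.1 ab.2))) < e').
  by apply: near_fin => ab; exact: te.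
pose m := maxn K (maxn K1 K2).
have Km : (K <= m)%N by apply: leq_maxl.
have K1m : (K1 <= m)%N by rewrite /m; lia.
have K2m : (K2 <= m)%N by rewrite /m; lia.
have gPhi := h1 m K1m; have {h2}h2 a b := h2 m K2m (a, b).
have yN : nm (ti T' (gsa (Phi m) c *m gsb (Phi m) c d *m (gsa (Phi m) c *m gsb (Phi m) c d) -
    Phi m (E c c))) <= 10%:R * e'.
  by apply: (gcomm_defect e'0) => //; [lra|exact: h2|exact: h2].
have [|Phi' [gPhi' kPhi' _ hPhi']] := gcomm_fix (ti_cnorm T' m) gPhi (tcd T k) _ yN; first lra.
exists m, Phi'; split; [exact: Km|exact: gPhi'|exact: kPhi'|] => a b.
have := nm_tri (ti T' (Phi m (E a b))) (ti T' (Phi' (E a b))) (F (ti T (E a b))).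
have := h2 a b; have := hPhi' a b; rewrite /= (shomB (@ti_hom _ _ T' m)) => u v w.
apply: le_lt_trans w _; lra.
Qed.

End CloseMap.

(** * Uniqueness of nearby maps *)

Section Average.
Variables (C : numClosedFieldType) (r : nat) (a b p a' b' p' : 'M[C]_r).
Hypotheses (aa : a *m a = p) (bb : b *m b = p) (pa : p *m a = a) (pb : p *m b = b) (ap : a *m p = a).
Hypothesis ab : a *m b = b *m a.
Hypotheses (aa' : a' *m a' = p') (bb' : b' *m b' = p') (pb' : p' *m b' = b').
Hypotheses (ap' : a' *m p' = a') (bp' : b' *m p' = b') (ab' : a' *m b' = b' *m a').

(** Two commuting symmetries are a representation of the Klein four-group on the corner. This is the
    average over the group of g acting in the second representation times g acting in the first,
    hence an intertwiner. *)
Definition group_avg := 4%:R^-1 *: (p' *m p + a' *m a + b' *m b + a' *m b' *m (a *m b)).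

Lemma group_avg_a : a' *m group_avg = group_avg *m a.
Proof.
rewrite /group_avg -scalemxAr -scalemxAl; congr (_ *: _); rewrite !mulmxDr !mulmxDl.
rewrite !mulmxA ap' aa' pb' -[p' *m p *m a]mulmxA pa -[a' *m a *m a]mulmxA aa.
rewrite -[b' *m b *m a]mulmxA -ab mulmxA.
have -> : a' *m b' *m a *m b *m a = a' *m b' *m b.
  by rewrite -[_ *m b *m a]mulmxA -ab mulmxA -[_ *m a *m a]mulmxA aa -[_ *m p *m b]mulmxA pb.
by rewrite [X in X + _ + _]addrC addrAC -!addrA; congr (_ + (_ + _)); rewrite addrC.
Qed.

Lemma group_avg_b : b' *m group_avg = group_avg *m b.
Proof.
rewrite /group_avg -scalemxAr -scalemxAl; congr (_ *: _); rewrite !mulmxDr !mulmxDl.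
have -> : b' *m (p' *m p) = b' *m p by rewrite mulmxA bp'.
have -> : b' *m (a' *m a) = b' *m a' *m a by rewrite mulmxA.
have -> : b' *m (b' *m b) = p' *m b by rewrite mulmxA bb'.
have -> : b' *m (a' *m b' *m (a *m b)) = a' *m a *m b.
  by rewrite !mulmxA -ab' -[a' *m b' *m b']mulmxA bb' ap'.
have -> : p' *m p *m b = p' *m b by rewrite -mulmxA pb.
have -> : b' *m b *m b = b' *m p by rewrite -mulmxA bb.
have -> : a' *m b' *m (a *m b) *m b = b' *m a' *m a.
  by rewrite -[LHS]mulmxA -[a *m b *m b]mulmxA bb ap ab'.
move: (b' *m p) (b' *m a' *m a) (p' *m b) (a' *m a *m b) => x y z w.
by apply/matrixP=> i j; rewrite !mxE; ring.
Qed.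

End Average.

Section Twine.
Variables (C : numClosedFieldType) (n n' : sizes) (P P' : blockmx C n -> blockmx C n').
Hypotheses (gP : good P) (gP' : good P').
Variables (c d : 'I_(\sum_(i < 4) n i)) (q : blockmx C n').
Hypotheses (cd : base_pair C c d).
Hypotheses (qa : gsa P' c *m q = q *m gsa P c) (qb : gsb P' c d *m q = q *m gsb P c d).
Let hP := good_hom gP.
Let hP' := good_hom gP'.
Local Notation z1 := (hat P' P c q).

(** The second term fills the complements of the two supports, on which both homomorphisms vanish,
    so that the intertwiner is close to 1 on the whole space. *)
Definition twiner := z1 + (1%:M - P' 1%:M) *m (1%:M - P 1%:M).

Lemma hat_1l : P' 1%:M *m z1 = z1.
Proof. by rewrite /hat mulmx_sumr; apply: eq_bigr => x _; rewrite !mulmxA (mhom1M hP'). Qed.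

Lemma hat_1r : z1 *m P 1%:M = z1.
Proof. by rewrite -(hat_twine hP' hP) hat_1l. Qed.

(** The signature meets [q] only through a on top rows and b on bottom rows, and [q] intertwines
    both pairs. *)
Lemma hat_diagalg : diagalg z1.
Proof.
split.
  have -> : Fg n' *m z1 = z1 *m P (Fg n).
    by rewrite -{1}hat_1l mulmxA (good_F gP') mulmx1 (hat_twine hP' hP).
  by rewrite -[Fg n]mul1mx -(good_Fr gP) mulmxA hat_1r.
rewrite /hat mulmx_sumr mulmx_suml; apply: eq_bigr => x _.
have hq : gsh P' c d x *m q = q *m gsh P c d x by rewrite /gsh; case: ifP.
rewrite !mulmxA (good_Sc gP' cd) -[RHS]mulmxA (good_Scr gP cd) -!scalemxAl -scalemxAr.
by congr (_ *: _); rewrite mulmxA -[_ *m gsh P' c d x *m q]mulmxA hq !mulmxA.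
Qed.

Lemma twiner_diagalg : diagalg twiner.
Proof.
have h1 := good_diagalg gP (diagalg1 _ _); have h2 := good_diagalg gP' (diagalg1 _ _).
rewrite /twiner; apply: (diagalgD hat_diagalg); apply: diagalgM.
  by apply: diagalgB h2; exact: diagalg1.
by apply: diagalgB h1; exact: diagalg1.
Qed.

Lemma twinerE y : P' y *m twiner = twiner *m P y.
Proof.
rewrite /twiner [LHS]mulmxDr [RHS]mulmxDl (hat_twine hP' hP); congr (_ + _).
have -> : P' y *m ((1%:M - P' 1%:M) *m (1%:M - P 1%:M)) = 0.
  by rewrite mulmxA [P' y *m _]mulmxBr mulmx1 (mhomM1 hP') subrr mul0mx.
have e : (1%:M - P 1%:M) *m P y = 0 by rewrite mulmxBl mul1mx (mhom1M hP) subrr.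
by rewrite -mulmxA e mulmx0.
Qed.

Lemma twinerA y : twiner^t* *m twiner *m P y = P y *m (twiner^t* *m twiner).
Proof.
have e : twiner^t* *m P' y = P y *m twiner^t*.
  have := congr1 (fun x : 'M[C]_(_, _) => x^t*) (twinerE (y^t*)).
  by rewrite !adjmxM (mhomA hP) (mhomA hP') !trmxCK.
by rewrite -mulmxA -twinerE !mulmxA e.
Qed.

End Twine.

Section AverageClose.
Variables (R : realType) (r : nat) (N : 'M[R[i]]_r -> R).
Hypothesis hN : cnorm N.

Lemma cnD4 x y z w (k l m t : R) : N x <= k -> N y <= l -> N z <= m -> N w <= t ->
  N (x + y + z + w) <= k + l + m + t.
Proof.
move=> hx hy hz hw; apply: le_trans (cnD hN _ _) (lerD _ hw).
apply: le_trans (cnD hN _ _) (lerD _ hz); exact: le_trans (cnD hN _ _) (lerD hx hy).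
Qed.

Lemma cn_sum_le (I : finType) (f : I -> 'M[R[i]]_r) (k : R) : (forall i, N (f i) <= k) ->
  N (\sum_i f i) <= #|I|%:R * k.
Proof.
move=> h; apply: le_trans (cn_sum hN _ _ _) _.
apply: le_trans (ler_sum _ (fun i _ => h i)) _.
by rewrite sumr_const mulr_natl.
Qed.

Variables (a b p a' b' p' : 'M[R[i]]_r) (e : R).

Lemma group_avg_close : N a <= 1 -> N b' <= 1 -> N a' <= 1 -> N p' <= 1 ->
  a' *m a' = p' -> b' *m b' = p' -> p' *m p' = p' -> a' *m b' *m (a' *m b') = p' ->
  N (p - p') <= e -> N (a - a') <= e -> N (b - b') <= 2%:R * e ->
  N (group_avg a b p a' b' p' - p') <= 2%:R * e.
Proof.
move=> a1 b1' a1' p1 aa bb pp ab hp ha hb; rewrite /group_avg.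
have -> : 4%:R^-1 *: (p' *m p + a' *m a + b' *m b + a' *m b' *m (a *m b)) - p' =
  4%:R^-1 *: (p' *m (p - p') + a' *m (a - a') + b' *m (b - b') +
    a' *m b' *m (a *m (b - b') + (a - a') *m b')).
  have -> : a *m (b - b') + (a - a') *m b' = a *m b - a' *m b'.
    by rewrite mulmxBr mulmxBl addrA subrK.
  rewrite !mulmxBr pp aa bb ab.
  move: (p' *m p) (a' *m a) (b' *m b) (a' *m b' *m (a *m b)) => x y z w.
  by apply/matrixP=> i j; rewrite !mxE; field.
rewrite (cnZ hN) -(rmorph_nat (real_complex R)) -fmorphV cabs_real ger0_norm //.
have h1 : N (p' *m (p - p')) <= 1 * e by exact: (cnM_le hN).
have h2 : N (a' *m (a - a')) <= 1 * e by exact: (cnM_le hN).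
have h3 : N (b' *m (b - b')) <= 1 * (2%:R * e) by exact: (cnM_le hN).
have h4 : N (a' *m b' *m (a *m (b - b') + (a - a') *m b')) <= 1 * 1 * (1 * (2%:R * e) + e * 1).
  apply: (cnM_le hN); first exact: (cnM_le hN).
  by apply: le_trans (cnD hN _ _) _; apply: lerD; exact: (cnM_le hN).
have e0 := le_trans (cn_ge0 hN _) hp; have := cnD4 h1 h2 h3 h4; move: (N _) => t ht; rewrite mulrC ler_pdivrMr //; lra.
Qed.

End AverageClose.

Section Uniqueness.
Variables (R : realType) (n n' : sizes) (N : blockmx R[i] n' -> R).
Local Notation C := R[i].
Variables (P P' : blockmx C n -> blockmx C n') (c d : 'I_(\sum_(i < 4) n i)).
Local Notation r := (\sum_(i < 4) n i)%N.
Local Notation E x y := (delta_mx x y : blockmx C n).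
Hypotheses (hN : cnorm N) (gP : good P) (gP' : good P') (cd : base_pair C c d).
Hypotheses (kP : gcomm P c d) (kP' : gcomm P' c d).
Variable e : R.
Hypothesis close : forall x y, N (P' (E x y) - P (E x y)) <= e.
Let hP := good_hom gP.
Let hP' := good_hom gP'.
Local Notation q := (group_avg (gsa P c) (gsb P c d) (P (E c c)) (gsa P' c) (gsb P' c d) (P' (E c c))).

Let close_p : N (P (E c c) - P' (E c c)) <= e.
Proof. by rewrite -opprB (cnN hN). Qed.

Let close_e x y : N (P (E x y) - P' (E x y)) <= e.
Proof. by rewrite -opprB (cnN hN). Qed.

Lemma gsa_le1 (Q : blockmx C n -> blockmx C n') : good Q -> N (gsa Q c) <= 1.
Proof.
move=> gQ; apply: le_trans (cn_SgM hN _) _; exact: (cn_hom_unit hN gQ).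
Qed.

Lemma gsb_le1 (Q : blockmx C n -> blockmx C n') : good Q -> N (gsb Q c d) <= 1.
Proof.
move=> gQ; rewrite /gsb -mulmxA -[1]mulr1; apply: (cnM_le hN); first exact: (cn_hom_unit hN gQ).
apply: le_trans (cn_SgM hN _) _; exact: (cn_hom_unit hN gQ).
Qed.

Lemma gsa_close : N (gsa P c - gsa P' c) <= e.
Proof. by rewrite /gsa -mulmxBr; apply: le_trans (cn_SgM hN _) _. Qed.

Lemma gsb_close : N (gsb P c d - gsb P' c d) <= 2%:R * e.
Proof.
rewrite /gsb -!mulmxA; apply: (cnM_close hN).
- exact: (cn_hom_unit hN gP).
- apply: le_trans (cn_SgM hN _) _; exact: (cn_hom_unit hN gP').
- exact: close_e.
- by rewrite -mulmxBr; apply: le_trans (cn_SgM hN _) _; exact: close_e.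
Qed.

Lemma avg_close : N (q - P' (E c c)) <= 2%:R * e.
Proof.
apply: (group_avg_close hN _ _ _ _ (gsa_sqr gP' cd) (gsb_sqr gP' cd) _ _ close_p gsa_close gsb_close).
- exact: gsa_le1.
- exact: gsb_le1.
- exact: gsa_le1.
- exact: (cn_hom_unit hN gP').
- exact: (mhom_unitMM hP').
- exact: gcomm_sqr.
Qed.

Lemma twiner_close : N (twiner P P' c q - 1%:M) <= 4%:R * r%:R * e.
Proof.
have h1 : N (hat P' P c q - P' 1%:M) <= r%:R * (3%:R * e).
  have -> : hat P' P c q - P' 1%:M =
      \sum_x P' (E x c) *m (q *m P (E c x) - P' (E c c) *m P' (E c x)).
    rewrite -(hat1 c hP') /hat -sumrB; apply: eq_bigr => x _.
    by rewrite mulmxBr !mulmxA.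
  rewrite -[X in X%:R]card_ord; apply: (cn_sum_le hN) => x.
  have -> : q *m P (E c x) - P' (E c c) *m P' (E c x) =
      (q - P' (E c c)) *m P (E c x) + P' (E c c) *m (P (E c x) - P' (E c x)).
    by rewrite mulmxBr mulmxBl addrA subrK.
  have -> : 3%:R * e = 1 * (2%:R * e * 1 + 1 * e) by ring.
  apply: (cnM_le hN); first exact: (cn_hom_unit hN gP').
  apply: le_trans (cnD hN _ _) _; apply: lerD; apply: (cnM_le hN).
  - exact: avg_close.
  - exact: (cn_hom_unit hN gP).
  - exact: (cn_hom_unit hN gP').
  - exact: close_e.
have h2 : N (P' 1%:M - P 1%:M) <= r%:R * e.
  rewrite mx1_sum_delta (shom_sum hP) (shom_sum hP') -sumrB.
  by rewrite -[X in X%:R]card_ord; apply: (cn_sum_le hN) => x.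
have h3 : N (1%:M - P' 1%:M) <= 1.
  apply: (cn_proj_le hN); first by rewrite adjmxB adjmx1 (mhom1A hP').
  by rewrite mulmxBr mulmx1 mulmxBl mul1mx (mhomM1 hP') subrr subr0.
have -> : twiner P P' c q - 1%:M = (hat P' P c q - P' 1%:M) + (1%:M - P' 1%:M) *m (P' 1%:M - P 1%:M).
  rewrite /twiner !mulmxBr !mulmxBl !mul1mx !mulmx1 (mhomM1 hP').
  by move: (hat _ _ _ _) (P' 1%:M *m _) => x y; apply/matrixP=> i j; rewrite !mxE; ring.
apply: le_trans (cnD hN _ _) _; have := cnM_le hN h3 h2; move: h1; lra.
Qed.

(** The unitary is the polar part of the twiner z. As z^* z commutes with the image of [P] and with
    both symmetries, so does its inverse square root: the polar part still intertwines and is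
    block-diagonal. The twiner is within 4 r e of 1, so the bound on [e] makes this 1/8 and puts z^*
    z within 1/2 of 1. *)
Lemma good_unique : e <= 1 / (32%:R * r%:R) -> (0 < r)%N -> exists u : blockmx C n',
  [/\ u^t* *m u = 1%:M, u *m u^t* = 1%:M, diagalg u & forall x, u *m P x *m u^t* = P' x].
Proof.
move=> er r0; have rr : 0 < r%:R :> R by rewrite ltr0n.
have qa : gsa P' c *m q = q *m gsa P c.
  exact: (group_avg_a (gsa_sqr gP cd) (p_gsa gP cd) (p_gsb gP c d) kP (gsa_sqr gP' cd)
    (p_gsb gP' c d) (gsa_p gP' c)).
have qb : gsb P' c d *m q = q *m gsb P c d.
  exact: (group_avg_b (gsb_sqr gP cd) (p_gsb gP c d) (gsa_p gP c) (gsb_sqr gP' cd)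
    (gsa_p gP' c) (gsb_p gP' c d) kP').
have zD := twiner_diagalg gP gP' cd qa qb.
have zE := twinerE gP gP' c q; have zA := twinerA gP gP' c q.
have := twiner_close; move: (twiner P P' c q) zD zE zA => z zD zE zA zN.
have {}zN : N (z - 1%:M) <= 1 / 8%:R.
  apply: le_trans zN _; have := ler_wpM2l (ltW rr) er.
  have -> : r%:R * (1 / (32%:R * r%:R)) = 1 / 32%:R :> R by field; rewrite lt0r_neq0.
  lra.
have zz : N (z^t* *m z - 1%:M) <= 1 / 2%:R.
  have -> : z^t* *m z - 1%:M = ((z - 1%:M)^t* + (z - 1%:M)) + (z - 1%:M)^t* *m (z - 1%:M).
    rewrite adjmxB adjmx1 mulmxBr !mulmxBl !mul1mx !mulmx1.
    by move: (z^t* *m z) (z^t*) => x y; apply/matrixP=> i j; rewrite !mxE; ring.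
  have zN' : N ((z - 1%:M)^t*) <= 1 / 8%:R by rewrite (cnA hN).
  have := cnM_le hN zN' zN; have := cnD hN ((z - 1%:M)^t*) (z - 1%:M).
  have := cnD hN ((z - 1%:M)^t* + (z - 1%:M)) ((z - 1%:M)^t* *m (z - 1%:M)).
  move: zN zN'; lra.
have zzA : (z^t* *m z)^t* = z^t* *m z by rewrite adjmxM trmxCK.
have [s [sA _ ss _ sC]] := isqrt_exists hN zzA (adjmx1 _ _) (mulmx1 _) (mul1mx _) (mulmx1 _) zz.
have sC' y : y *m (z^t* *m z) = z^t* *m z *m y -> y *m s = s *m y.
  by move=> h; apply: (sC _ h); rewrite mulmx1 mul1mx.
have szz : z^t* *m z *m s = s *m (z^t* *m z) by apply: sC'.
have uu : (z *m s)^t* *m (z *m s) = 1%:M.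
  by rewrite adjmxM sA -ss -!mulmxA -szz !mulmxA.
have zsA : (z *m s)^t* = s *m z^t* by rewrite adjmxM sA.
have uu' : z *m s *m (s *m z^t*) = 1%:M by rewrite -zsA; apply: mulmx1C.
exists (z *m s); split.
- exact: uu.
- by rewrite zsA.
- have [zF zS] := zD; have [zF' zS'] := diagalgA zD; apply: (diagalgM zD); split; apply: sC'.
    by rewrite mulmxA zF' -[LHS]mulmxA zF mulmxA.
  by rewrite mulmxA zS' -[LHS]mulmxA zS mulmxA.
move=> x; have sP : P x *m s = s *m P x by apply: sC'; rewrite zA.
have -> : z *m s *m P x = P' x *m (z *m s) by rewrite -[LHS]mulmxA -sP [LHS]mulmxA -zE -[LHS]mulmxA.
by rewrite zsA -[LHS]mulmxA uu' mulmx1.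
Qed.

End Uniqueness.

Definition dunitary (C : numClosedFieldType) (n : sizes) (u : blockmx C n) :=
  [/\ u^t* *m u = 1%:M, u *m u^t* = 1%:M & diagalg u].

(** * The intertwining argument *)

Section ConjGood.
Variables (C : numClosedFieldType) (n n' : sizes) (P : blockmx C n -> blockmx C n').
Variables (u : blockmx C n').
Hypotheses (gP : good P) (hu : dunitary u).
Let hP := good_hom gP.
Local Notation Q := (fun x => u *m P x *m u^t*).

Lemma dunitary_adj : dunitary (u^t*).
Proof. by case: hu => h1 h2 h3; split; rewrite ?trmxCK //; exact: diagalgA. Qed.

Lemma dunitaryM v : dunitary v -> dunitary (u *m v).
Proof.
case: hu => h1 h2 h3 [k1 k2 k3]; split; last exact: diagalgM.
- by rewrite adjmxM mulmxA -[_ *m u]mulmxA h1 mulmx1.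
- by rewrite adjmxM mulmxA -[u *m v *m _]mulmxA k2 mulmx1.
Qed.

Lemma conj_mul x y : u *m x *m u^t* *m (u *m y *m u^t*) = u *m (x *m y) *m u^t*.
Proof.
case: hu => h1 _ _; rewrite !mulmxA; congr (_ *m _ *m _).
by rewrite -[LHS]mulmxA h1 mulmx1.
Qed.

Lemma conj_Fg : Fg n' *m u = u *m Fg n' /\ u^t* *m Fg n' = Fg n' *m u^t*.
Proof. by case: hu => _ _ h; have [h1 _] := h; have [h2 _] := diagalgA h. Qed.

Lemma conj_Sg : Sg n' *m u = u *m Sg n' /\ u^t* *m Sg n' = Sg n' *m u^t*.
Proof. by case: hu => _ _ h; have [_ h1] := h; have [_ h2] := diagalgA h. Qed.

Lemma conj_good : good Q.
Proof.
have [F1 F2] := conj_Fg; have [S1 S2] := conj_Sg; have [_ PF PS] := gP.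
split.
- by case: hu => h1 _ _; exact: (shom_comp hP (conj_hom h1)).
- by rewrite !mulmxA F1 -[u *m _ *m P _]mulmxA PF.
- move=> x /PS <-; rewrite !mulmxA S1 -[_ *m u^t* *m Sg _]mulmxA S2.
  by rewrite !mulmxA.
Qed.

Lemma conj_SgM x : Sg n' *m (u *m x *m u^t*) = u *m (Sg n' *m x) *m u^t*.
Proof. by have [S1 _] := conj_Sg; rewrite !mulmxA S1. Qed.

Lemma conj_gcomm c d : gcomm P c d -> gcomm Q c d.
Proof.
rewrite /gcomm; have -> : gsa Q c = u *m gsa P c *m u^t* by exact: conj_SgM.
have -> : gsb Q c d = u *m gsb P c d *m u^t*.
  by rewrite /gsb -[LHS]mulmxA conj_SgM conj_mul [P _ *m (_ *m _)]mulmxA.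
by move=> k; rewrite !conj_mul k.
Qed.

Lemma conj_neq0 x : P x != 0 -> Q x != 0.
Proof.
case: hu => h1 _ _; apply: contra_neq => /(congr1 (fun y => u^t* *m y *m u)).
by rewrite mulmx0 mul0mx !mulmxA h1 mul1mx -[LHS]mulmxA h1 mulmx1.
Qed.

End ConjGood.

Section Amplify.
Variables (C : numClosedFieldType) (n n' : sizes) (P : blockmx C n -> blockmx C n').
Hypothesis gP : good P.
Let hP := good_hom gP.

(** [P] need not be unital; the identity added off its support keeps the images of unitaries
    unitary. *)
Definition amplify (u : blockmx C n) : blockmx C n' := P u + (1%:M - P 1%:M).

Lemma amplify_mul u x : amplify u *m P x = P (u *m x).
Proof. by rewrite mulmxDl mulmxBl mul1mx (mhom1M hP) subrr addr0 (mhomM hP). Qed.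

Lemma amplifyA u : (amplify u)^t* = amplify (u^t*).
Proof. by rewrite adjmxD adjmxB adjmx1 -!(mhomA hP) adjmx1. Qed.

Lemma amplify_mulr u x : P x *m amplify u = P (x *m u).
Proof. by rewrite mulmxDr mulmxBr mulmx1 (mhomM1 hP) subrr addr0 (mhomM hP). Qed.

Lemma amplifyM u v : amplify u *m amplify v = amplify (u *m v).
Proof.
rewrite {2}/amplify mulmxDr amplify_mul mulmxBr mulmx1 amplify_mul mulmx1 /amplify.
by rewrite addrAC subrr add0r.
Qed.

Lemma amplify1 : amplify 1%:M = 1%:M.
Proof. by rewrite /amplify addrC subrK. Qed.

Lemma amplify_dunitary u : dunitary u -> dunitary (amplify u).
Proof.
case=> h1 h2 h3; split.
- by rewrite amplifyA amplifyM h1 amplify1.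
- by rewrite amplifyA amplifyM h2 amplify1.
- apply: diagalgD; first exact: good_diagalg.
  by apply: diagalgB; [exact: diagalg1|apply: (good_diagalg gP); exact: diagalg1].
Qed.

(* If phi = Ad(v) phi0 and Ad(u) (P phi0) = al, this is how Ad(w) P is made to
   compose with phi to exactly al. *)
Lemma amplify_conj (u y : blockmx C n') (v x : blockmx C n) : v^t* *m v = 1%:M -> u *m P x *m u^t* = y ->
  let w := u *m amplify (v^t*) in w *m P (v *m x *m v^t*) *m w^t* = y.
Proof.
move=> vv <- /=; rewrite adjmxM amplifyA trmxCK -[u *m _ *m P _]mulmxA amplify_mul.
rewrite mulmxA -[u *m _ *m amplify v]mulmxA amplify_mulr.
by rewrite !mulmxA vv mul1mx -[x *m _ *m v]mulmxA vv mulmx1.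
Qed.
End Amplify.

Section Stepping.
Variable R : realType.
Local Notation C := (R[i]).
Variables (B B' : cstarAlgType C) (T : tower B) (T' : tower B').
Local Notation M k := (blockmx C (ts T k)).
Local Notation M' k := (blockmx C (ts T' k)).
Local Notation r k := (\sum_(i < 4) ts T k i)%N.
Local Notation r' k := (\sum_(i < 4) ts T' k i)%N.

(** Half of the threshold of [good_unique]: in a composite, two crossover maps contribute one such
    error each. *)
Definition near_hom (F : B -> B') k m (phi : M k -> M' m) : Prop :=
  [/\ good phi, gcomm phi (tc T k) (td T k) &
    forall a b, nm (ti T' (phi (delta_mx a b)) - F (ti T (delta_mx a b : M k))) <=
      1 / (64%:R * (r k)%:R)].

(** Making the diagram exact conjugates the maps by unitaries that may be far from 1, so the exact
    maps need not approximate [F]. The closeness needed for the next step is kept in [phi0]. *)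
Definition state (F : B -> B') k m (phi : M k -> M' m) : Prop :=
  exists (phi0 : M k -> M' m) (u : M' m), [/\ near_hom F phi0, dunitary u &
    phi = fun x => u *m phi0 x *m u^t*].

Variables (F : B -> B') (G : B' -> B).
Hypotheses (FG : tower_iso T T' F G).

Lemma near_hom_neq0 k m (phi : M k -> M' m) : near_hom F phi ->
  phi (delta_mx (tc T k) (tc T k)) != 0.
Proof.
case=> gphi _ close; apply/eqP => e; have := close (tc T k) (tc T k).
rewrite e (shom0 (@ti_hom _ _ T' m)) sub0r nmN (iso_nm FG) (cn_unit (ti_cnorm T k)).
rewrite ler_pdivlMr ?mulr_gt0 ?ltr0n ?tr_gt0 // mul1r => h.
have : (1 : R) <= (r k)%:R by rewrite ler1n tr_gt0.
lra.
Qed.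

Lemma state_good k m (phi : M k -> M' m) : state F phi ->
  [/\ good phi, gcomm phi (tc T k) (td T k) & phi (delta_mx (tc T k) (tc T k)) != 0].
Proof.
case=> phi0 [u [h hu ->]]; have [g kk _] := h; split.
- exact: conj_good.
- exact: conj_gcomm.
- exact: (conj_neq0 hu (near_hom_neq0 h)).
Qed.

Lemma state_regular k m (phi : M k -> M' m) : state F phi -> regular_embedding phi.
Proof. by case/state_good=> g kk n0; exact: (good_regular g (tcd T k) kk n0). Qed.

Hypothesis sT : strict T.

Lemma near_hom_exists k K (e : R) : 0 < e -> exists m (phi : M k -> M' m),
  [/\ (K <= m)%N, near_hom F phi &
   forall a b, nm (ti T' (phi (delta_mx a b)) - F (ti T (delta_mx a b : M k))) <= e].
Proof.
move=> e0; have r0 : 0 < 64%:R * (r k)%:R :> R by rewrite mulr_gt0 ?ltr0n ?tr_gt0.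
pose e' := Num.min e (1 / (64%:R * (r k)%:R)).
have e'0 : 0 < e' by rewrite lt_min e0 divr_gt0.
have [m [phi [Km g kk close]]] := close_map FG sT k K e'0.
exists m, phi; split; [exact: Km|split; [exact: g|exact: kk|]|] => a b.
  by apply: le_trans (ltW (close a b)) _; rewrite ge_min lexx orbT.
by apply: le_trans (ltW (close a b)) _; rewrite ge_min lexx.
Qed.

End Stepping.

Section HomDistance.
Variable R : realType.
Local Notation C := (R[i]).
Variables (B B' : cstarAlgType C) (T : tower B) (T' : tower B').
Variables (F : B -> B') (G : B' -> B).
Hypotheses (FG : tower_iso T T' F G).
Local Notation M k := (blockmx C (ts T k)).
Local Notation M' k := (blockmx C (ts T' k)).

Lemma hom_distance k m (phi : M k -> M' m) (e : R) x : star_hom phi ->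
  (forall a b, nm (ti T' (phi (delta_mx a b)) - F (ti T (delta_mx a b : M k))) <= e) ->
  nm (ti T' (phi x) - F (ti T x)) <=
  (\sum_(i < 4) ts T k i)%:R * ((\sum_(i < 4) ts T k i)%:R * (e * nm (ti T x))).
Proof.
move=> hphi close; have hr := rho_hom FG k; have h' := shom_comp hphi (@ti_hom _ _ T' m).
have -> : ti T' (phi x) - F (ti T x) =
    \sum_a \sum_b x a b *: (ti T' (phi (delta_mx a b)) - F (ti T (delta_mx a b : M k))).
  rewrite {1 2}[x]matrix_sum_delta (shom_sum hr) [ti T' _](shom_sum h') -sumrB.
  apply: eq_bigr => a _; rewrite (shom_sum hr) (shom_sum h') -sumrB; apply: eq_bigr => b _.
  by rewrite (shomZ hr) (shomZ h') scalerBr.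
have bound (I : finType) (f : I -> B') (l : R) : (forall i, nm (f i) <= l) ->
    nm (\sum_i f i) <= #|I|%:R * l.
  move=> h; apply: le_trans (nm_sum _ _ _) _.
  by apply: le_trans (ler_sum _ (fun i _ => h i)) _; rewrite sumr_const mulr_natl.
rewrite -[X in X%:R * _]card_ord; apply: (bound _ _ _) => a.
rewrite -[X in X%:R * _]card_ord; apply: (bound _ _ _) => b.
rewrite nmZ mulrC; apply: ler_pM => //; rewrite ?nm_ge0 ?cabs_ge0 //.
exact: (cn_entry (ti_cnorm T k)).
Qed.

End HomDistance.

Section Step.
Variable R : realType.
Local Notation C := (R[i]).
Variables (B B' : cstarAlgType C) (T : tower B) (T' : tower B').
Variables (F : B -> B') (G : B' -> B).
Hypotheses (FG : tower_iso T T' F G) (sT : strict T) (sT' : strict T').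
Local Notation M k := (blockmx C (ts T k)).
Local Notation M' k := (blockmx C (ts T' k)).
Local Notation r k := (\sum_(i < 4) ts T k i)%N.
Local Notation r' k := (\sum_(i < 4) ts T' k i)%N.
Let GF := tower_iso_sym FG.

Lemma state_init K : exists k (phi : M 0%N -> M' k), (K <= k)%N /\ state F phi.
Proof.
have [m [phi [Km h _]]] := near_hom_exists FG sT 0 K ltr01.
exists m, phi; split=> //; exists phi, 1%:M; split=> //.
- by split; rewrite ?adjmx1 ?mulmx1 //; exact: diagalg1.
- by apply/funext => x; rewrite adjmx1 mul1mx mulmx1.
Qed.

Lemma state_step k m (phi : M k -> M' m) K : state F phi ->
  exists n (psi : M' m -> M n), [/\ (K <= n)%N, state G psi & forall x, ti T (psi (phi x)) = ti T x].
Proof.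
case=> phi0 [u [[gphi0 kphi0 close0] hu ->]].
have rk : 0 < (r k)%:R :> R by rewrite ltr0n tr_gt0.
have rm : 0 < (r' m)%:R :> R by rewrite ltr0n tr_gt0.
(* [psi0] is applied to images of units under [phi0], which are not units; expanding them over the
   matrix units of stage m costs a factor (r' m)^2. *)
have e0 : 0 < 1 / ((r' m)%:R * (r' m)%:R * (64%:R * (r k)%:R)) :> R.
  by apply: divr_gt0 => //; apply: mulr_gt0; apply: mulr_gt0.
have [n [psi0 [Kn [gpsi0 kpsi0 close1] close]]] := near_hom_exists GF sT' m (maxn K k) e0.
have [al [gal ale kal _]] := strict_map sT (leq_trans (leq_maxr K k) Kn).
have kc := gcomm_comp gphi0 gpsi0 (tcd T k) (tcd T' m) kphi0 kpsi0.
have cl a b : nm (ti T (al (delta_mx a b) - (psi0 \o phi0) (delta_mx a b))) <= 1 / (32%:R * (r k)%:R).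
  have := hom_distance GF (phi0 (delta_mx a b)) (good_hom gpsi0) close.
  have N1 : nm (ti T' (phi0 (delta_mx a b))) <= 1 by exact: (cn_hom_unit (ti_cnorm T' m) gphi0).
  have h2 : nm (G (ti T' (phi0 (delta_mx a b))) - ti T (delta_mx a b : M k)) <= 1 / (64%:R * (r k)%:R).
    rewrite -{1}(iso_FK FG (ti T (delta_mx a b : M k))) -(shomB (iso_homG FG)) (iso_nm GF).
    exact: close0.
  set lhs := nm _ => h1; have {h1} h1 : lhs <= 1 / (64%:R * (r k)%:R).
    apply: le_trans h1 _; rewrite mulrA -[leRHS]mulr1.
    have -> : 1 / (64%:R * (r k)%:R) = (r' m)%:R * (r' m)%:R *
       (1 / ((r' m)%:R * (r' m)%:R * (64%:R * (r k)%:R))) :> R.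
      by field; rewrite (lt0r_neq0 rk) (lt0r_neq0 rm).
    rewrite -[leRHS]mulrA (ler_pM2l (mulr_gt0 rm rm)); apply: ler_wpM2l N1; exact: (ltW e0).
  rewrite (shomB (@ti_hom _ _ T n)) ale -opprB nmN.
  have := nm_tri (G (ti T' (phi0 (delta_mx a b)))) (ti T (psi0 (phi0 (delta_mx a b)))) (ti T (delta_mx a b : M k)).
  rewrite -/lhs => h3.
  have -> : 1 / (32%:R * (r k)%:R) = 1 / (64%:R * (r k)%:R) + 1 / (64%:R * (r k)%:R) :> R.
    by field; rewrite (lt0r_neq0 rk).
  by apply: le_trans h3 _; exact: lerD.
have [v [vv vv' vD vE]] := good_unique (ti_cnorm T n) (good_comp gphi0 gpsi0) gal (tcd T k) kc kal cl
  (lexx _) (tr_gt0 T k).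
have hv : dunitary v by split.
have hu' := dunitary_adj hu; have [uu _ _] := hu.
exists n, (fun x => (v *m amplify psi0 (u^t*)) *m psi0 x *m (v *m amplify psi0 (u^t*))^t*); split.
- exact: leq_trans (leq_maxl K k) Kn.
- exists psi0, (v *m amplify psi0 (u^t*)); split; [exact: And3 gpsi0 kpsi0 close1| |by []].
  by apply: (dunitaryM hv); exact: amplify_dunitary.
- move=> x; rewrite (amplify_conj gpsi0 (y := al x) uu); first exact: ale.
  exact: vE.
Qed.

End Step.

Section Intertwining.
Variable R : realType.
Local Notation C := (R[i]).
Variables (B B' : cstarAlgType C) (T : tower B) (T' : tower B').
Variables (F : B -> B') (G : B' -> B).
Hypotheses (FG : tower_iso T T' F G) (sT : strict T) (sT' : strict T').
Local Notation M k := (blockmx C (ts T k)).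
Local Notation M' k := (blockmx C (ts T' k)).
Let GF := tower_iso_sym FG.

(** Only the forward map is carried along; the backward map arises in between, and its own state for
    [G] produces the next forward map. *)
Record link := Link {
  lk : nat; lm : nat; lphi : M lk -> M' lm; lstate : state F lphi }.

Definition link_next (s t : link) (psi : M' (lm s) -> M (lk t)) : Prop :=
  [/\ regular_embedding psi, forall x, ti T (psi (@lphi s x)) = ti T x &
      forall x, ti T' (@lphi t (psi x)) = ti T' x].

Lemma link_step s : exists t : link,
  [/\ (lk s < lk t)%N, (lm s < lm t)%N & exists psi, @link_next s t psi].
Proof.
case: s => k m phi st.
have [n [psi [kn spsi psiE]]] := state_step FG sT sT' k.+1 st.
have [m' [phi' [mm' sphi' phiE]]] := state_step GF sT' sT m.+1 spsi.
exists (Link sphi'); split=> //; exists psi; split=> //.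
exact: (state_regular GF spsi).
Qed.

Lemma crossover : exists (n m : nat -> nat) (phi : forall i, M (n i) -> M' (m i))
    (psi : forall i, M' (m i) -> M (n i.+1)),
  [/\ forall i, (n i < n i.+1)%N /\ (m i < m i.+1)%N,
      forall i, regular_embedding (phi i) /\ regular_embedding (psi i),
      forall i x, ti T (psi i (phi i x)) = ti T x &
      forall i x, ti T' (phi i.+1 (psi i x)) = ti T' x].
Proof.
have [k [phi0 [_ st0]]] := state_init FG sT 0.
have [f hf] := choice link_step.
pose s i := iter i f (Link st0).
have hs i : [/\ (lk (s i) < lk (s i.+1))%N, (lm (s i) < lm (s i.+1))%N &
  exists psi, @link_next (s i) (s i.+1) psi] by exact: (hf (s i)).
have /dep_choice[psi hpsi] : forall i, exists psi, @link_next (s i) (s i.+1) psi.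
  by move=> i; case: (hs i).
exists (fun i => lk (s i)), (fun i => lm (s i)), (fun i => @lphi (s i)), psi; split.
- by move=> i; case: (hs i).
- move=> i; split; first exact: (state_regular FG (@lstate (s i))).
  by case: (hpsi i).
- by move=> i; case: (hpsi i).
- by move=> i; case: (hpsi i).
Qed.

End Intertwining.

Lemma nm_dist (R : realType) (V : normedModType R[i]) (x y : V) :
  - nm (x - y) <= nm x - nm y <= nm (x - y).
Proof.
have := nm_tri x y 0; have := nm_tri y x 0; rewrite !subr0 (nmBC y x).
by move=> *; apply/andP; split; lra.
Qed.

(** * From crossover maps to an isomorphism *)

Section Extension.
Variable R : realType.
Local Notation C := (R[i]).
Variables (B B' : cstarAlgType C) (T : tower B) (T' : tower B').
Local Notation M k := (blockmx C (ts T k)).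
Local Notation M' k := (blockmx C (ts T' k)).
Variable Phi : forall k, M k -> M' k.
Hypotheses (hPhi : forall k, star_hom (@Phi k)) (iPhi : forall k, injective (@Phi k)).
Hypothesis coherent : forall k (x : M k) (y : M k.+1), ti T y = ti T x ->
  ti T' (Phi y) = ti T' (Phi x).

Lemma ext_iso k (x : M k) : nm (ti T' (Phi x)) = nm (ti T x).
Proof. exact: (cnorm_shom (ti_cnorm T k) (ti_cnorm T' k) (hPhi k) (@iPhi k)). Qed.

Lemma ext_coherent k m (x : M k) (y : M m) : (k <= m)%N -> ti T y = ti T x ->
  ti T' (Phi y) = ti T' (Phi x).
Proof.
elim: m y => [|m IH] y.
  by rewrite leqn0 => /eqP e; subst k => /(@ti_inj _ _ T 0) ->.
rewrite leq_eqVlt => /orP[/eqP e|km yx]; first by subst k => /(@ti_inj _ _ T m.+1) ->.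
have [z zx] : exists z : M m, ti T z = ti T x.
  by have [al [_ ale]] := tower_map T (km : (k <= m)%N); exists (al x).
by rewrite (@coherent _ z) ?yx ?zx //; apply: IH.
Qed.

Lemma ext_diff k m (x : M k) (y : M m) : (k <= m)%N ->
  nm (ti T' (Phi x) - ti T' (Phi y)) = nm (ti T x - ti T y).
Proof.
move=> km; have [al [_ ale]] := tower_map T km.
rewrite -(ale x) -(@ext_coherent k m x (al x) km) //.
by rewrite -(shomB (@ti_hom _ _ T' m)) -(shomB (hPhi m)) ext_iso (shomB (@ti_hom _ _ T m)).
Qed.

Lemma ext_tends0 (z : forall m, M m) : tends z 0 -> tends (fun m => Phi (z m)) (0 : B').
Proof. by move=> h e /h[K hK]; exists K => m /hK; rewrite !subr0 ext_iso. Qed.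

(** By uniqueness of the C*-norm each [Phi] is isometric on its stage, so images of convergent
    sequences converge and the limit depends on [b] alone. *)
Lemma ext_lim b : exists b', forall x : forall m, M m, tends x b -> tends (fun m => Phi (x m)) b'.
Proof.
have [y yb] := dense_seq T b.
have [b' hb'] : exists b', tends (fun m => Phi (y m)) b'.
  apply: tends_cauchy => e e0; have e2 : 0 < e / 2%:R by rewrite divr_gt0.
  have [K hK] := yb _ e2; exists K => m m' Km mm'; rewrite ext_diff //.
  apply: le_lt_trans (nm_tri b _ _) _; have := hK _ Km; have := hK _ (leq_trans Km mm').
  by rewrite -(nmN (ti T (y m') - b)) opprB; lra.
exists b' => x xb; have h := tendsB xb yb; rewrite subrr in h.
have := tendsD (ext_tends0 h) hb'; rewrite add0r; apply: tends_ev; exists 0%N => m _.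
by rewrite (shomB (hPhi m)) subrK.
Qed.

Lemma ext_hom : exists F : B -> B', [/\ star_hom F, forall b, nm (F b) = nm b &
  forall k (x : M k), F (ti T x) = ti T' (Phi x)].
Proof.
have [F hF] := choice ext_lim; exists F.
have FE k (x : M k) : F (ti T x) = ti T' (Phi x).
  have h := hF _ _ (tends_lift x); apply: (tends_uniq h) => e e0; exists k => m km.
  by rewrite (ext_coherent km (tliftE _ km)) subrr nm0.
split=> // [|b].
  apply: star_homP => [c x y|x y|x].
  - have [u ux] := dense_seq T x; have [v vy] := dense_seq T y.
    apply: (tends_uniq (hF _ _ (tendsD (tendsZ c ux) vy))).
    apply: (tends_ev _ (tendsD (tendsZ c (hF _ _ ux)) (hF _ _ vy))); exists 0%N => m _.
    by rewrite (shomD (hPhi m)) (shomZ (hPhi m)).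
  - have [u ux] := dense_seq T x; have [v vy] := dense_seq T y.
    apply: (tends_uniq (hF _ _ (tendsM ux vy))).
    apply: (tends_ev _ (tendsM (hF _ _ ux) (hF _ _ vy))); exists 0%N => m _.
    by rewrite (mhomM (hPhi m)).
  - have [u ux] := dense_seq T x; apply: (tends_uniq (hF _ _ (tendsA ux))).
    apply: (tends_ev _ (tendsA (hF _ _ ux))); exists 0%N => m _.
    by rewrite (mhomA (hPhi m)).
have [u ub] := dense_seq T b; have fb := hF _ _ ub.
have close (e : R) : 0 < e -> `|nm (F b) - nm b| <= 2%:R * e.
  move=> e0; have [K hK] := ub e e0; have [K' hK'] := fb e e0.
  have hu := hK _ (leq_maxl K K'); have hu' := hK' _ (leq_maxr K K').
  have /andP[d1 d2] := nm_dist (ti T' (Phi (u (maxn K K')))) (F b).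
  have /andP[d3 d4] := nm_dist (ti T (u (maxn K K'))) b.
  rewrite ext_iso in d1 d2; rewrite ler_norml; apply/andP; split; lra.
apply/eqP; rewrite -subr_eq0 -normr_eq0 -[_ == 0]negbK; apply/negP => h.
have h0 : 0 < `|nm (F b) - nm b| by rewrite lt0r h normr_ge0.
have := close (`|nm (F b) - nm b| / 4%:R) ltac:(by rewrite divr_gt0); lra.
Qed.

End Extension.

Section IsoFromLinks.
Variable R : realType.
Local Notation C := (R[i]).
Variables (B B' : cstarAlgType C) (T : tower B) (T' : tower B').
Variables (F : B -> B') (G : B' -> B).
Hypotheses (hF : star_hom F) (hG : star_hom G).
Hypotheses (nF : forall b, nm (F b) = nm b) (nG : forall b, nm (G b) = nm b).

Lemma dense_fix (H : B -> B) : star_hom H -> (forall b, nm (H b) = nm b) ->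
  (forall k (x : blockmx C (ts T k)), H (ti T x) = ti T x) -> forall b, H b = b.
Proof.
move=> hH nH HE b; apply/eqP; rewrite -subr_eq0; apply/eqP/nm_eq0/eqP.
rewrite eq_le nm_ge0 andbT leNgt; apply/negP => h.
have h2 : 0 < nm (H b - b) / 4%:R by rewrite divr_gt0.
have [k [x hx]] := ti_dense T b h2.
have := nm_tri (ti T x) (H b) b; rewrite -{1}HE -(shomB hH) nH (nmBC b (ti T x)); lra.
Qed.

Lemma inA_hom (Phi : forall k (x : blockmx C (ts T k)), fourCycle C _ x ->
     inA T' (F (ti T x))) b : inA T b -> inA T' (F b).
Proof.
move=> hb e e0; have e2 : 0 < e / 2%:R by rewrite divr_gt0.
have [k [x [xA hx]]] := hb _ e2; have [m [y [yA hy]]] := Phi k x xA _ e2.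
exists m, y; split=> //; have := nm_tri (F (ti T x)) (ti T' y) (F b).
by rewrite -(shomB hF) nF; lra.
Qed.
End IsoFromLinks.

(** * Generic systems as towers *)

Section SystemTower.
Variables (R : realType) (S : system R[i]).
Local Notation C := (R[i]).
Local Notation M k := (blockmx C (bsize S k)).
Hypothesis genS : generic_system S.

Definition odd_map j k (al : M j -> M k) : Prop := forall c d, base_pair C c d ->
  gcomm al c d /\ odd (\rank (al (delta_mx c c))).

Lemma conn_good k : exists Phi : M k -> M k.+1,
  [/\ star_extension (@conn _ S k) Phi, good Phi &
    (forall m, multiplicity (@conn _ S k) m -> odd m) -> odd_map Phi].
Proof.
have [m [V [s [t [hV oV hE]]]]] := generic_sumconj (genS k).
have hom := sumconj_hom hV oV.
have ext : star_extension (@conn _ S k) (sumconj V) by split=> // x /hE ->.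
exists (sumconj V); split; [exact: ext|exact: (sumconj_good hV oV)|].
move=> om c d cd; split; first exact: (sumconj_comm hV oV cd).
have -> : \rank (sumconj V (delta_mx c c)) = m.
  apply/eqP; rewrite -(eqr_nat C) -idem_trace; last exact: (mhom_unitMM hom).
  by rewrite (sumconj_tr hV) idem_trace ?mul_delta_mx // mxrank_delta mulr1.
apply: om; exists (sumconj V); [exact: ext|exists V; split; last by []].
move=> a b; case: eqP => [<-|/eqP ab]; last exact: oV.
by case: (hV a).
Qed.

Hypothesis oddS : odd_system S.

Lemma odd_eventually : exists K, forall k, (K <= k)%N ->
  forall m, multiplicity (@conn _ S k) m -> odd m.
Proof.
have /finite_seqP[s sE] := oddS; exists (\max_(i <- s) i).+1 => k Kk m hm.
apply/negPn/negP => om; have : k \in s.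
  have : [set k | exists2 m, multiplicity (@conn _ S k) m & ~~ odd m] k by exists m.
  by rewrite sE.
by move=> ks; have := leq_bigmax_seq (P := xpredT) (F := fun i => i) _ ks isT; rewrite leqNgt Kk.
Qed.

End SystemTower.

Section LimitTower.
Variables (R : realType) (S : system R[i]).
Local Notation C := (R[i]).
Local Notation M k := (blockmx C (bsize S k)).
Variables (B : cstarAlgType C) (iota : forall k, M k -> B).
Hypotheses (genS : generic_system S) (lim : cstar_limit iota).

Lemma iota_hom k : star_hom (@iota k). Proof. by case: lim. Qed.
Lemma iota_inj k : injective (@iota k). Proof. by case: lim => _ h _ _; exact: h. Qed.

Lemma conn_map k : exists Phi : M k -> M k.+1,
  [/\ good Phi, forall x, iota (Phi x) = iota x,
    forall x, fourCycle C _ x -> Phi x = conn x &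
    (forall m, multiplicity (@conn _ S k) m -> odd m) -> odd_map Phi].
Proof.
have [Phi [ext gPhi om]] := conn_good genS k; exists Phi; split; [exact: gPhi| |exact: ext.2|exact: om].
by case: lim => _ _ h _; exact: h.
Qed.

Lemma iota_conn k x : stage S k x -> iota (conn x) = iota x.
Proof. by move=> hx; have [Phi [_ e <- // _]] := conn_map k. Qed.

Variable K : nat.

Definition odd_from := forall k, (K <= k)%N -> forall m, multiplicity (@conn _ S k) m -> odd m.

Lemma odd_map_id k : odd_map (@id (M k)).
Proof. by move=> c d cd; split; [exact: gcomm_id|rewrite mxrank_delta]. Qed.

Lemma bsize_base k : exists cd : 'I_(\sum_(i < 4) bsize S k i) * 'I_(\sum_(i < 4) bsize S k i),
  base_pair C cd.1 cd.2.
Proof.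
exists (tagnat.Rank _ (Ordinal (bsize_gt0 S k 0)), tagnat.Rank _ (Ordinal (bsize_gt0 S k (2%:R : 'I_4)))).
by split; rewrite /btop /bsgn /blk ?tagnat.Rank1K //= expr0.
Qed.

Lemma level_map j k : (j <= k)%N -> exists al : M j -> M k,
  [/\ good al, forall x, iota (al x) = iota x &
     odd_from -> (K <= j)%N -> odd_map al].
Proof.
elim: k => [|k IH].
  rewrite leqn0 => /eqP ->; exists id; split; [exact: good_id|by []|by move=> _ _; exact: odd_map_id].
rewrite leq_eqVlt => /orP[/eqP->|].
  exists id; split; [exact: good_id|by []|by move=> _ _; exact: odd_map_id].
rewrite ltnS => jk; have [al [gal ale oal]] := IH jk; have [Phi [gPhi PhiE _ oPhi]] := conn_map k.
exists (Phi \o al); split.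
- exact: (good_comp gal gPhi).
- by move=> x /=; rewrite PhiE.
move=> od Kj c d cd; have [kal ra] := oal od Kj c d cd.
have [[c' d'] /= cd'] := bsize_base k; have [kP rP] := oPhi (od k (leq_trans Kj jk)) _ _ cd'.
split; first exact: (gcomm_comp gal gPhi cd cd').
by rewrite /= (hom_rank_comp c c' (good_hom gal) (good_hom gPhi)) oddM rP ra.
Qed.

Variables (n : nat -> nat) (hn : forall i, (n i < n i.+1)%N).

Let link i := cid (level_map (ltnW (hn i))).

Lemma leq_level i : (i <= n i)%N.
Proof. by elim: i => // i IH; apply: leq_ltn_trans IH (hn i). Qed.

Lemma iota_dense b (e : R) : 0 < e -> exists k x, nm (@iota (n k) x - b) < e.
Proof.
move=> e0; case: lim => _ _ _ dense.
have : closure (\bigcup_k range (@iota k)) b by rewrite dense.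
move/closure_nm => /(_ e e0)[_ [j _ [x _ <-]] xe].
have [al [_ ale _]] := level_map (leq_level j).
by exists j, (al x); rewrite ale.
Qed.

(** The same limit along chosen stages: a shift removes the even connecting maps, and the indices of
    given crossover maps serve in the converse direction. *)
Definition limit_tower : tower B :=
  @Tower _ B (fun i => bsize S (n i)) (fun i => bsize_gt0 S (n i)) (fun i => @iota (n i))
    (fun i => iota_hom (n i)) (fun i => @iota_inj (n i)) (fun i => sval (link i))
    (fun i => let: And3 g _ _ := svalP (link i) in g)
    (fun i => let: And3 _ e _ := svalP (link i) in e) iota_dense.

Lemma limit_tower_strict : odd_from -> (forall i, (K <= n i)%N) -> strict limit_tower.
Proof.
move=> od hK i; have [_ _ o] := svalP (link i).
exact: (o od (hK i) _ _ (tcd limit_tower i)).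
Qed.

Lemma limit_tower_inA b : inA limit_tower b <-> operator_limit iota b.
Proof.
split=> [h|/closure_nm h e /h[_ [j _ [x hx <-]] xe]].
  apply/closure_nm => e /h[k [x [hx xe]]]; exists (iota x); last exact: xe.
  by exists (n k); [|exists x].
have [al [gal ale _]] := level_map (leq_level j).
by exists j, (al x); split; [exact: (good_fourCycle gal)|rewrite /= ale].
Qed.

End LimitTower.

(** Radical units and their adjoints give all units between the sides; products of two of them,
    through [d] or [c], give the units within a side. *)
Lemma fourCycle_generates (C : numClosedFieldType) (n : sizes) (c d : 'I_(\sum_(i < 4) n i))
    (P : set (blockmx C n)) : base_pair C c d -> P 0 ->
  (forall k x y, P x -> P y -> P (k *: x + y)) -> (forall x y, P x -> P y -> P (x *m y)) ->
  (forall x, P x -> P (x^t*)) -> fourCycle C n `<=` P -> forall x, P x.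
Proof.
move=> [tc /negbTE td _ _] P0 PL PM PA PF x.
have top a b : btop a -> btop b = false -> P (delta_mx a b).
  by move=> ta tb; apply: PF; apply: fourCycle_delta; rewrite ta tb orbT.
have low a b : btop a -> btop b = false -> P (delta_mx b a).
  by move=> ta tb; have := PA _ (top a b ta tb); rewrite adjmx_delta.
have unit a b : P (delta_mx a b).
  case ta: (btop a); case tb: (btop b); [|exact: top|exact: low|].
    by rewrite -(mul_delta_mx d); apply: PM; [exact: top|exact: low].
  by rewrite -(mul_delta_mx c); apply: PM; [exact: low|exact: top].
have PD y z : P y -> P z -> P (y + z) by move=> Py Pz; have := PL 1 y z Py Pz; rewrite scale1r.
have PZ k y : P y -> P (k *: y) by move=> Py; have := PL k y 0 Py P0; rewrite addr0.
rewrite [x]matrix_sum_delta; apply: (big_ind P) => // a _.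
by apply: (big_ind P) => // b _; apply: PZ.
Qed.

Section Generated.
Variables (R : realType) (S : system R[i]).
Local Notation C := (R[i]).
Local Notation M k := (blockmx C (bsize S k)).
Variables (B : cstarAlgType C) (iota : forall k, M k -> B).
Hypotheses (genS : generic_system S) (lim : cstar_limit iota).

Lemma operator_limit_generates : cstar_generated (operator_limit iota) = setT.
Proof.
apply/seteqP; split=> // b _ D [[D0 DL DM DA Dc] AD].
have Di k (x : M k) : D (iota x).
  have [[c d] /= cd] := bsize_base S k; have h := iota_hom lim k.
  apply: (fourCycle_generates (P := fun x => D (iota x)) cd) => [|a y z|y z|y|y hy].
  - by rewrite (shom0 h).
  - by move=> Dy Dz; rewrite (shomD h) (shomZ h); exact: DL.
  - by move=> Dy Dz; rewrite [iota (y *m z)](shomM h); exact: DM.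
  - by move=> Dy; rewrite [iota (y^t*)](shomA h); exact: DA.
  - by apply: AD; apply: subset_closure; exists k => //; exists y.
have [_ _ _ dense] := lim; rewrite closureE in dense.
by have : setT b by []; rewrite -dense => /(_ D); apply; split=> // _ [k _ [x _ <-]].
Qed.

Lemma iota_agree j (f : M j -> B) : star_hom f -> (forall x, stage S j x -> f x = iota x) ->
  forall x, f x = iota x.
Proof.
move=> hf fE; have [[c d] /= cd] := bsize_base S j; have h := iota_hom lim j.
apply: (fourCycle_generates (P := fun x => f x = iota x) cd) => [|a y z fy fz|y z fy fz|y fy|y hy].
- by rewrite (shom0 h) (shom0 hf).
- by rewrite (shomD h) (shomD hf) (shomZ h) (shomZ hf) fy fz.
- by rewrite [LHS](shomM hf) [RHS](shomM h) fy fz.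
- by rewrite [LHS](shomA hf) [RHS](shomA h) fy.
- exact: fE.
Qed.

Lemma iter_step j (x : M j) p : stage S j x -> exists y : M (p + j),
  [/\ iter p (@step _ S) (in_stage x) = in_stage y, stage S (p + j) y & iota y = iota x].
Proof.
move=> hx; elim: p => [|p [y [e hy yx]]]; first by exists x.
have [[sf _ _] _] := conn_emb S (p + j).
exists (conn y : M (p.+1 + j)); split; first by rewrite iterS e.
  exact: sf.
by rewrite -yx; exact: (iota_conn genS lim).
Qed.

(** Connecting maps become inclusions in the limit algebra and [iota] is injective, so an iterate of
    [step] can be identified by its image there; an equality in the sigma type is traded for one in
    [B]. *)
Lemma is_connP j k (f : M j -> M k) : (j <= k)%N ->
  (forall x, stage S j x -> stage S k (f x)) ->
  is_conn f <-> forall x, stage S j x -> iota (f x) = iota x.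
Proof.
move=> jk sf; rewrite /is_conn; move: (subnK jk); move: (k - j)%N => p e; case: _ / e in f sf *.
split=> h x hx; have [y [e hy yx]] := iter_step p hx.
  move: (h x hx); rewrite e => /(congr1 (fun v => tagged_as (in_stage y) v)).
  by rewrite /in_stage !tagged_asE => <-.
by rewrite e; congr in_stage; apply: (iota_inj lim); rewrite yx h.
Qed.

End Generated.

Lemma regular_stage (C : numClosedFieldType) (n n' : sizes) (f : blockmx C n -> blockmx C n') :
  regular_embedding f -> forall x, fourCycle C n x -> fourCycle C n' (f x).
Proof. by case=> [[[sf _ _] _] _] x; exact: sf. Qed.

(** * The two implications *)

Section Classification.
Variables (R : realType) (S S' : system R[i]).
Hypotheses (genS : generic_system S) (genS' : generic_system S').
Variables (B B' : cstarAlgType R[i]).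
Variables (iota : forall k, blockmx R[i] (bsize S k) -> B).
Variables (iota' : forall k, blockmx R[i] (bsize S' k) -> B').
Hypotheses (lim : cstar_limit iota) (lim' : cstar_limit iota').

Lemma iso_regular : odd_system S -> odd_system S' ->
  star_ext_isomorphic (operator_limit iota) (operator_limit iota') -> regularly_isomorphic S S'.
Proof.
move=> /odd_eventually[K hK] /odd_eventually[K' hK'] [f [[ff fi fs] _ [F [Fb hF Ff]]]].
rewrite !operator_limit_generates // in Fb hF.
have [_ Fi Fs] := Fb; have iF : injective F by move=> x y; apply: Fi; rewrite inE.
have /choice[G GK] : forall y, exists x, F x = y.
  by move=> y; have [x _ <-] := Fs y I; exists x.
have FK : cancel F G by move=> x; apply: iF; rewrite GK.
have hG : star_hom G.
  apply: star_homP => [c x y|x y|x]; apply: iF; rewrite GK.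
  - by rewrite (shomD hF) (shomZ hF) !GK.
  - by rewrite (shomM hF) !GK.
  - by rewrite (shomA hF) !GK.
(* Both towers start past their last connecting map of even multiplicity, hence the shifts of the
   final indices. *)
pose T := limit_tower genS lim K (n := fun i => (i + K)%N) (fun i => ltnSn _).
pose T' := limit_tower genS' lim' K' (n := fun i => (i + K')%N) (fun i => ltnSn _).
have sT : strict T by apply: limit_tower_strict => // i; exact: leq_addl.
have sT' : strict T' by apply: limit_tower_strict => // i; exact: leq_addl.
have FG : tower_iso T T' F G.
  split=> // b /limit_tower_inA hb; apply/limit_tower_inA.
    by rewrite Ff //; exact: ff.
  by have [a ha <-] := fs b hb; rewrite -Ff // FK.
have [n [m [phi [psi [nm_lt reg psiphi phipsi]]]]] := crossover FG sT sT'.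
exists (fun i => n i + K)%N, (fun i => m i + K')%N, phi, psi; split=> // i.
- by have [h1 h2] := nm_lt i; rewrite !ltn_add2r.
- have [h1 _] := nm_lt i; have [r1 r2] := reg i.
  apply/(is_connP genS lim); first by rewrite leq_add2r ltnW.
    by move=> x hx; apply: (regular_stage r2); exact: (regular_stage r1).
  by move=> x _; exact: psiphi.
- have [_ h1] := nm_lt i; have [_ r1] := reg i; have [r2 _] := reg i.+1.
  apply/(is_connP genS' lim'); first by rewrite leq_add2r ltnW.
    by move=> x hx; apply: (regular_stage r2); exact: (regular_stage r1).
  by move=> x _; exact: phipsi.
Qed.

Lemma regular_iso : regularly_isomorphic S S' ->
  star_ext_isomorphic (operator_limit iota) (operator_limit iota').
Proof.
case=> n [m [phi [psi [nm_lt reg psiphi phipsi]]]].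
have ltn_ i : (n i < n i.+1)%N by case: (nm_lt i).
have ltm_ i : (m i < m i.+1)%N by case: (nm_lt i).
have /dep_choice[Phi hPhi] : forall i, exists Phi, star_extension (phi i) Phi.
  by move=> i; have [[[_ h] _] _] := reg i.
have /dep_choice[Psi hPsi] : forall i, exists Psi, star_extension (psi i) Psi.
  by move=> i; have [_ [[_ h] _]] := reg i.
have hphi i : star_hom (Phi i) by case: (hPhi i).
have hpsi i : star_hom (Psi i) by case: (hPsi i).
have sphi i x (hx : fourCycle _ _ x) := regular_stage (reg i).1 hx.
have spsi i x (hx : fourCycle _ _ x) := regular_stage (reg i).2 hx.
(* The diagram commutes by hypothesis on the 4-cycle algebra; two star homomorphisms that agree
   there agree on the matrix algebra it generates. *)
have PP i x : iota (Psi i (Phi i x)) = iota x.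
  have h := shom_comp (shom_comp (hphi i) (hpsi i)) (iota_hom lim (n i.+1)).
  move: x; apply: (iota_agree lim h) => x hx /=.
  rewrite (hPhi i).2 // (hPsi i).2; last exact: sphi.
  have sf y : stage S (n i) y -> stage S (n i.+1) ((psi i \o phi i) y).
    by move=> hy; apply: spsi; exact: sphi.
  exact: ((is_connP genS lim (ltnW (ltn_ i)) sf).1 (psiphi i) x hx).
have PP' i x : iota' (Phi i.+1 (Psi i x)) = iota' x.
  have h := shom_comp (shom_comp (hpsi i) (hphi i.+1)) (iota_hom lim' (m i.+1)).
  move: x; apply: (iota_agree lim' h) => x hx /=.
  rewrite (hPsi i).2 // (hPhi i.+1).2; last exact: spsi.
  have sf y : stage S' (m i) y -> stage S' (m i.+1) ((phi i.+1 \o psi i) y).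
    by move=> hy; apply: sphi; exact: spsi.
  exact: ((is_connP genS' lim' (ltnW (ltm_ i)) sf).1 (phipsi i) x hx).
have iphi i : injective (Phi i) by move=> x y e; apply: (iota_inj lim); rewrite -PP e PP.
have ipsi i : injective (Psi i) by move=> x y e; apply: (iota_inj lim'); rewrite -PP' e PP'.
pose T := limit_tower genS lim 0 ltn_.
pose T' := limit_tower genS' lim' 0 ltm_.
(* [Psi i] lands in stage n (i+1), which is level i of this shifted tower; [T] and [T1] have the
   same limit. *)
pose T1 := limit_tower genS lim 0 (fun i => ltn_ i.+1).
have [F [hF nF FE]] : exists F : B -> B', [/\ star_hom F, forall b, nm (F b) = nm b &
    forall i x, F (iota x) = iota' (Phi i x)].
  apply: (@ext_hom _ _ _ T T' Phi hphi iphi) => i x y yx.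
  have -> : y = Psi i (Phi i x) by apply: (iota_inj lim); rewrite PP.
  exact: PP'.
have [G [hG nG GE]] : exists G : B' -> B, [/\ star_hom G, forall b, nm (G b) = nm b &
    forall i x, G (iota' x) = iota (Psi i x)].
  apply: (@ext_hom _ _ _ T' T1 Psi hpsi ipsi) => i x y yx.
  have -> : y = Phi i.+1 (Psi i x) by apply: (iota_inj lim'); rewrite PP'.
  exact: PP.
have FK : cancel F G.
  apply: (dense_fix (T := T) (shom_comp hF hG)) => [b|i x] /=; first by rewrite nG nF.
  by rewrite FE GE PP.
have GK : cancel G F.
  apply: (dense_fix (T := T') (shom_comp hG hF)) => [b|i x] /=; first by rewrite nF nG.
  by rewrite GE FE PP'.
have FA b : operator_limit iota b -> operator_limit iota' (F b).
  move=> /(limit_tower_inA genS lim 0 ltn_) hb; apply/(limit_tower_inA genS' lim' 0 ltm_).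
  apply: (inA_hom hF nF _ hb) => i x hx; rewrite /= FE (hPhi i).2 //.
  by apply: (ti_inA (T := T') (k := i)); exact: sphi.
have GA b : operator_limit iota' b -> operator_limit iota (G b).
  move=> /(limit_tower_inA genS' lim' 0 ltm_) hb.
  apply/(limit_tower_inA genS lim 0 (fun i => ltn_ i.+1)).
  apply: (inA_hom hG nG _ hb) => i x hx; rewrite /= GE (hPsi i).2 //.
  by apply: (ti_inA (T := T1) (k := i)); exact: spsi.
exists F; split.
- split=> // [x y _ _|y hy]; first exact: (can_inj FK).
  by exists (G y); [exact: GA|exact: GK].
- by split=> [c x y _ _|x y _ _]; [rewrite (shomD hF) (shomZ hF)|exact: (shomM hF)].
exists F; split=> //; rewrite !operator_limit_generates //.
split=> // [x y _ _|y _]; first exact: (can_inj FK).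
by exists (G y); [|exact: GK].
Qed.

End Classification.

Local Open Scope complex_scope.

Theorem theorem6p7 (R : realType) (S S' : system R[i])
    (genS : generic_system S) (genS' : generic_system S')
    (oddS : odd_system S) (oddS' : odd_system S')
    (B B' : cstarAlgType R[i])
    (iota : forall k, blockmx R[i] (bsize S k) -> B)
    (iota' : forall k, blockmx R[i] (bsize S' k) -> B')
    (limB : cstar_limit iota) (limB' : cstar_limit iota') :
  star_ext_isomorphic (operator_limit iota) (operator_limit iota') <->
  regularly_isomorphic S S'.
Proof. by split; [exact: iso_regular|exact: regular_iso]. Qed.
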